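(* Let $p \in [2,\infty)$ and let $q$ be defined by $\frac1p + \frac1q = 1$. Let \[ K = \{ (x,y,z)^T \in \mathbb R^3 \mid 0 \leq z \leq x^{1/p}y^{1/q},\ x \geq 0,\ y \geq 0\}, \] and let $F$ be the canonical potential of $K$. For $\xi > 0$ define \[ t(\xi) = \left(\sqrt{\xi + p + q - 1}+\sqrt{p+q}\right)\left(\frac{\xi}{(\sqrt{\xi + p + q - 1}+\sqrt{p+q-1})^2}\right)^{\frac{\sqrt{p+q-1}}{\sqrt{p+q}}} \left(\frac{\sqrt{\xi + p + q - 1}+\sqrt{q-1}}{\xi+p}\right)^{\frac{1}{p}}\left(\frac{\sqrt{\xi + p + q - 1}+\sqrt{p-1}}{\xi+q}\right)^{\frac{1}{q}}. \] Then the level set $\{F = 0\}$, which is a complete hyperbolic affine sphere asymptotic to $\partial K$, is given by the hypersurface immersion \[ (0,\infty) \times \mathbb R \ni \begin{pmatrix} \xi \\ \mu \end{pmatrix} \mapsto \begin{pmatrix} x \\ y \\ z \end{pmatrix} = \left(1+\frac{\xi\sqrt{\xi + p+q-1}}{\sqrt{p+q}}\right)^{\frac13} \begin{pmatrix} t(\xi)^{-\frac13}e^{\frac{q+1}{3q}\mu} \\ t(\xi)^{-\frac13}e^{-\frac{p+1}{3p}\mu} \\ t(\xi)^{\frac23}e^{-\frac{\mu(p-q)}{3(p+q)}} \end{pmatrix}. \]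
   Context: A convex cone in $\mathbb R^n$ is regular if it is closed, has non-empty interior, and contains no line. The canonical potential of a regular convex cone $K\subset\mathbb R^n$ is the unique smooth solution $F: K^o \to \mathbb R$ ($K^o$ the interior of $K$) of the Monge-Ampère problem $\det F'' = e^{2F}$, $F|_{\partial K} = +\infty$, $F'' \succ 0$, where $F''$ is the Hessian in the standard coordinates and the boundary condition means that $F(x) \to +\infty$ as $x$ tends to a boundary point of $K$. It is known that this solution exists and is unique, and that the complete hyperbolic affine spheres asymptotic to the boundary of $K$ (in the sense of equiaffine differential geometry: convex hypersurfaces whose affine normals all meet at the vertex of $K$, which separate their convex hull from that point, and which are complete in the affine metric) are exactly the level sets of $F$; they are related to each other by homotheties.
   Formalization: The canonical potential is additionally required to satisfy F(lx) = F(x) − n ln l for l > 0, since the Monge-Ampère problem with blow-up only at finite boundary points has no unique solution (on the orthant, −Σ ln sinh x_i also solves it). *)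

(* Defs.v *)
From HB Require Import structures.
From mathcomp Require Import all_boot all_order all_algebra.
From mathcomp Require Import all_classical all_reals all_analysis.
Import Order.TTheory GRing.Theory Num.Theory.
Import numFieldNormedType.Exports.

Set Implicit Arguments.
Unset Strict Implicit.
Unset Printing Implicit Defensive.

Local Open Scope classical_set_scope.
Local Open Scope ring_scope.

(* Points of R^n are row vectors, as for the library's jacobian 'J. *)

(* C^k on an open set U. In the finite-dimensional spaces used below, the
   existence and continuity on U of all iterated directional derivatives up to
   order k is equivalent to being k times continuously differentiable. *)
Fixpoint Ck_on (R : realType) (V W : normedModType R) (k : nat)
    (U : set V) (f : V -> W) : Prop :=
  (forall x, U x -> {for x, continuous f}) /\
  if k is k'.+1 then
    forall v, (forall x, U x -> derivable f x v) /\ Ck_on k' U ('D_v f)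
  else True.

Definition smooth_on (R : realType) (V W : normedModType R)
    (U : set V) (f : V -> W) : Prop :=
  forall k, Ck_on k U f.

Definition posdef (R : realType) (n : nat) (A : 'M[R]_n) : Prop :=
  forall v : 'rV[R]_n, v != 0 -> 0 < (v *m A *m v^T) 0 0.

Definition hessian (R : realType) (n : nat) (F : 'rV[R]_n -> R)
    (x : 'rV[R]_n) : 'M[R]_n :=
  \matrix_(i, j) 'D_(delta_mx 0 j) ('D_(delta_mx 0 i) F) x.

Definition boundary (T : topologicalType) (A : set T) : set T :=
  closure A `\` A°.

(* [F] is the canonical potential of the regular convex cone [K] of R^n; its
   values outside the interior of [K] are irrelevant.
   The last clause, logarithmic homogeneity, is what singles out one solution.
   If x |-> F x solves the Monge-Ampere problem, then so does
   x |-> F (l *: x) + n ln l for every l > 0, so that logarithmic homogeneity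
   is part of the assertion that the canonical potential is *the* solution.
   It cannot be left out: since K is unbounded, the equation, convexity and the
   blow-up at the (finite) boundary points do not determine F. For instance, on
   the orthant of R^n, both - \sum_i ln x_i and - \sum_i ln (sinh x_i) satisfy
   them. *)
Definition canonical_potential (R : realType) (n : nat) (K : set 'rV[R]_n)
    (F : 'rV[R]_n -> R) : Prop :=
  [/\ smooth_on K° F,
      forall x, K° x -> posdef (hessian F x),
      forall x, K° x -> \det (hessian F x) = expR (2 * F x),
      forall b, boundary K b -> F @ within K° (nbhs b) --> +oo &
      forall x l, K° x -> 0 < l -> F (l *: x) = F x - n%:R * ln l].

Definition immersion (R : realType) (U : set 'rV[R]_2)
    (f : 'rV[R]_2 -> 'rV[R]_3) : Prop :=
  smooth_on U f /\ forall u, U u -> injective ('d f u).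

(* [N] is the affine normal field and [h] the affine (Blaschke) metric of the
   locally strongly convex immersion [f]: N is the transversal field, with
   Gauss formula D_v D_w f = tangential part + h(v, w) N, such that the
   derivatives of N are tangential and the volume form det (., ., N) induced on
   the surface is the volume form of h. Requiring h to be positive definite
   fixes the sign of N, which then points to the concave side. *)
Definition affine_normal_metric (R : realType) (U : set 'rV[R]_2)
    (f : 'rV[R]_2 -> 'rV[R]_3) (N : 'rV[R]_2 -> 'rV[R]_3)
    (h : 'rV[R]_2 -> 'M[R]_2) : Prop :=
  smooth_on U N /\
  forall u, U u ->
  [/\ posdef (h u),
      forall v w, exists z,
        'D_v ('D_w f) u = 'd f u z + (v *m h u *m w^T) 0 0 *: N u,
      forall v, exists z, 'D_v N u = 'd f u z &
      (\det (col_mx ('J f u) (N u) : 'M[R]_3)) ^+ 2 = \det (h u)].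

Definition speed (R : realType) (h : 'rV[R]_2 -> 'M[R]_2) (c : R -> 'rV[R]_2)
    (t : R) : R :=
  Num.sqrt (('D_1 c t *m h (c t) *m ('D_1 c t)^T) 0 0).

(* Completeness of the Riemannian metric [h] on [U]: every C^1 curve in U that
   eventually leaves each compact subset of U has infinite length. *)
Definition complete_metric (R : realType) (U : set 'rV[R]_2)
    (h : 'rV[R]_2 -> 'M[R]_2) : Prop :=
  forall c : R -> 'rV[R]_2,
    @Ck_on R R^o 'rV[R]_2 1 `]0, +oo[ c ->
    (forall t, 0 < t -> U (c t)) ->
    (forall C, compact C -> C `<=` U -> \forall t \near +oo, ~ C (c t)) ->
    (\int[lebesgue_measure]_(t in `]0%R, +oo[) (speed h c t)%:E = +oo)%E.

Definition convex_hull (R : realType) (n : nat) (A : set 'rV[R]_n) :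
    set 'rV[R]_n :=
  \bigcap_(C in [set C | @convex_set R 'rV[R]_n C /\ A `<=` C]) C.

Definition convex_hypersurface (R : realType) (n : nat) (M : set 'rV[R]_n) :
    Prop :=
  M `<=` boundary (convex_hull M).

(* [M] lies between the origin and its convex hull. *)
Definition separates_hull_from_origin (R : realType) (n : nat)
    (M : set 'rV[R]_n) : Prop :=
  ~ convex_hull M 0 /\
  forall x, convex_hull M x -> exists2 s : R, 0 <= s <= 1 & M (s *: x).

Definition asymptotic_to_boundary (R : realType) (n : nat)
    (K M : set 'rV[R]_n) : Prop :=
  M `<=` K° /\
  forall e : R, 0 < e -> exists A : R, forall x, M x -> A < `|x| ->
    exists2 b, boundary K b & `|x - b| < e.

(* The surface immersed by [f] is a complete hyperbolic affine sphere with
   center the origin, asymptotic to the boundary of the cone [K]. *)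
Definition complete_hyperbolic_affine_sphere (R : realType)
    (K : set 'rV[R]_3) (U : set 'rV[R]_2) (f : 'rV[R]_2 -> 'rV[R]_3) : Prop :=
  [/\ immersion U f,
      convex_hypersurface (f @` U),
      separates_hull_from_origin (f @` U),
      asymptotic_to_boundary K (f @` U) &
      exists N h, [/\ affine_normal_metric U f N h,
        forall u, U u -> exists s : R, f u + s *: N u = 0 &
        complete_metric U h]].

Definition power_cone (R : realType) (p q : R) : set 'rV[R]_3 :=
  [set v : 'rV[R]_3 | let x := v 0 0 in let y := v 0 1 in let z := v 0 2 in
     [/\ 0 <= z <= x `^ p^-1 * y `^ q^-1, 0 <= x & 0 <= y]].

Definition sphere_t (R : realType) (p q xi : R) : R :=
  let s := Num.sqrt (xi + p + q - 1) in
  (s + Num.sqrt (p + q))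
  * (xi / (s + Num.sqrt (p + q - 1)) ^+ 2)
      `^ (Num.sqrt (p + q - 1) / Num.sqrt (p + q))
  * ((s + Num.sqrt (q - 1)) / (xi + p)) `^ p^-1
  * ((s + Num.sqrt (p - 1)) / (xi + q)) `^ q^-1.

Definition sphere_param (R : realType) (p q : R) (u : 'rV[R]_2) : 'rV[R]_3 :=
  let xi := u 0 0 in let mu := u 0 1 in
  let t := sphere_t p q xi in
  (1 + xi * Num.sqrt (xi + p + q - 1) / Num.sqrt (p + q)) `^ 3^-1 *:
  \row_(i < 3)
    [:: t `^ (- 3^-1) * expR ((q + 1) / (3 * q) * mu);
        t `^ (- 3^-1) * expR (- ((p + 1) / (3 * p)) * mu);
        t `^ (2 / 3) * expR (- (mu * (p - q) / (3 * (p + q))))]`_i.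

(* Main.v *)
(* Write W = ln z - ln x / p - ln y / q, rho(xi) = 1 + xi sqrt(xi+p+q-1) /
   sqrt(p+q) and F0 = ln rho(xi) - ln(x y z), where xi > 0 is determined by ln
   t(xi) = W. A direct computation gives det F0'' = rho^2 / (x y z)^2 = exp(2
   F0), and F0 is logarithmically homogeneous, convex and blows up at the
   boundary of K. To see that F = F0 on the interior of K, compare two such
   potentials G1, G2 through linear maps A close to the identity that carry the
   nonzero points of K into its interior: at a minimum of G1 - G2 o A the
   Hessians are ordered, hence so are their determinants, which gives G1 >= G2 o
   A + ln det A; let A tend to the identity.

   On the immersed surface xyz = rho and W = ln t(xi), so that it is {F0 = 0}.
   There the position vector f satisfies a Gauss formula D_v D_w f = tangential
   part + H(v, w) f / 3, and det H is proportional to det(f_xi, f_mu, f)^2, so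
   that a constant multiple of f is the affine normal. The affine metric
   dominates multiples of (dxi / xi)^2 and dmu^2, hence is complete. Convexity
   of {F0 <= 0} and homogeneity of F0 describe the convex hull of the surface. *)
Require Import Defs.
From HB Require Import structures.
From mathcomp Require Import all_boot all_order all_algebra.
From mathcomp Require Import all_classical all_reals all_analysis.
From mathcomp Require Import measurable_realfun ring lra.
Import Order.TTheory GRing.Theory Num.Theory.
Import numFieldNormedType.Exports.
Set Implicit Arguments.
Unset Strict Implicit.
Unset Printing Implicit Defensive.
Local Open Scope classical_set_scope.
Local Open Scope ring_scope.

(** * Derivatives along lines *)

(** The formulas are governed by the relation d ln rho = xi d ln t: as a function of W, ln rho has
    derivative xi and second derivative 1 / tau, where tau = d ln t / d xi. After scaling by the
    coordinates, the Hessian of F0 is therefore a diagonal matrix plus a rank-one term with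
    coefficient 1 / tau, and the Monge-Ampere equation is an algebraic identity in xi and sqrt(xi +
    p + q - 1). The diagonal entry 1 - xi is negative for xi > 1, so that convexity rests on a lower
    bound for 1 / tau.

    Smoothness and the Hessian are stated through iterated directional derivatives, while F0
    contains the implicitly given xi. The comparison is therefore phrased with second derivatives
    along lines: for F they come from the Hessian by symmetry of mixed derivatives, for F0 from
    one-variable calculus.

    The maps A secure the existence of the minimum: at boundary points of K other than 0, G1 is
    infinite while G2 o A stays finite. *)

Lemma approx_eq (R : realType) (W : normedModType R) (a b : W) :
  (forall e : R, 0 < e -> exists c : W, `|a - c| < e /\ `|b - c| < e) -> a = b.
Proof.
move=> ab; apply/eqP; rewrite -subr_eq0 -normr_le0; apply/ler_addgt0Pl => e e0.
have [|c [ac bc]] := ab (e / 2); first by rewrite divr_gt0.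
rewrite addr0; apply: le_trans (ler_distD c _ _) _.
by rewrite [e]splitr [X in _ + X]distrC; apply/ltW/ltrD.
Qed.

Lemma subrACA (W : zmodType) (a b c d : W) : a - b - (c - d) = a - c - (b - d).
Proof. by rewrite !opprB addrACA [in RHS]addrACA; congr (_ + _); rewrite addrC. Qed.

Section LineDerivatives.
Context {R : realType} {V : normedModType R}.
Implicit Types (f g : V -> R) (x v w : V).

(** Reduces directional derivatives to derivatives of functions on R, where the chain rule and the
    mean value theorem are at hand. *)
Lemma is_derive_lineP (W : normedModType R) (f : V -> W) x v (t : R) (d : W) :
  is_derive (x + t *: v) v f d <-> is_derive t 1 (fun s : R => f (x + s *: v)) d.
Proof.
have E : (fun h : R => h^-1 *: ((f \o shift (x + t *: v)) (h *: v) - f (x + t *: v))) =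
         (fun h : R => h^-1 *: (((fun s : R => f (x + s *: v)) \o shift t) (h *: 1)
                                - f (x + t *: v))).
  apply/funext => h /=; congr (_ *: (f _ - _)).
  by rewrite [h *: 1]mulr1 scalerDl addrCA.
split=> -[ex val]; split.
- by move: ex; rewrite /derivable E.
- by move: val; rewrite /derive E.
- by move: ex; rewrite /derivable E.
- by move: val; rewrite /derive E.
Qed.

Lemma is_derive_translate f a x v (d : R) :
  is_derive (x + a) v f d -> is_derive x v (fun y => f (y + a)) d.
Proof.
have E : (fun h : R => h^-1 *: ((f \o shift (x + a)) (h *: v) - f (x + a))) =
         (fun h : R => h^-1 *: (((fun y => f (y + a)) \o shift x) (h *: v) - f (x + a))).
  by apply/funext => h /=; rewrite addrA.
by move=> -[ex val]; split; [move: ex; rewrite /derivable E|move: val; rewrite /derive E].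
Qed.

Lemma is_derive_line0 (W : normedModType R) (f : V -> W) x v (d : W) :
  is_derive x v f d -> is_derive (0 : R) 1 (fun s : R => f (x + s *: v)) d.
Proof. by move=> H; apply/is_derive_lineP; rewrite scale0r addr0. Qed.

Lemma is_deriveZ_dir f x v a d : is_derive x v f d -> is_derive x (a *: v) f (a * d).
Proof.
move=> /is_derive_line0 H.
have H2 : is_derive (0 : R) 1 (( *%R a) : R -> R) a.
  have -> : ( *%R a : R -> R) = a \*: (@id R) by apply/funext.
  by apply: is_derive_eq; rewrite [LHS]mulr1.
have H3 : is_derive (a * 0) 1 (fun s : R => f (x + s *: v)) d by rewrite mulr0.
have := is_derive1_comp H3 H2; rewrite mulrC => H4.
have := (is_derive_lineP f x (a *: v) 0 (a * d)).2.
rewrite scale0r addr0; apply.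
suff -> : (fun s : R => f (x + s *: (a *: v))) = (fun s : R => f (x + s *: v)) \o *%R a by [].
by apply/funext => s /=; rewrite scalerA mulrC.
Qed.

Lemma deriveZ_dir f x v a : derivable f x v -> 'D_(a *: v) f x = a * 'D_v f x.
Proof. by move=> /derivableP/(is_deriveZ_dir a) [_]. Qed.

Lemma MVT_line f x v : (forall s : R, 0 <= s <= 1 -> derivable f (x + s *: v) v) ->
  exists2 s : R, 0 <= s <= 1 & f (x + v) - f x = 'D_v f (x + s *: v).
Proof.
move=> df.
have df' (s : R) : 0 <= s <= 1 ->
    is_derive s 1 (fun s : R => f (x + s *: v)) ('D_v f (x + s *: v)).
  by move=> /df /derivableP /is_derive_lineP.
have [||c] := @MVT_segment R (fun s : R => f (x + s *: v)) (fun s => 'D_v f (x + s *: v)) 0 1 ler01.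
- by move=> s; rewrite in_itv /= => /andP[/ltW s0 /ltW s1]; apply: df'; rewrite s0.
- apply: derivable_within_continuous => s; rewrite in_itv /= => /df' [].
  by [].
- rewrite in_itv /= scale0r addr0 scale1r subr0 mulr1 => c01 E.
  by exists c.
Qed.

Lemma normZ_le (a h : R) (u : V) : 0 <= a <= 1 -> `|(a * h) *: u| <= `|h| * `|u|.
Proof.
move=> /andP[a0 a1]; rewrite normrZ ler_wpM2r //.
by have := normrM a h; rewrite (ger0_norm a0) => ->; rewrite ler_piMl.
Qed.

Lemma nbhs_ball3 x (A B C : set V) : nbhs x A -> nbhs x B -> nbhs x C ->
  exists2 r : R, 0 < r & forall y, ball x r y -> [/\ A y, B y & C y].
Proof.
move=> nA nB nC.
have /nbhs_ballP[r /= r0 Hr] : nbhs x (A `&` (B `&` C)).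
  by apply: filterI => //; exact: filterI.
by exists r => // y /Hr[? [? ?]].
Qed.

(** [Ck_on] provides directional derivatives only, so additivity in the direction has to come from
    their continuity: the increment from x to x + h (v + w) is split at x + h v, and the mean value
    theorem is applied on each leg. *)
Lemma deriveD_dir (U : set V) f x v w : open U -> U x ->
  (forall y, U y -> derivable f y v) -> (forall y, U y -> derivable f y w) ->
  {for x, continuous ('D_v f)} -> {for x, continuous ('D_w f)} ->
  is_derive x (v + w) f ('D_v f x + 'D_w f x).
Proof.
move=> oU Ux dv dw cv cw.
suff C : h^-1 *: ((f \o shift x) (h *: (v + w)) - f x) @[h --> 0^'] -->
    'D_v f x + 'D_w f x.
  by split; [exact: (cvgP _ C)|exact/cvg_lim].
apply/cvgrPdist_lt => e e0.
have e2 : 0 < e / 2 by rewrite divr_gt0.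
move/cvgrPdist_lt : cv => /(_ _ e2) cv; move/cvgrPdist_lt : cw => /(_ _ e2) cw.
have [r r0 Hr] := nbhs_ball3 (open_nbhs_nbhs (conj oU Ux)) cv cw.
have m0 : 0 < `|v| + `|w| + 1 by rewrite ltr_wpDl // addr_ge0.
near=> h.
have hn0 : h != 0 by near: h; exact: nbhs_dnbhs_neq.
have hr : `|h| * (`|v| + `|w|) < r.
  have /le_lt_trans : `|h| * (`|v| + `|w|) <= `|h| * (`|v| + `|w| + 1).
    by rewrite ler_wpM2l // lerDl.
  apply.
  rewrite -ltr_pdivlMr //; near: h; apply: dnbhs0_lt; exact: divr_gt0.
have inB (a b : R) : 0 <= a <= 1 -> 0 <= b <= 1 -> ball x r (x + (a * h) *: v + (b * h) *: w).
  move=> /andP[a0 a1] /andP[b0 b1].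
  rewrite -ball_normE /ball_ /= -addrA opprD addrA subrr add0r normrN.
  apply: le_lt_trans (ler_normD _ _) _; apply: le_lt_trans hr.
  rewrite mulrDr lerD // normZ_le //; exact/andP.
have B0 (a : R) : 0 <= a <= 1 -> ball x r (x + (a * h) *: v).
  move=> /(inB a 0); rewrite lexx ler01 => /(_ isT).
  by rewrite mul0r scale0r addr0.
have [s|s s01 E1] := @MVT_line f x (h *: v).
  move=> /B0/Hr[+ _ _] => /dv /derivableP /(is_deriveZ_dir h) [].
  by rewrite scalerA.
have [s''|s' s01' E2] := @MVT_line f (x + h *: v) (h *: w).
  move=>  /(inB 1 s''); rewrite mul1r ler01 lexx => /(_ isT) /Hr[+ _ _].
  by move=> /dw /derivableP /(is_deriveZ_dir h) []; rewrite scalerA.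
rewrite /= [h *: _ + x]addrC.
have -> : f (x + h *: (v + w)) - f x =
    (f (x + h *: v + h *: w) - f (x + h *: v)) + (f (x + h *: v) - f x).
  by rewrite scalerDr !addrA subrK.
rewrite E1 E2 scalerA scalerA.
have := B0 _ s01 => /Hr [/dv d1 b1 _].
have := inB 1 s'; rewrite mul1r ler01 lexx => /(_ isT s01') /Hr [/dw d2 _ b2].
rewrite !deriveZ_dir // -mulrDr [_ *: _]mulrA mulVf // mul1r.
rewrite [X in _ - X]addrC opprD addrACA.
by apply: le_lt_trans (ler_normD _ _) _; rewrite [ltRHS]splitr ltrD.
Unshelve. all: by end_near. Qed.

(** The second difference of f over the parallelogram spanned by h v and h w is symmetric in v and
    w. Two mean value steps turn it into h^2 times a mixed derivative at a nearby point, in either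
    order; continuity at x identifies the two values. *)
Lemma derive_commute (U : set V) f x v w : open U -> U x ->
  (forall y, U y -> derivable f y v) -> (forall y, U y -> derivable f y w) ->
  (forall y, U y -> derivable ('D_v f) y w) -> (forall y, U y -> derivable ('D_w f) y v) ->
  {for x, continuous ('D_w ('D_v f))} -> {for x, continuous ('D_v ('D_w f))} ->
  'D_w ('D_v f) x = 'D_v ('D_w f) x.
Proof.
move=> oU Ux dv dw dvw dwv cvw cwv.
apply: approx_eq => e e0.
move/cvgrPdist_lt : cvw => /(_ _ e0) cvw; move/cvgrPdist_lt : cwv => /(_ _ e0) cwv.
have [r r0 Hr] := nbhs_ball3 (open_nbhs_nbhs (conj oU Ux)) cvw cwv.
have m0 : 0 < `|v| + `|w| + 1 by rewrite ltr_wpDl // addr_ge0.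
pose h := r / 2 / (`|v| + `|w| + 1).
have h0 : 0 < h by rewrite !divr_gt0.
have hr : h * (`|v| + `|w|) < r.
  apply: (@le_lt_trans _ _ (h * (`|v| + `|w| + 1))).
    by rewrite ler_pM2l // lerDl.
  by rewrite /h divfK ?gt_eqF // gtr_pMr // invf_lt1 // (ltr_nat _ 1 2).
have inB (a b : R) : 0 <= a <= 1 -> 0 <= b <= 1 -> ball x r (x + (a * h) *: v + (b * h) *: w).
  move=> /andP[a0 a1] /andP[b0 b1].
  rewrite -ball_normE /ball_ /= -addrA opprD addrA subrr add0r normrN.
  apply: le_lt_trans (ler_normD _ _) _; apply: le_lt_trans hr.
  rewrite -{3}(gtr0_norm h0) mulrDr lerD // normZ_le //; exact/andP.
have key v' w' : (forall a b : R, 0 <= a <= 1 -> 0 <= b <= 1 ->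
      ball x r (x + (a * h) *: v' + (b * h) *: w')) ->
    (forall y, U y -> derivable f y v') ->
    (forall y, U y -> derivable ('D_v' f) y w') ->
    exists2 y, ball x r y &
     f (x + h *: v' + h *: w') - f (x + h *: w') - (f (x + h *: v') - f x) =
     h * (h * 'D_w' ('D_v' f) y).
  move=> inB' dv' dvw'.
  have B0 (a : R) : 0 <= a <= 1 -> U (x + (a * h) *: v').
    move=> /(inB' a 0); rewrite lexx ler01 => /(_ isT) /Hr[].
    by rewrite mul0r scale0r addr0.
  have B1 (a : R) : 0 <= a <= 1 -> U (x + (a * h) *: v' + h *: w').
    by move=> /(inB' a 1); rewrite lexx ler01 mul1r => /(_ isT) /Hr[].
  have dg (y : V) : U y -> U (y + h *: w') ->
      is_derive y (h *: v') (fun y => f (y + h *: w') - f y)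
        (h * ('D_v' f (y + h *: w') - 'D_v' f y)).
    move=> Uy Uyw; apply: is_deriveZ_dir; apply: is_deriveB; last exact/derivableP/dv'.
    exact/is_derive_translate/derivableP/dv'.
  have [s s01|s s01 E1] := @MVT_line (fun y => f (y + h *: w') - f y) x (h *: v').
    by rewrite scalerA; have [] := dg _ (B0 _ s01) (B1 _ s01).
  rewrite scalerA in E1.
  have [_ E2] := dg _ (B0 _ s01) (B1 _ s01).
  have [s' s01'|s' s01' E3] := @MVT_line ('D_v' f) (x + (s * h) *: v') (h *: w').
    have [/dvw' /derivableP dd _ _] := Hr _ (inB' _ _ s01 s01').
    by rewrite scalerA; have [] := is_deriveZ_dir h dd.
  exists (x + (s * h) *: v' + (s' * h) *: w'); first exact: inB'.
  have [/dvw' /derivableP dd _ _] := Hr _ (inB' _ _ s01 s01').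
  have [_ E4] := is_deriveZ_dir h dd.
  rewrite -E4 -[(s' * h) *: w']scalerA -E3 -E2 -E1 [x + _ + _]addrAC.
  rewrite !opprB addrACA [RHS]addrACA; congr (_ + _); exact: addrC.
have [y1 By1 E1] := key v w inB dv dvw.
have [|y2 By2 E2] := key w v _ dw dwv.
  by move=> a b a01 b01; rewrite addrAC; exact: inB.
have [_ b1 _] := Hr _ By1; have [_ _ b2] := Hr _ By2.
exists ('D_w ('D_v f) y1); split; first exact: b1.
suff -> : 'D_w ('D_v f) y1 = 'D_v ('D_w f) y2 by exact: b2.
have E3 : f (x + h *: v + h *: w) - f (x + h *: w) - (f (x + h *: v) - f x) =
    f (x + h *: w + h *: v) - f (x + h *: v) - (f (x + h *: w) - f x).
  by rewrite [x + h *: w + h *: v]addrAC; exact: subrACA.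
have E := etrans (esym E1) (etrans E3 E2).
exact: (mulfI (lt0r_neq0 h0) (mulfI (lt0r_neq0 h0) E)).
Qed.

End LineDerivatives.

Section ScalarDerivatives.
Context {R : realType} {V : normedModType R}.
Implicit Types (f g : V -> R) (x v : V) (a b c : R).

Lemma is_derive_subst f x v a b : is_derive x v f a -> a = b -> is_derive x v f b.
Proof. by move=> fa <-. Qed.

Lemma is_derive_add f g x v a b : is_derive x v f a -> is_derive x v g b ->
  is_derive x v (fun y => f y + g y) (a + b).
Proof. by move=> fa gb; exact: is_deriveD. Qed.

Lemma is_derive_mul f g x v a b : is_derive x v f a -> is_derive x v g b ->
  is_derive x v (fun y => f y * g y) (a * g x + f x * b).
Proof.
move=> fa gb; apply: is_derive_subst (is_deriveM fa gb) _.
by rewrite addrC; congr (_ + _); exact: mulrC.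
Qed.

Lemma is_derive_const c x v : is_derive x v (fun=> c) (0 : R).
Proof. exact: is_derive_cst. Qed.

Lemma is_derive_scale f x v a c : is_derive x v f a -> is_derive x v (fun y => c * f y) (c * a).
Proof.
move=> fa; apply: is_derive_subst (is_derive_mul (is_derive_const c x v) fa) _.
by rewrite mul0r add0r.
Qed.

Lemma is_derive_chain (h : R -> R) f x v a b : is_derive (f x) 1 h b -> is_derive x v f a ->
  is_derive x v (fun y => h (f y)) (b * a).
Proof.
move=> hb fa.
have F := is_derive_line0 fa.
have H : is_derive (f (x + 0 *: v)) 1 h b by rewrite scale0r addr0.
have := is_derive1_comp (g := fun s : R => f (x + s *: v)) H F.
move=> C; have := (is_derive_lineP (fun y => h (f y)) x v 0 (b * a)).2 C.
by rewrite scale0r addr0.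
Qed.

Lemma is_derive_lnf f x v a : 0 < f x -> is_derive x v f a ->
  is_derive x v (fun y => ln (f y)) (a / f x).
Proof. by move=> fx fa; rewrite mulrC; apply: is_derive_chain fa; exact: is_derive1_ln. Qed.

Lemma is_derive_expf f x v a : is_derive x v f a ->
  is_derive x v (fun y => expR (f y)) (expR (f x) * a).
Proof. by move=> fa; apply: is_derive_chain fa; exact: is_derive_expR. Qed.

Lemma is_derive_inv f x v a : f x != 0 -> is_derive x v f a ->
  is_derive x v (fun y => (f y)^-1) (- (a / f x ^+ 2)).
Proof.
move=> fx fa; have D : is_derive (f x) 1 (fun t : R => t^-1) (- (f x ^- 2)).
  have [ex vl] := @is_deriveV R id (f x) 1 1 fx (is_derive_id (f x) (1 : R)).
  by split; [exact: ex|rewrite vl; exact: mulr1].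
by apply: is_derive_subst (is_derive_chain D fa) _; rewrite mulNr mulrC.
Qed.

End ScalarDerivatives.

Definition deriv2 (R : realType) (f : R -> R) (t c : R) :=
  exists2 df : R -> R, (\forall s \near t, is_derive (s : R) 1 f (df s)) & is_derive t 1 df c.

Lemma deriv2B (R : realType) (f g : R -> R) (t c d : R) :
  deriv2 f t c -> deriv2 g t d -> deriv2 (f - g) t (c - d).
Proof.
move=> [df df1 df2] [dg dg1 dg2]; exists (df - dg); last exact: is_deriveB.
by apply: filterS2 df1 dg1 => s fs gs; exact: is_deriveB.
Qed.

Lemma dist_neg (R : realType) (c z : R) : `|c - z| < - c -> z < 0.
Proof. by rewrite ltr_norml => /andP[]; lra. Qed.

(** If c were negative, the first derivative, which vanishes at the minimum, would be negative just
    to the right of 0, and f would drop below f 0 by the mean value theorem. *)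
Lemma deriv2_min_ge0 (R : realType) (f : R -> R) (c : R) :
  deriv2 f 0 c -> (\forall s \near (0 : R), f 0 <= f s) -> 0 <= c.
Proof.
move=> [df df1 [cv Ec]] fmin; rewrite leNgt; apply/negP => c0.
have /cvgrPdist_lt /(_ _ (_ : 0 < - c)) : h^-1 *: ((df \o shift 0) (h *: 1) - df 0) @[h --> 0^'] --> c.
  by rewrite -Ec.
rewrite oppr_gt0 => /(_ c0) near_c.
have [e /= e0 He] : \forall s \near (0 : R), [/\ is_derive (s : R) 1 f (df s), f 0 <= f s &
    s != 0 -> s^-1 * (df s - df 0) < 0].
  near=> s; split; [near: s; exact: df1|near: s; exact: fmin|move=> s0].
  have : `|c - s^-1 *: ((df \o shift 0) (s *: 1) - df 0)| < - c.
    move: s0; near: s; exact: near_c.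
  by rewrite /= addr0 [s *: 1]mulr1; exact: dist_neg.
have {}He (s : R) : `|s| < e -> [/\ is_derive s 1 f (df s), f 0 <= f s &
    s != 0 -> s^-1 * (df s - df 0) < 0].
  by move=> se; apply: He; rewrite /ball_ /= sub0r normrN.
have e2 : 0 < e / 2 by rewrite divr_gt0.
have e2e : e / 2 < e by rewrite gtr_pMr // invf_lt1 // ltr1n.
have df0 : df 0 = 0.
  have [|d0 _ _] := He 0; first by rewrite normr0.
  have dd : forall t, t \in `](- (e / 2)), (e / 2)[ -> derivable f t 1.
    move=> t; rewrite in_itv /= => /andP[t1 t2].
    by have [|[]] := He t; first by rewrite ltr_norml; lra.
  have [|||_ E0] := @derive1_at_min R f (- (e / 2)) (e / 2) 0 _ dd; first by rewrite ge0_cp // ltW.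
  - by rewrite in_itv /= oppr_lt0 e2.
  - move=> t; rewrite in_itv /= => /andP[t1 t2].
    by have [|] := He t; first by rewrite ltr_norml; lra.
  by have [_ <-] := d0.
have [|d0 m0 _] := He (e / 2); first by rewrite gtr0_norm.
have [||t] := @MVT R f df 0 (e / 2) e2.
- move=> t; rewrite in_itv /= => /andP[t1 t2].
  by have [|] := He t; first by rewrite ltr_norml; lra.
- apply: derivable_within_continuous => t; rewrite in_itv /= => /andP[t1 t2].
  by have [|[]] := He t; first by rewrite ltr_norml; lra.
rewrite in_itv /= => /andP[t1 t2] E.
have [|_ _] := He t; first by rewrite gtr0_norm //; exact: lt_trans e2e.
rewrite gt_eqF // => /(_ isT); rewrite df0 subr0 pmulr_rlt0 ?invr_gt0 // => dt0.
by move: m0; rewrite -subr_ge0 E subr0 nmulr_rge0 // leNgt e2.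
Unshelve. all: by end_near. Qed.

Lemma cvg_rowP (R : realType) (T : Type) (F : set_system T) (FF : Filter F) n
    (f : T -> 'rV[R]_n) (l : 'rV[R]_n) :
  (forall j, f x 0 j @[x --> F] --> l 0 j) -> f x @[x --> F] --> l.
Proof.
move=> fl; apply/cvg_ballP => e e0.
have : \near F, forall j, ball (l 0 j) e (f F 0 j).
  by apply: filter_forall => j; exact: cvg_ball (fl j) _ e0.
by apply: filterS => x Hx; split=> // i j; rewrite (ord1 i); exact: Hx.
Qed.

Lemma cvg_line0 (R : realType) (V : normedModType R) (x v : V) :
  x + s *: v @[s --> (0 : R)] --> x.
Proof.
suff : x + s *: v @[s --> (0 : R)] --> x + 0 *: v by rewrite scale0r addr0.
by apply: cvgD; [exact: cvg_cst|apply: cvgZr_tmp; exact: cvg_id].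
Qed.

Lemma near_line (R : realType) (V : normedModType R) (U : set V) (x v : V) :
  open U -> U x -> \forall s \near (0 : R), U (x + s *: v).
Proof. by move=> oU Ux; apply: (@cvg_line0 R V x v U); exact: open_nbhs_nbhs. Qed.

Lemma cvg_line (R : realType) (V : normedModType R) (f : V -> R) (x v : V) :
  {for x, continuous f} -> f (x + s *: v) @[s --> 0^'+] --> f x.
Proof.
move=> cf; apply: cvg_at_right_filter.
exact: (@cvg_comp _ _ _ (fun s : R => x + s *: v) f _ _ _ (@cvg_line0 R V x v) cf).
Qed.

Lemma near_is_derive_line (R : realType) (V : normedModType R) (f : V -> R) (U : set V) (x v : V) :
  open U -> U x -> (forall y, U y -> derivable f y v) ->
  \forall s \near (0 : R),
    is_derive (s : R) 1 (fun s => f (x + s *: v)) ('D_v f (x + s *: v)).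
Proof.
move=> oU Ux df; apply: filterS (near_line v oU Ux) => s Us.
have H := (is_derive_lineP f x v s _).1 (derivableP (df _ Us)).
exact: H.
Qed.

(** * Comparison of determinants *)

Section SchurComplement.
Variables (F : realFieldType).

Definition qf n (A : 'M[F]_n) (v : 'rV[F]_n) : F := \sum_i \sum_j v 0 i * A i j * v 0 j.

Lemma qfE n (A : 'M[F]_n) v : (v *m A *m v^T) 0 0 = qf A v.
Proof.
rewrite mxE /qf exchange_big /=; apply: eq_bigr => j _.
by rewrite !mxE mulr_suml.
Qed.

Definition sym_posdef n (A : 'M[F]_n) :=
  (forall i j, A i j = A j i) /\ forall v, v != 0 -> 0 < qf A v.

Definition schur n (A : 'M[F]_(1 + n)) : 'M[F]_n :=
  drsubmx A - (A 0 0)^-1 *: (dlsubmx A *m ursubmx A).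

Lemma schurE n (A : 'M[F]_(1 + n)) i j : schur A i j =
  A (rshift 1 i) (rshift 1 j) - (A 0 0)^-1 * (A (rshift 1 i) 0 * A 0 (rshift 1 j)).
Proof.
rewrite !mxE big_ord1 !mxE /=.
by have -> : lshift n (0 : 'I_1) = 0 :> 'I_(1 + n) by apply/val_inj.
Qed.

Lemma det_schur n (A : 'M[F]_(1 + n)) : A 0 0 != 0 -> \det A = A 0 0 * \det (schur A).
Proof.
move=> a0.
have ul : ulsubmx A = (A 0 0)%:M.
  by rewrite [LHS]mx11_scalar !mxE; congr (A _ _)%:M; apply/val_inj.
have E : A *m block_mx 1%:M (- (A 0 0)^-1 *: ursubmx A) 0 1%:M =
         block_mx (A 0 0)%:M 0 (dlsubmx A) (schur A).
  rewrite -{1}[A]submxK mulmx_block !mulmx1 !mulmx0 !addr0 -!scalemxAr ul.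
  rewrite mul_scalar_mx scalerA mulNr mulVf // scaleN1r addNr.
  by rewrite /schur scaleNr addrC.
have /(congr1 determinant) := E.
by rewrite det_mulmx det_ublock !det1 !mulr1 det_lblock det_scalar1.
Qed.

Definition cross n (A : 'M[F]_(1 + n)) (y : 'rV[F]_n) : F := \sum_j A 0 (rshift 1 j) * y 0 j.

(** Completing the square in the first coordinate. *)
Lemma qf_schur n (A : 'M[F]_(1 + n)) (c : F) (y : 'rV[F]_n) :
  (forall i j, A i j = A j i) -> A 0 0 != 0 ->
  qf A (row_mx c%:M y) = A 0 0 * (c + cross A y / A 0 0) ^+ 2 + qf (schur A) y.
Proof.
move=> sA a0.
have l0 : lshift n (0 : 'I_1) = 0 :> 'I_(1 + n) by apply/val_inj.
have -> : qf (schur A) y = \sum_i \sum_j y 0 i * A (rshift 1 i) (rshift 1 j) * y 0 j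
    - (A 0 0)^-1 * cross A y ^+ 2.
  rewrite /cross expr2 big_distrlr mulr_sumr -sumrB; apply: eq_bigr => i _.
  rewrite mulr_sumr -sumrB; apply: eq_bigr => j _; rewrite schurE (sA (rshift 1 i) 0) /=.
  by ring.
rewrite /qf big_split_ord big_ord1 big_split_ord big_ord1 /= !row_mxEl l0 mxE eqxx mulr1n.
have -> : \sum_(i < n) c * A 0 (rshift 1 i) * row_mx c%:M y 0 (rshift 1 i) = c * cross A y.
  by rewrite mulr_sumr; apply: eq_bigr => i _; rewrite row_mxEr mulrA.
have -> : \sum_(i < n) \sum_(j < 1 + n)
      row_mx c%:M y 0 (rshift 1 i) * A (rshift 1 i) j * row_mx c%:M y 0 j =
    c * cross A y + \sum_(i < n) \sum_(j < n) y 0 i * A (rshift 1 i) (rshift 1 j) * y 0 j.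
  rewrite mulr_sumr -big_split; apply: eq_bigr => i _ /=.
  rewrite big_split_ord big_ord1 /= row_mxEl l0 row_mxEr mxE eqxx mulr1n sA; congr (_ + _).
    by ring.
  by apply: eq_bigr => j _; rewrite row_mxEr.
move: (cross A y) (\sum_i _) => u w.
by field.
Qed.

Lemma qf_row1 n (A : 'M[F]_(1 + n)) : qf A (row_mx 1%:M 0) = A 0 0.
Proof.
have l0 : lshift n (0 : 'I_1) = 0 :> 'I_(1 + n) by apply/val_inj.
rewrite /qf big_split_ord big_ord1 big_split_ord big_ord1 /= !row_mxEl l0 mxE eqxx mulr1n mul1r mulr1.
rewrite !big1 ?addr0 //= => i _; rewrite ?row_mxEr ?mxE ?mulr0 //=.
by rewrite big1 // => j _; rewrite !mul0r.
Qed.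

Lemma sym_posdef_gt0 n (A : 'M[F]_(1 + n)) : sym_posdef A -> 0 < A 0 0.
Proof.
move=> [sA pA]; have := pA (row_mx 1%:M 0).
rewrite qf_row1; apply; apply/eqP => /rowP /(_ (lshift n 0)); rewrite row_mxEl !mxE eqxx => /eqP.
by rewrite oner_eq0.
Qed.

Lemma sym_posdef_schur n (A : 'M[F]_(1 + n)) : sym_posdef A -> sym_posdef (schur A).
Proof.
move=> hA; have a0 := sym_posdef_gt0 hA; case: hA => sA pA; split.
  move=> i j; rewrite !schurE (sA (rshift 1 i)) (sA (rshift 1 i) 0) (sA 0 (rshift 1 j)).
  by rewrite [A 0 _ * _]mulrC.
move=> y y0; have := qf_schur (- (cross A y / A 0 0)) y sA (lt0r_neq0 a0).
rewrite addNr expr0n mulr0 add0r => <-; apply: pA.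
apply: contra y0 => /eqP E; apply/eqP/rowP => i; rewrite mxE.
by move/rowP: E => /(_ (rshift 1 i)); rewrite row_mxEr mxE.
Qed.

Lemma det_posdef_gt0 n (A : 'M[F]_n) : sym_posdef A -> 0 < \det A.
Proof.
elim: n A => [|n IH] A hA; first by rewrite det_mx00.
have a0 := sym_posdef_gt0 hA.
by rewrite (@det_schur n) ?gt_eqF // mulr_gt0 //; exact/IH/sym_posdef_schur.
Qed.

(** [qf (schur A) y] is the minimum of [qf A] over all vectors with tail y, so the order of two
    forms passes to their Schur complements as well as to their top left entries; [det_schur] then
    gives an induction. *)
Lemma det_posdef_le n (A B : 'M[F]_n) : sym_posdef A -> sym_posdef B ->
  (forall v, qf B v <= qf A v) -> \det B <= \det A.
Proof.
elim: n A B => [|n IH] A B hA hB AB; first by rewrite !det_mx00.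
have a0 := sym_posdef_gt0 hA; have b0 := sym_posdef_gt0 hB.
rewrite !(@det_schur n) ?gt_eqF //; apply: ler_pM; [exact: ltW| | |].
- exact/ltW/det_posdef_gt0/sym_posdef_schur.
- by have := AB (row_mx 1%:M 0); rewrite !qf_row1.
apply: IH; [exact: sym_posdef_schur|exact: sym_posdef_schur|move=> y].
(* At this first coordinate the square in [qf_schur] vanishes for A; for B it is merely
   nonnegative. *)
have := AB (row_mx (- (cross A y / A 0 0))%:M y).
rewrite (qf_schur _ _ hA.1 (lt0r_neq0 a0)) addNr expr0n mulr0 add0r.
rewrite (qf_schur _ _ hB.1 (lt0r_neq0 b0)); apply: le_trans.
by rewrite lerDr mulr_ge0 ?sqr_ge0 // ltW.
Qed.

Lemma qf_congr n (A M : 'M[F]_n) v : qf (A *m M *m A^T) v = qf M (v *m A).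
Proof. by rewrite -!qfE trmx_mul !mulmxA. Qed.

Lemma sym_posdef_congr n (A M : 'M[F]_n) : \det A != 0 -> sym_posdef M ->
  sym_posdef (A *m M *m A^T).
Proof.
move=> A0 [sM pM]; have uA : A \in unitmx by rewrite unitmxE unitfE.
have sMT : M^T = M by apply/matrixP => i j; rewrite mxE sM.
split; last first.
  move=> v v0; rewrite qf_congr; apply: pM.
  by apply: contra v0 => /eqP E; rewrite -[v](mulmxK uA) E mul0mx.
have /matrixP E : (A *m M *m A^T)^T = A *m M *m A^T by rewrite !trmx_mul trmxK sMT mulmxA.
by move=> i j; rewrite -[LHS]E mxE.
Qed.

Lemma det_congr n (A M : 'M[F]_n) : \det (A *m M *m A^T) = \det A ^+ 2 * \det M.
Proof. by rewrite !det_mulmx det_tr mulrAC. Qed.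

Lemma mulmxZ n (A : 'M[F]_n) (l : F) (x : 'rV_n) : (l *: x) *m A = l *: (x *m A).
Proof. by rewrite scalemxAl. Qed.

Lemma mulmx_line n (A : 'M[F]_n) (s : F) (x v : 'rV_n) :
  (x + s *: v) *m A = x *m A + s *: (v *m A).
Proof. by rewrite mulmxDl scalemxAl. Qed.

Lemma mulmx_shrink n (E : 'M[F]_n) (s : F) (x : 'rV_n) :
  x *m (1%:M + s *: E) = x + s *: (x *m E).
Proof. by rewrite mulmxDr mulmx1 scalemxAr. Qed.

End SchurComplement.

(** * Comparison of potentials *)

Section SmoothHessian.
Variables (R : realType) (n : nat).
Implicit Types (U : set 'rV[R]_n) (F g : 'rV[R]_n -> R) (x v : 'rV[R]_n).

Lemma C1_derive_sum U g x v : open U -> Ck_on 1 U g -> U x ->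
  'D_v g x = \sum_j v 0 j * 'D_(delta_mx 0 j) g x.
Proof.
move=> oU [_ Cg] Ux.
have dg w y : U y -> derivable g y w by have [d _] := Cg w; exact: d.
have cg w : {for x, continuous ('D_w g)} by have [_ [c _]] := Cg w; exact: c.
suff [_] : is_derive x v g (\sum_j v 0 j * 'D_(delta_mx 0 j) g x) by [].
rewrite {1}(row_sum_delta v).
apply: (big_rec2 (fun w d => is_derive x w g d)); first exact: is_derive0.
move=> j w d _ [_ <-].
rewrite -deriveZ_dir; last exact: dg.
by apply: (deriveD_dir oU Ux) => //; exact: dg.
Qed.

Lemma C2_C1 U F v : Ck_on 2 U F -> Ck_on 1 U ('D_v F).
Proof. by move=> [_ CF]; have [_ c] := CF v; exact: c. Qed.

Lemma Ck_derivable k U F v x : Ck_on k.+1 U F -> U x -> derivable F x v.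
Proof. by move=> [_ CF] Ux; have [d _] := CF v; exact: d. Qed.

Lemma Ck_derive_continuous k U F v x : Ck_on k.+1 U F -> U x -> {for x, continuous ('D_v F)}.
Proof. by move=> [_ CF] Ux; have [_ ck] := CF v; case: k CF ck => [|k] _ [c _]; exact: c. Qed.

Lemma C2_commute U F x v w : open U -> Ck_on 2 U F -> U x ->
  'D_w ('D_v F) x = 'D_v ('D_w F) x.
Proof.
move=> oU CF Ux.
have Cv := C2_C1 v CF; have Cw := C2_C1 w CF.
exact: (derive_commute oU Ux (fun y => @Ck_derivable _ _ _ v y CF)
  (fun y => @Ck_derivable _ _ _ w y CF) (fun y => @Ck_derivable _ _ _ w y Cv)
  (fun y => @Ck_derivable _ _ _ v y Cw) (Ck_derive_continuous Cv Ux) (Ck_derive_continuous Cw Ux)).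
Qed.

Lemma hessian_sym U F x i j : open U -> Ck_on 2 U F -> U x ->
  hessian F x i j = hessian F x j i.
Proof. by move=> oU CF Ux; rewrite !mxE (C2_commute _ _ oU CF Ux). Qed.

Lemma line_hessian U F x v : open U -> Ck_on 2 U F -> U x ->
  deriv2 (fun s => F (x + s *: v)) 0 (qf (hessian F x) v).
Proof.
move=> oU CF Ux.
exists (fun s => 'D_v F (x + s *: v)).
  exact: (@near_is_derive_line R _ F U x v oU Ux (fun y => @Ck_derivable _ _ _ v y CF)).
have -> : qf (hessian F x) v = 'D_v ('D_v F) x.
  rewrite (C1_derive_sum _ oU (C2_C1 _ CF) Ux).
  (* [C1_derive_sum] expands the outer direction only; exchanging the two derivatives lets it expand
     the other one. *)
  apply: eq_bigr => i _; rewrite (C2_commute _ _ oU CF Ux) (C1_derive_sum _ oU (C2_C1 _ CF) Ux).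
  rewrite mulr_sumr; apply: eq_bigr => j _; rewrite mxE -mulrA; congr (_ * _); exact: mulrC.
have D := derivableP (@Ck_derivable _ _ _ v x (C2_C1 v CF) Ux).
exact: (@is_derive_line0 R _ _ ('D_v F) x v _ D).
Qed.

End SmoothHessian.

Section Comparison.
Variables (R : realType) (n : nat) (K : set 'rV[R]_n).

(** What the comparison uses of a potential. The Hessian enters as a matrix M known through the
    second derivatives along lines, which is how the explicit potential can be handled. *)
Definition potential_like (G : 'rV[R]_n -> R) :=
  [/\ forall x : 'rV[R]_n, K° x -> {for x, continuous G},
      forall b : 'rV[R]_n, boundary K b -> G @ within K° (nbhs b) --> +oo,
      forall (x : 'rV[R]_n) (l : R), K° x -> 0 < l -> G (l *: x) = G x - n%:R * ln l &
      forall x : 'rV[R]_n, K° x -> exists M : 'M[R]_n,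
        [/\ sym_posdef M, \det M = expR (2 * G x) &
        forall v : 'rV[R]_n, deriv2 (fun s => G (x + s *: v)) 0 (qf M v)]].

Lemma canonical_potential_like F : canonical_potential K F -> potential_like F.
Proof.
move=> [sF pF dF bF hF].
have oK := @open_interior _ K.
split=> // x Kx; first by have [c _] := sF 0%N; exact: c.
exists (hessian F x); split; last by move=> v; exact: (line_hessian _ oK (sF 2%N) Kx).
  split; first by move=> i j; exact: (hessian_sym _ _ oK (sF 2%N) Kx).
  by move=> v v0; rewrite -qfE; exact: pF.
exact: dF.
Qed.

Variables (S : set 'rV[R]_n).
Hypotheses (cS : compact S) (SK : S `<=` closure K).
Hypothesis K_scale : forall (x : 'rV[R]_n) (l : R), K° x -> 0 < l -> K° (l *: x).
Hypothesis S_ray : forall x : 'rV[R]_n, K° x -> exists2 l : R, 0 < l & S (l *: x).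

Lemma continuous_mulmxr (A : 'M[R]_n) (x : 'rV[R]_n) :
  {for x, continuous (fun y : 'rV[R]_n => y *m A)}.
Proof.
apply: (@cvg_rowP R _ (nbhs x) (nbhs_filter x) n (fun y => y *m A)) => j.
suff -> : (fun y : 'rV[R]_n => (y *m A) 0 j) = (fun y : 'rV[R]_n => \sum_i y 0 i * A i j).
  rewrite mxE; apply: cvg_big => // [|i _]; first exact: add_continuous.
  by apply: cvgM; [exact: coord_continuous|exact: cvg_cst].
by apply/funext => y; rewrite mxE.
Qed.

(* G1 - G2 (. A) is constant on rays, so it has a minimum over the interior of K,
   attained on the compact section S. There the Hessian of G1 dominates that of
   G2 (. A), and the equation det = exp (2 G) turns the resulting inequality of
   determinants into the claim. *)
Lemma comparison_shrink G1 G2 (A : 'M[R]_n) : potential_like G1 -> potential_like G2 ->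
  0 < \det A -> (forall x : 'rV[R]_n, S x -> K° (x *m A)) ->
  forall x : 'rV[R]_n, K° x -> G2 (x *m A) + ln (\det A) <= G1 x.
Proof.
move=> [c1 b1 h1 d1] [c2 b2 h2 d2] A0 SA x1 Kx1.
have oK := @open_interior _ K.
pose phi (x : 'rV[R]_n) : R := G1 x - G2 (x *m A).
have KA (x : 'rV[R]_n) : K° x -> K° (x *m A).
  move=> Kx; have [l l0 Sl] := S_ray Kx.
  have il0 : 0 < l^-1 by rewrite invr_gt0.
  have := K_scale (SA _ Sl) il0.
  by rewrite mulmxZ scalerA (mulVf (lt0r_neq0 l0)) scale1r.
have phiZ (x : 'rV[R]_n) (l : R) : K° x -> 0 < l -> phi (l *: x) = phi x.
  move=> Kx l0; rewrite /phi mulmxZ (h1 _ _ Kx l0) (h2 _ _ (KA _ Kx) l0).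
  by rewrite subrACA subrr subr0.
have cphi2 (x : 'rV[R]_n) : S x -> {for x, continuous (fun y : 'rV[R]_n => G2 (y *m A))}.
  move=> Sx; apply: (@continuous_comp _ _ _ (fun y : 'rV[R]_n => y *m A) G2).
    exact: continuous_mulmxr.
  exact/c2/SA.
(* A minimum of phi is a maximum of exp (- phi). Extended by 0, this function is continuous on all
   of S: at a boundary point of K in S, G1 tends to +oo while G2 (y A) stays bounded, since S A lies
   in the interior. *)
pose psi (x : 'rV[R]_n) : R := if pselect (K° x) then expR (- phi x) else 0.
have psiE (x : 'rV[R]_n) : K° x -> psi x = expR (- phi x).
  by move=> Kx; rewrite /psi; case: pselect.
have psi0 (x : 'rV[R]_n) : ~ K° x -> psi x = 0.
  by move=> Kx; rewrite /psi; case: pselect.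
have cphi (x : 'rV[R]_n) : K° x -> S x -> {for x, continuous (fun y => expR (- phi y))}.
  move=> Kx Sx; apply: (@continuous_comp _ _ _ phi (fun t => expR (- t))).
    exact: (cvgB (c1 _ Kx) (cphi2 _ Sx)).
  by apply: continuous_comp; [exact: opp_continuous|exact: continuous_expR].
have cpsi (x : 'rV[R]_n) : S x -> psi y @[y --> within S (nbhs x)] --> psi x.
  move=> Sx; have [Kx|nKx] := pselect (K° x).
    apply: cvg_within_filter; rewrite (psiE _ Kx).
    apply: cvg_trans (cphi _ Kx Sx); apply: near_eq_cvg.
    by apply: filterS (open_nbhs_nbhs (conj oK Kx)) => y /psiE ->.
  have bx : boundary K x by split; [exact: SK|].
  rewrite (psi0 _ nKx).
  apply/cvgrPdist_lt => e e0.
  (* With this lower bound for G1 y, and G2 (y A) below G2 (x A) + 1, one gets - phi y < ln e. *)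
  have /cvgryPge /(_ (1 - ln e + (G2 (x *m A) + 1))) N1 := b1 _ bx.
  have gt1 : G2 (x *m A) < G2 (x *m A) + 1 by rewrite ltrDl.
  have /(_ (nbhs_filter x)) N2 := cvgr_lt _ (cphi2 _ Sx) _ gt1.
  rewrite near_withinE; rewrite near_withinE in N1.
  apply: filterS2 N1 N2 => y n1 n2 Sy; rewrite sub0r normrN.
  have [Ky|nKy] := pselect (K° y); last by rewrite psi0 // normr0.
  rewrite (psiE _ Ky) gtr0_norm ?expR_gt0 // -[ltRHS]lnK ?posrE // ltr_expR /phi.
  by move: (n1 Ky) n2; lra.
have [l1 l10 Sl1] := S_ray Kx1.
have [x0 Sx0 x0max] := EVT_max_rV (ex_intro _ _ Sl1) cS
  ((subspace_continuousP S psi).2 cpsi).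
have Kx0 : K° x0.
  apply: contrapT => nK; have := x0max _ (mem_set Sl1).
  rewrite (psiE _ (K_scale Kx1 l10)) (psi0 _ nK).
  by rewrite leNgt expR_gt0.
have min0 (x : 'rV[R]_n) : K° x -> phi x0 <= phi x.
  move=> Kx; have [l l0 Sl] := S_ray Kx.
  have := x0max _ (mem_set Sl).
  by rewrite (psiE _ Kx0) (psiE _ (K_scale Kx l0)) ler_expR lerN2 phiZ.
have [M1 [p1 e1 l1']] := d1 _ Kx0.
have [M2 [p2 e2 l2]] := d2 _ (KA _ Kx0).
have q12 (v : 'rV[R]_n) : qf (A *m M2 *m A^T) v <= qf M1 v.
  rewrite qf_congr -subr_ge0.
  apply: (@deriv2_min_ge0 R (fun s => phi (x0 + s *: v))).
    apply: deriv2B; first exact: l1'.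
    suff -> : (fun s : R => G2 ((x0 + s *: v) *m A)) = (fun s => G2 (x0 *m A + s *: (v *m A))) by [].
    by apply/funext => s; rewrite mulmx_line.
  rewrite scale0r addr0.
  by apply: filterS (near_line v oK Kx0) => s; exact: min0.
have := det_posdef_le p1 (sym_posdef_congr (lt0r_neq0 A0) p2) q12.
(* Writing det A as exp (ln det A), the comparison of determinants at x0 becomes ln det A <= phi
   x0. *)
rewrite det_congr e1 e2 -{1}[\det A]lnK ?posrE // -expRM_natl -expRD ler_expR => H.
have := min0 _ Kx1; rewrite /phi; lra.
Qed.

Lemma potential_le G1 G2 (E : 'M[R]_n) : potential_like G1 -> potential_like G2 ->
  (forall e : R, 0 < e -> 1 <= \det (1%:M + e *: E) /\
     forall x : 'rV[R]_n, S x -> K° (x *m (1%:M + e *: E))) ->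
  forall x : 'rV[R]_n, K° x -> G2 x <= G1 x.
Proof.
move=> p1 p2 HE x Kx; have [c2 _ _ _] := p2.
apply: (cvgr_to_le (cvg_line (x *m E) (c2 _ Kx))).
near=> e; have e0 : 0 < e by near: e; exact: nbhs_right_gt.
have [d1 SE] := HE _ e0.
have := comparison_shrink p1 p2 (lt_le_trans ltr01 d1) SE Kx.
rewrite mulmx_shrink; apply: le_trans; rewrite lerDl; exact: ln_ge0.
Unshelve. all: by end_near. Qed.

End Comparison.

(** * The function t *)

(** The computation behind the derivative of [logt], with s = rt x, a = sqrt(p + q), b = sqrt(p + q
    - 1), c = sqrt(p - 1) and d = sqrt(q - 1). In these letters p = c a and q = d a, so that both
    sides are rational. *)
Lemma logt_identity (R : realFieldType) (s a b c d x : R) :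
  c * d = 1 -> a = c + d -> b ^+ 2 = a ^+ 2 - 1 -> x = s ^+ 2 - b ^+ 2 ->
  s != 0 -> a != 0 -> c != 0 -> x != 0 ->
  s + a != 0 -> s + b != 0 -> s - d != 0 -> s - c != 0 ->
  (2 * s)^-1 / (s + a) + b / a * (1 / x + - (2 * ((2 * s)^-1 / (s + b))))
    - ((c * a)^-1 * ((2 * s)^-1 / (s - d))) - ((d * a)^-1 * ((2 * s)^-1 / (s - c))) =
  (3 * x + 2 * (a ^+ 2 - 1)) / (2 * x * s * (a + x * s)).
Proof.
move=> cd ea eb ex s0 a0 c0 x0 sa sb sd sc.
(* As a cubic in s, a + x s has the roots -a, c and d. *)
have eD : a + x * s = (s + a) * ((s - d) * (s - c)).
  have -> : x = s ^+ 2 - (c + d) ^+ 2 + c * d by rewrite ex eb ea cd; ring.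
  by rewrite ea -[LHS]mulr1 -[in LHS]cd; ring: cd.
have H : b / a * (1 / x + - (2 * ((2 * s)^-1 / (s + b)))) = (a ^+ 2 - 1) / (a * x * s).
  have xE : x = (s - b) * (s + b) by rewrite ex; ring.
  have sb' : s - b != 0 by apply: contra x0 => /eqP E; rewrite xE E mul0r.
  by rewrite -eb xE; field; rewrite s0 sb sb' a0.
rewrite H eD.
(* [field] takes the letters as independent, so d and a are eliminated in favour of c. *)
have dE : d = c^-1 by rewrite -[LHS](mulKf c0) cd mulr1.
have xE : x = s ^+ 2 - (c + c^-1) ^+ 2 + 1 by rewrite ex eb ea dE; ring.
rewrite dE in ea sd *; rewrite ea in a0 sa *.
have x0' : s ^+ 2 - (c + c^-1) ^+ 2 + 1 != 0 by rewrite -xE.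
have x0'' : s ^+ 2 * c ^+ 2 - (c ^+ 2 + 1) ^+ 2 + c ^+ 2 != 0.
  suff -> : s ^+ 2 * c ^+ 2 - (c ^+ 2 + 1) ^+ 2 + c ^+ 2 = x * c ^+ 2.
    by rewrite mulf_neq0 // expf_neq0.
  by rewrite xE; field.
have n1 : s * c - 1 != 0.
  have -> : s * c - 1 = c * (s - c^-1) by field.
  by rewrite mulf_neq0.
have n2 : s * c + (c * c + 1) != 0.
  have -> : s * c + (c * c + 1) = c * (s + (c + c^-1)) by field.
  by rewrite mulf_neq0.
have n3 : c * c + 1 != 0.
  have -> : c * c + 1 = c * (c + c^-1) by field.
  by rewrite mulf_neq0.
rewrite xE; field.
by rewrite c0 sc n1 n2 s0 exprMn -!expr2 x0'' expr2 n3.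
Qed.

Section Profile.
Variables (R : realType) (p q : R).
Hypotheses (hp : 2 <= p) (hpq : p^-1 + q^-1 = 1).

Local Notation P := (p + q).

Lemma p_gt0 : 0 < p. Proof. by move: hp; lra. Qed.

Lemma q_gt0 : 0 < q.
Proof.
rewrite -invr_gt0; have : p^-1 < 1 by rewrite invf_lt1 ?p_gt0 //; move: hp; lra.
by move: hpq; lra.
Qed.

Lemma P_mul : P = p * q.
Proof.
have p0 := p_gt0; have q0 := q_gt0.
have -> : p * q = p * q * (p^-1 + q^-1) by rewrite hpq mulr1.
by field; rewrite !gt_eqF.
Qed.

Lemma q_gt1 : 1 < q.
Proof. by have := P_mul; have := p_gt0; have := q_gt0; nra. Qed.

Lemma q_le2 : q <= 2.
Proof. by have := P_mul; have := hp; have := q_gt1; nra. Qed.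

Lemma P_ge4 : 4 <= P.
Proof. by have := P_mul; have := hp; have := q_gt1; nra. Qed.

Definition rt (x : R) : R := Num.sqrt (x + p + q - 1).
Local Notation r0 := (Num.sqrt P).
Local Notation r1 := (Num.sqrt (P - 1)).
Local Notation rp := (Num.sqrt (p - 1)).
Local Notation rq := (Num.sqrt (q - 1)).

Lemma r0_gt0 : 0 < r0.
Proof. by rewrite sqrtr_gt0; have := P_ge4; lra. Qed.
Lemma r1_gt0 : 0 < r1.
Proof. by rewrite sqrtr_gt0; have := P_ge4; lra. Qed.
Lemma rp_gt0 : 0 < rp.
Proof. by rewrite sqrtr_gt0; have := hp; lra. Qed.
Lemma rq_gt0 : 0 < rq.
Proof. by rewrite sqrtr_gt0; have := q_gt1; lra. Qed.
Lemma r0_sqr : r0 ^+ 2 = P.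
Proof. by rewrite sqr_sqrtr //; have := P_ge4; lra. Qed.
Lemma r1_sqr : r1 ^+ 2 = P - 1.
Proof. by rewrite sqr_sqrtr //; have := P_ge4; lra. Qed.
Lemma rp_sqr : rp ^+ 2 = p - 1.
Proof. by rewrite sqr_sqrtr //; have := hp; lra. Qed.
Lemma rq_sqr : rq ^+ 2 = q - 1.
Proof. by rewrite sqr_sqrtr //; have := q_gt1; lra. Qed.

(** Conjugate exponents satisfy (p - 1)(q - 1) = 1. Hence rp + rq = r0, p = rp r0 and q = rq r0,
    which ties the exponents 1/p and 1/q in t to its square roots. *)
Lemma rp_rq : rp * rq = 1.
Proof.
rewrite -sqrtrM; last by have := hp; lra.
have -> : (p - 1) * (q - 1) = 1 by have := P_mul; nra.
exact: sqrtr1.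
Qed.

Lemma rp_add_rq : rp + rq = r0.
Proof.
have hpp := rp_gt0; have hqq := rq_gt0.
apply/eqP; rewrite -(@eqrXn2 _ 2) ?ltW ?addr_gt0 ?r0_gt0 //.
by rewrite sqrrD rp_rq rp_sqr rq_sqr r0_sqr; apply/eqP; ring.
Qed.

Lemma r0_gt1 : 1 < r0.
Proof. by have := r0_sqr; have := P_ge4; have := r0_gt0; nra. Qed.

Section AtPoint.
Variable x : R.
Hypothesis x0 : 0 < x.

Lemma rt_sqr : rt x ^+ 2 = x + P - 1.
Proof. by rewrite sqr_sqrtr; have := P_ge4; have := x0; lra. Qed.

Lemma rt_gt : r1 < rt x.
Proof. by rewrite ltr_sqrt; have := P_ge4; have := x0; lra. Qed.

Lemma rt_gt0 : 0 < rt x.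
Proof. exact: lt_trans r1_gt0 rt_gt. Qed.

Lemma rt_gtp : rp < rt x.
Proof. by rewrite ltr_sqrt; have := q_gt0; have := hp; have := x0; lra. Qed.

Lemma rt_gtq : rq < rt x.
Proof. by rewrite ltr_sqrt; have := hp; have := q_gt1; have := x0; lra. Qed.

Lemma is_derive_rt : is_derive x 1 rt ((2 * rt x)^-1).
Proof.
have h : 0 < x + p + q - 1 by have := q_gt1; have := hp; have := x0; lra.
have D := is_derive_add (is_derive_add (is_derive_add (is_derive_id x (1 : R))
  (is_derive_const p x 1)) (is_derive_const q x 1)) (is_derive_const (-1) x 1).
apply: is_derive_subst (is_derive_chain (f := fun y => y + p + q - 1) (is_derive1_sqrt h) D) _.
by rewrite !addr0 mulr1.
Qed.

End AtPoint.

Definition rho (x : R) : R := 1 + x * rt x / r0.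

(* With s = sqrt(x + P - 1) one has x + p = (s - sqrt(q - 1)) (s + sqrt(q - 1)) and
   x + q = (s - sqrt(p - 1)) (s + sqrt(p - 1)); after these cancellations, logt is
   the logarithm of t. *)
Definition logt (x : R) : R := ln (rt x + r0) + r1 / r0 * (ln x - 2 * ln (rt x + r1))
  - p^-1 * ln (rt x - rq) - q^-1 * ln (rt x - rp).

(** The derivative of [logt]; also rho' / (xi rho). *)
Definition tau (x : R) : R := (3 * x + 2 * (P - 1)) / (2 * x * rt x * (r0 + x * rt x)).

Lemma rho_gt1 x : 0 < x -> 1 < rho x.
Proof.
by move=> x0; rewrite /rho ltrDl divr_gt0 ?r0_gt0 // mulr_gt0 // rt_gt0.
Qed.

Lemma tau_gt0 x : 0 < x -> 0 < tau x.
Proof.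
move=> x0; have s0 := rt_gt0 x0; have P4 := P_ge4.
rewrite divr_gt0 //; first by lra.
by rewrite !mulr_gt0 // addr_gt0 ?r0_gt0 // mulr_gt0.
Qed.

Lemma is_derive_rho (x : R) : 0 < x -> is_derive x 1 rho (x * rho x * tau x).
Proof.
move=> x0; have D := is_derive_rt x0.
have M := is_derive_mul (is_derive_mul (is_derive_id x 1) D) (is_derive_const r0^-1 x 1).
apply: is_derive_subst (is_derive_add (is_derive_const 1 x 1) M) _; rewrite /= /tau /rho.
have := rt_gt0 x0; have := rt_sqr x0; have := r0_gt0.
move: (rt x) r0 => s a a0 Es s0.
have d0 : a + x * s != 0 by rewrite gt_eqF // addr_gt0 // mulr_gt0.
have -> : 3 * x + 2 * (P - 1) = 2 * s ^+ 2 + x by rewrite Es; ring.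
by field; rewrite d0 !gt_eqF.
Qed.

Lemma sphere_tE x : 0 < x -> sphere_t p q x = expR (logt x).
Proof.
move=> x0; rewrite /sphere_t -/(rt x).
have s0 := rt_gt0 x0; have sq := rt_gtq x0; have sp := rt_gtp x0.
have E1 : (rt x + rq) / (x + p) = (rt x - rq)^-1.
  have -> : x + p = (rt x - rq) * (rt x + rq).
    by rewrite -subr_sqr rt_sqr // rq_sqr; lra.
  by field; rewrite !gt_eqF //; have := rq_gt0; lra.
have E2 : (rt x + rp) / (x + q) = (rt x - rp)^-1.
  have -> : x + q = (rt x - rp) * (rt x + rp).
    by rewrite -subr_sqr rt_sqr // rp_sqr; lra.
  by field; rewrite !gt_eqF //; have := rp_gt0; lra.
rewrite E1 E2.
have a1 : 0 < rt x + r0 by have := r0_gt0; lra.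
have a2 : 0 < rt x + r1 by have := r1_gt0; lra.
have a3 : 0 < rt x - rq by lra.
have a4 : 0 < rt x - rp by lra.
have a5 : 0 < x / (rt x + r1) ^+ 2 by rewrite divr_gt0 // exprn_gt0.
have -> : expR (logt x) = (rt x + r0) * expR (r1 / r0 * (ln x - 2 * ln (rt x + r1))) *
    expR (- (p^-1 * ln (rt x - rq))) * expR (- (q^-1 * ln (rt x - rp))).
  by rewrite /logt !expRD lnK // posrE.
rewrite /powR (gt_eqF a5) !gt_eqF ?invr_gt0 //.
rewrite !lnV ?posrE // ln_div ?posrE ?exprn_gt0 // lnXn // !mulrN.
by rewrite -[ln _ *+ 2]mulr_natl.
Qed.

Lemma is_derive_logt (x : R) : 0 < x -> is_derive x 1 logt (tau x).
Proof.
move=> x0; have D := is_derive_rt x0.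
have s0 := rt_gt0 x0; have sq := rt_gtq x0; have sp := rt_gtp x0; have s1 := rt_gt x0.
have Dc (c : R) : is_derive x 1 (fun y => rt y + c) ((2 * rt x)^-1).
  exact: is_derive_subst (is_derive_add D (is_derive_const c x 1)) (addr0 _).
have a1 : 0 < rt x + r0 by have := r0_gt0; lra.
have a2 : 0 < rt x + r1 by have := r1_gt0; lra.
have a3 : 0 < rt x - rq by lra.
have a4 : 0 < rt x - rp by lra.
have L1 := is_derive_lnf (f := fun y => rt y + r0) a1 (Dc r0).
have L2 := is_derive_lnf (f := fun y => rt y + r1) a2 (Dc r1).
have L3 := is_derive_lnf (f := fun y => rt y - rq) a3 (Dc (- rq)).
have L4 := is_derive_lnf (f := fun y => rt y - rp) a4 (Dc (- rp)).
have L5 := is_derive_lnf (f := id) x0 (is_derive_id x 1).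
have L := is_derive_add (is_derive_add (is_derive_add L1 (is_derive_scale (r1 / r0)
   (is_derive_add L5 (is_derive_scale (-1) (is_derive_scale 2 L2)))))
   (is_derive_scale (-1) (is_derive_scale p^-1 L3))) (is_derive_scale (-1) (is_derive_scale q^-1 L4)).
have -> : logt = (fun y => ln (rt y + r0) + r1 / r0 * (ln y + -1 * (2 * ln (rt y + r1)))
  + -1 * (p^-1 * ln (rt y - rq)) + -1 * (q^-1 * ln (rt y - rp))).
  by apply/funext => y; rewrite /logt !mulN1r.
apply: is_derive_subst L _; rewrite /tau.
have hx := rt_sqr x0; have P0 := r0_sqr; have P1 := r1_sqr; have PP := P_mul.
have hxE : x = rt x ^+ 2 - r1 ^+ 2 by rewrite hx P1; lra.
have paE : p = rp * r0 by rewrite -rp_add_rq mulrDr rp_rq -expr2 rp_sqr; lra.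
have qaE : q = rq * r0 by rewrite -rp_add_rq mulrDr [rq * rp]mulrC rp_rq -expr2 rq_sqr; lra.
have b2 : r1 ^+ 2 = r0 ^+ 2 - 1 by rewrite P0 P1; lra.
have -> : 3 * x + 2 * (P - 1) = 3 * x + 2 * (r0 ^+ 2 - 1) by rewrite P0.
rewrite [in p^-1]paE [in q^-1]qaE !mulN1r.
apply: logt_identity => //; rewrite ?gt_eqF // ?r0_gt0 ?r1_gt0 ?rp_gt0 ?rq_gt0 //.
- exact: rp_rq.
- by rewrite rp_add_rq.
Qed.

End Profile.

(** * The inverse function of ln t *)

Section ProfileInverse.
Variables (R : realType) (p q : R).
Hypotheses (hp : 2 <= p) (hpq : p^-1 + q^-1 = 1).

Local Notation P := (p + q).
Local Notation rt := (rt p q).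
Local Notation logt := (logt p q).
Local Notation tau := (tau p q).
Local Notation r0 := (Num.sqrt P).
Local Notation r1 := (Num.sqrt (P - 1)).
Local Notation rp := (Num.sqrt (p - 1)).
Local Notation rq := (Num.sqrt (q - 1)).

Lemma logt_lt x y : 0 < x -> x < y -> logt x < logt y.
Proof.
move=> x0 xy.
have dT z : x <= z -> is_derive z 1 logt (tau z).
  by move=> xz; apply: is_derive_logt => //; exact: lt_le_trans xz.
have [||c] := @MVT R logt tau x y xy.
- by move=> z; rewrite in_itv /= => /andP[/ltW xz _]; exact: dT.
- apply: derivable_within_continuous => z; rewrite in_itv /= => /andP[xz _].
  by have [] := dT _ xz.
rewrite in_itv /= => /andP[xc _] E.
by rewrite -subr_gt0 E mulr_gt0 ?subr_gt0 // tau_gt0 // (lt_trans x0).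
Qed.

Lemma logt_le x y : 0 < x -> x <= y -> logt x <= logt y.
Proof. by move=> x0; rewrite le_eqVlt => /predU1P[->//|/(logt_lt x0)/ltW]. Qed.

Lemma logt_inj x y : 0 < x -> 0 < y -> logt x = logt y -> x = y.
Proof.
move=> x0 y0 E; apply/eqP; rewrite eq_le !leNgt; apply/andP; split; apply/negP.
- by move=> /(logt_lt y0); rewrite E ltxx.
- by move=> /(logt_lt x0); rewrite E ltxx.
Qed.

Lemma r1_lt_r0 : r1 < r0.
Proof. by rewrite ltr_sqrt; have := P_ge4 hp hpq; lra. Qed.
Lemma rp_lt_r1 : rp < r1.
Proof. by rewrite ltr_sqrt; have := q_gt0 hp hpq; have := P_ge4 hp hpq; lra. Qed.
Lemma rq_lt_r1 : rq < r1.
Proof. by rewrite ltr_sqrt; move: hp; have := P_ge4 hp hpq; lra. Qed.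

Lemma pinv_gt0 : 0 < p^-1. Proof. by rewrite invr_gt0 (p_gt0 hp). Qed.
Lemma qinv_gt0 : 0 < q^-1. Proof. by rewrite invr_gt0 (q_gt0 hp hpq). Qed.

Lemma ln_le_sub1 (u : R) : 0 < u -> ln u <= u - 1.
Proof. by move=> u0; have := expR_ge1Dx (ln u); rewrite lnK ?posrE //; lra. Qed.

Lemma ln_ge_1subV (u : R) : 0 < u -> 1 - u^-1 <= ln u.
Proof. by move=> u0; have := @ln_le_sub1 u^-1; rewrite invr_gt0 lnV ?posrE // => /(_ u0); lra. Qed.

(** Since p^-1 + q^-1 = 1, the divisions by rt x cancel out, and x = (rt x - r1)(rt x + r1). In this
    form every logarithm tends to 0 at infinity. *)
Lemma logtE x : 0 < x -> logt x = ln ((rt x + r0) / rt x)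
  + r1 / r0 * ln ((rt x - r1) / (rt x + r1))
  - p^-1 * ln ((rt x - rq) / rt x) - q^-1 * ln ((rt x - rp) / rt x).
Proof.
move=> x0; have s0 := rt_gt0 hp hpq x0; have s1 := rt_gt hp hpq x0.
have s2 := rt_gtq hp hpq x0; have s3 := rt_gtp hp hpq x0; have a0 := r0_gt0 hp hpq.
have b0 := r1_gt0 hp hpq.
have xE : x = (rt x - r1) * (rt x + r1).
  by rewrite -subr_sqr rt_sqr // r1_sqr //; lra.
rewrite /logt {2}xE lnM ?posrE ?subr_gt0 ?addr_gt0 //.
rewrite !ln_div ?posrE ?subr_gt0 ?addr_gt0 //.
have -> : q^-1 = 1 - p^-1 by move: hpq; lra.
by ring.
Qed.

Lemma logt_arith (a b k L1 L2 L3 L4 e g : R) :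
  0 <= L1 -> L1 <= g -> L2 <= 0 -> - (2 * e) <= L2 -> L3 <= 0 -> - e <= L3 -> L4 <= 0 ->
  - e <= L4 -> 0 < a -> 0 < b -> a + b = 1 -> 0 < k -> k < 1 -> e <= g ->
  - (2 * e) <= L1 + k * L2 - a * L3 - b * L4 <= 2 * g.
Proof.
move=> l1 u1 u2 l2 u3 l3 u4 l4 a0 b0 ab k0 k1 eg.
have h1 : L2 <= k * L2 by rewrite -[leLHS]mul1r ler_wnM2r // ltW.
have h2 : k * L2 <= 0 by rewrite mulr_ge0_le0 // ltW.
have h3 : a * L3 <= 0 by rewrite mulr_ge0_le0 // ltW.
have h4 : b * L4 <= 0 by rewrite mulr_ge0_le0 // ltW.
have h5 : a * - e <= a * L3 by rewrite ler_pM2l.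
have h6 : b * - e <= b * L4 by rewrite ler_pM2l.
have h7 : a * - e + b * - e = - e by rewrite -mulrDl ab mul1r.
by apply/andP; split; lra.
Qed.

(** The inequalities 1 - 1/u <= ln u <= u - 1, applied to each logarithm of [logtE]. Both bounds
    tend to 0 at infinity. *)
Lemma logt_bounds x : 0 < x ->
  - (2 * (r1 / (rt x - r1))) <= logt x <= 2 * (r0 / (rt x - r1)).
Proof.
move=> x0; have s0 := rt_gt0 hp hpq x0; have s1 := rt_gt hp hpq x0.
have s2 := rt_gtq hp hpq x0; have s3 := rt_gtp hp hpq x0; have a0 := r0_gt0 hp hpq.
have b0 := r1_gt0 hp hpq; have c0 := rp_gt0 hp; have d0 := rq_gt0 hp hpq.
rewrite logtE //.
have dx : 0 < rt x - r1 by lra.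
have l1 : 0 <= ln ((rt x + r0) / rt x) by rewrite ln_ge0 // ler_pdivlMr // mul1r lerDl ltW.
have u1 : ln ((rt x + r0) / rt x) <= r0 / rt x.
  have := @ln_le_sub1 ((rt x + r0) / rt x); rewrite divr_gt0 ?addr_gt0 // => /(_ isT).
  by rewrite mulrDl divff ?gt_eqF //; lra.
have u1' : r0 / rt x <= r0 / (rt x - r1).
  by rewrite ler_pM2l // lef_pV2 ?posrE //; lra.
have u2 : ln ((rt x - r1) / (rt x + r1)) <= 0.
  by rewrite ln_le0 // ler_pdivrMr ?mul1r ?addr_gt0 //; lra.
have l2 : - (2 * (r1 / (rt x - r1))) <= ln ((rt x - r1) / (rt x + r1)).
  have ax : 0 < rt x + r1 by rewrite addr_gt0.
  have := @ln_ge_1subV ((rt x - r1) / (rt x + r1)) (divr_gt0 dx ax).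
  apply: le_trans; rewrite le_eqVlt; apply/orP; left; apply/eqP.
  by field; rewrite !gt_eqF // addr_gt0.
have K (r : R) : 0 < r -> r < r1 -> ln ((rt x - r) / rt x) <= 0 /\
     - (r1 / (rt x - r1)) <= ln ((rt x - r) / rt x).
  move=> rr0 rr1; split; first by rewrite ln_le0 // ler_pdivrMr ?mul1r //; lra.
  have sr : 0 < rt x - r by lra.
  have := @ln_ge_1subV ((rt x - r) / rt x); rewrite divr_gt0 // => /(_ isT).
  apply: le_trans.
  have -> : 1 - ((rt x - r) / rt x)^-1 = - (r / (rt x - r)) by field; rewrite !gt_eqF.
  rewrite lerN2 ler_pM ?invr_ge0 ?ltW // ltf_pV2 ?posrE //; lra.
have [k1 k2] := K _ d0 rq_lt_r1.
have [k3 k4] := K _ c0 rp_lt_r1.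
have kappa0 : 0 < r1 / r0 by rewrite divr_gt0.
have kappa1 : r1 / r0 < 1 by rewrite ltr_pdivrMr // mul1r r1_lt_r0.
have E : r1 / (rt x - r1) <= r0 / (rt x - r1).
  by rewrite ler_pM2r ?invr_gt0 // ltW // r1_lt_r0.
exact: (logt_arith l1 (le_trans u1 u1') u2 l2 k1 k2 k3 k4 pinv_gt0 qinv_gt0 hpq kappa0 kappa1 E).
Qed.

Lemma rt_large (M : R) : exists2 x, 0 < x & forall y, x <= y -> M < rt y.
Proof.
exists ((`|M| + 1) ^+ 2) => [|y xy]; first by rewrite exprn_gt0 // ltr_wpDl.
apply: (@lt_le_trans _ _ (`|M| + 1)); first by rewrite ltr_pwDr // ler_norm.
have P4 := P_ge4 hp hpq.
rewrite -[leLHS]ger0_norm ?addr_ge0 // -sqrtr_sqr ler_wsqrtr //; lra.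
Qed.

Lemma logt_large (e : R) : 0 < e -> exists2 x, 0 < x & forall y, x <= y -> `|logt y| < e.
Proof.
move=> e0; have [x x0 Hx] := rt_large (r1 + 2 * r0 / e).
exists x => // y /[dup] xy /Hx sy; have y0 : 0 < y by exact: lt_le_trans xy.
have d0 : 2 * r0 / e < rt y - r1 by lra.
have a0 := r0_gt0 hp hpq.
have dp : 0 < rt y - r1 by apply: lt_trans d0; rewrite divr_gt0 // mulr_gt0.
have H : 2 * (r0 / (rt y - r1)) < e by rewrite mulrA ltr_pdivrMr // -ltr_pdivrMl // mulrC.
have H1 : r1 / (rt y - r1) <= r0 / (rt y - r1).
  by rewrite ler_pM2r ?invr_gt0 // ltW // r1_lt_r0.
by have /andP[h1 h2] := logt_bounds y0; rewrite ltr_norml; apply/andP; split; lra.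
Qed.

(** Follows from strict monotonicity and the limit 0 at infinity given by [logt_large]. *)
Lemma logt_lt0 x : 0 < x -> logt x < 0.
Proof.
move=> x0; rewrite ltNge; apply/negP => T0.
have x1 : x < x + 1 by rewrite ltrDl.
have T1 : 0 < logt (x + 1) by apply: le_lt_trans T0 _; exact: logt_lt.
have [y y0 Hy] := logt_large T1.
have := Hy (Num.max y (x + 1)); rewrite le_max lexx => /(_ isT).
rewrite ltNge => /negP; apply; apply: le_trans (ler_norm _).
by apply: logt_le; rewrite ?le_max ?lexx ?orbT //; lra.
Qed.

Lemma logt_small (w : R) : exists2 x, 0 < x & logt x <= w.
Proof.
have a0 := r0_gt0 hp hpq; have b0 := r1_gt0 hp hpq.
have P4 := P_ge4 hp hpq.
have kappa0 : 0 < r1 / r0 by rewrite divr_gt0.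
(* For x <= 1 one has r1 < rt x <= r0, and k bounds from above all terms of [logt] other than (r1 /
   r0) ln x. The second entry of the minimum below makes this last term at most w - k. *)
pose k := ln (r0 + r0) - p^-1 * ln (r1 - rq) - q^-1 * ln (r1 - rp).
exists (Num.min 1 (expR ((w - k) / (r1 / r0)))); first by rewrite lt_min ltr01 expR_gt0.
set x := Num.min _ _.
have x0 : 0 < x by rewrite lt_min ltr01 expR_gt0.
have x1 : x <= 1 by rewrite ge_min lexx.
have lx : ln x <= (w - k) / (r1 / r0).
  by rewrite -[leRHS]expRK ler_ln ?posrE ?expR_gt0 // ge_min lexx orbT.
have s1 := rt_gt hp hpq x0.
have s0 : rt x <= r0 by rewrite /rt ler_wsqrtr //; lra.
have r11 : 1 < r1 by have := r1_sqr hp hpq; nra.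
have h1 : ln (rt x + r0) <= ln (r0 + r0).
  by rewrite ler_ln ?posrE ?addr_gt0 // ?lerD2r // (lt_trans b0).
have h2 : 0 <= ln (rt x + r1) by rewrite ln_ge0 //; lra.
have h3 : ln (r1 - rq) <= ln (rt x - rq).
  by have hr := rq_lt_r1; rewrite ler_ln ?posrE ?lerD2r ?subr_gt0 // ?ltW //; exact: lt_trans s1.
have h4 : ln (r1 - rp) <= ln (rt x - rp).
  by have hr := rp_lt_r1; rewrite ler_ln ?posrE ?lerD2r ?subr_gt0 // ?ltW //; exact: lt_trans s1.
have h5 : p^-1 * ln (r1 - rq) <= p^-1 * ln (rt x - rq) by rewrite ler_pM2l // pinv_gt0.
have h6 : q^-1 * ln (r1 - rp) <= q^-1 * ln (rt x - rp) by rewrite ler_pM2l // qinv_gt0.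
have h7 : r1 / r0 * (ln x - 2 * ln (rt x + r1)) <= r1 / r0 * ((w - k) / (r1 / r0)).
  by rewrite ler_pM2l //; lra.
move: h7; rewrite [leRHS]mulrC divfK ?gt_eqF // => h7.
rewrite /logt; move: h1 h2 h5 h6 h7; rewrite /k; lra.
Qed.

Lemma logt_surj (w : R) : w < 0 -> exists2 x, 0 < x & logt x = w.
Proof.
move=> w0; have [a a0 wa] := logt_small w.
have [|b b0 Hb] := @logt_large (- w); first by rewrite oppr_gt0.
have wb : w <= logt b by have := Hb b (lexx b); rewrite ltr_norml opprK => /andP[/ltW].
have ab : a <= b.
  by rewrite leNgt; apply/negP => /(logt_lt b0); rewrite ltNge (le_trans wa).
have [||c] := @IVT R logt a b w ab.
- apply: derivable_within_continuous => z; rewrite in_itv /= => /andP[az _].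
  by have [] := is_derive_logt hp hpq (lt_le_trans a0 az).
- by rewrite ge_min le_max wa wb orbT.
by rewrite in_itv /= => /andP[ac _] E; exists c => //; exact: lt_le_trans ac.
Qed.

(* Meaningful on negative arguments only: logt maps ]0, +oo[ onto ]-oo, 0[. *)
Definition logt_inv (w : R) : R := xget 1 [set x | 0 < x /\ logt x = w].

Lemma logt_invP (w : R) : w < 0 -> 0 < logt_inv w /\ logt (logt_inv w) = w.
Proof.
by move=> /logt_surj[x x0 xw]; rewrite /logt_inv; case: xgetP => [y -> //|/(_ x)[]].
Qed.

Lemma logtK (x : R) : 0 < x -> logt_inv (logt x) = x.
Proof.
move=> x0; have [y0 E] := logt_invP (logt_lt0 x0).
exact: logt_inj.
Qed.

Lemma is_derive_logt_inv (w : R) : w < 0 -> is_derive w 1 logt_inv (tau (logt_inv w))^-1.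
Proof.
move=> w0; have [x0 E] := logt_invP w0.
rewrite -{1}E; apply: is_derive_inverse.
- by near=> y; apply: logtK; near: y; exact: lt_nbhsr.
- near=> y.
  have y0 : 0 < y by near: y; exact: lt_nbhsr.
  have [D _] := is_derive_logt hp hpq y0.
  exact/differentiable_continuous/derivable1_diffP.
- exact: is_derive_logt.
- by rewrite gt_eqF // tau_gt0.
Unshelve. all: by end_near. Qed.

End ProfileInverse.

(** * The power cone *)

Lemma ord3_ind (Q : 'I_3 -> Prop) : Q 0 -> Q 1 -> Q 2 -> forall i, Q i.
Proof.
move=> Q0 Q1 Q2 [[|[|[|//]]] i3].
- by have <- : 0 = Ordinal i3 by apply/val_inj.
- by have <- : 1 = Ordinal i3 by apply/val_inj.
- by have <- : 2 = Ordinal i3 by apply/val_inj.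
Qed.

Lemma sum3 (V : zmodType) (f : 'I_3 -> V) : \sum_i f i = f 0 + f 1 + f 2.
Proof.
rewrite !big_ord_recl big_ord0 addr0 addrA; congr (f _ + f _ + f _); exact/val_inj.
Qed.

Lemma det_mx33 (F : comNzRingType) (A : 'M[F]_3) : \det A =
  A 0 0 * (A 1 1 * A 2 2 - A 1 2 * A 2 1) - A 0 1 * (A 1 0 * A 2 2 - A 1 2 * A 2 0)
  + A 0 2 * (A 1 0 * A 2 1 - A 1 1 * A 2 0).
Proof.
have e1 : lift (ord0 : 'I_3) (ord0 : 'I_2) = 1 by apply/val_inj.
have e2 : lift (ord0 : 'I_3) (lift ord0 ord0 : 'I_2) = 2 by apply/val_inj.
have e3 : lift (1 : 'I_3) (ord0 : 'I_2) = 0 by apply/val_inj.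
have e4 : lift (1 : 'I_3) (lift ord0 ord0 : 'I_2) = 2 by apply/val_inj.
have e5 : lift (2 : 'I_3) (ord0 : 'I_2) = 0 by apply/val_inj.
have e6 : lift (2 : 'I_3) (lift ord0 ord0 : 'I_2) = 1 by apply/val_inj.
rewrite (expand_det_row _ 0) sum3 /cofactor.
have D (j : 'I_3) : \det (row' 0 (col' j A)) =
    A 1 (lift j ord0) * A 2 (lift j (lift ord0 ord0)) - A 1 (lift j (lift ord0 ord0)) * A 2 (lift j ord0).
  rewrite (expand_det_row _ ord0) !big_ord_recl big_ord0 addr0 /cofactor !det_mx11 !mxE /=.
  have f1 : lift (ord0 : 'I_2) (ord0 : 'I_1) = lift ord0 ord0 by apply/val_inj.
  have f2 : lift (lift ord0 ord0 : 'I_2) (ord0 : 'I_1) = ord0 by apply/val_inj.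
  have g1 : lift (0 : 'I_3) (ord0 : 'I_2) = 1 by apply/val_inj.
  have g2 : lift (0 : 'I_3) (lift ord0 ord0 : 'I_2) = 2 by apply/val_inj.
  by rewrite f1 f2 g1 g2 /bump /= !addn0 add0n expr0 expr1 mul1r mulN1r mulrN.
rewrite !D e1 e2 e3 e4 e5 e6 /=.
by rewrite !exprS !expr0 ; ring.
Qed.

Lemma near_gt (R : realType) (T : topologicalType) (f : T -> R) (x : T) (a : R) :
  {for x, continuous f} -> a < f x -> \forall y \near x, a < f y.
Proof. by move=> cf; apply: (cvgr_gt _ cf). Qed.

Lemma near_lt (R : realType) (T : topologicalType) (f : T -> R) (x : T) (a : R) :
  {for x, continuous f} -> f x < a -> \forall y \near x, f y < a.
Proof. by move=> cf; apply: (cvgr_lt _ cf). Qed.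

Lemma closure_coord (R : realType) n (A : set 'rV[R]_n) (v : 'rV[R]_n) (e : R) :
  closure A v -> 0 < e -> exists2 k : 'rV[R]_n, A k & forall j, `|v 0 j - k 0 j| < e.
Proof.
move=> cv e0; have [k [Ak [_ vk]]] := cv _ (nbhsx_ballx v e e0).
by exists k => // j; exact: vk.
Qed.

Lemma near0_ex (R : realType) (Q : R -> Prop) : (\forall s \near (0 : R), Q s) ->
  exists2 s : R, 0 < s & Q s /\ Q (- s).
Proof.
move=> /nbhs_ballP[e /= e0 He]; exists (e / 2); first by rewrite divr_gt0.
have e2 : e / 2 < e by rewrite gtr_pMr // invf_lt1 // (ltr_nat _ 1 2).
have e2' : 0 < e / 2 by rewrite divr_gt0.
by split; apply: He; rewrite /ball /= sub0r normrN ?normrN gtr0_norm.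
Qed.

Section PowerCone.
Variables (R : realType) (p q : R).
Hypotheses (hp : 2 <= p) (hpq : p^-1 + q^-1 = 1).

Local Notation K := (power_cone p q).

(** The weighted geometric mean; the upper face of the cone is its graph. *)
Definition gm (a b : R) : R := a `^ p^-1 * b `^ q^-1.

Let p0 : 0 < p. Proof. by move: hp; lra. Qed.
Let q0 : 0 < q.
Proof.
rewrite -invr_gt0; have : p^-1 < 1 by rewrite invf_lt1 //; move: hp; lra.
by move: hpq; lra.
Qed.
Let pi0 : 0 < p^-1. Proof. by rewrite invr_gt0. Qed.
Let qi0 : 0 < q^-1. Proof. by rewrite invr_gt0. Qed.

Lemma gm_ge0 a b : 0 <= gm a b.
Proof. by rewrite mulr_ge0 // powR_ge0. Qed.

Lemma gmE a b : 0 < a -> 0 < b -> gm a b = expR (p^-1 * ln a + q^-1 * ln b).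
Proof. by move=> a0 b0; rewrite /gm /powR !gt_eqF // expRD. Qed.

Lemma gm_gt0 a b : 0 < a -> 0 < b -> 0 < gm a b.
Proof. by move=> a0 b0; rewrite gmE ?expR_gt0. Qed.

Lemma gm_young a b : 0 <= a -> 0 <= b -> gm a b <= p^-1 * a + q^-1 * b.
Proof.
move=> a0 b0.
have := conjugate_powR (powR_ge0 a p^-1) (powR_ge0 b q^-1) p0 q0 hpq.
by rewrite -!powRrM !mulVf ?gt_eqF // !powRr1 // [a / p]mulrC [b / q]mulrC.
Qed.

Lemma gm_scale a b c d : 0 <= a -> 0 <= b -> 0 <= c -> 0 <= d ->
  gm (a * c) (b * d) = gm a b * gm c d.
Proof. by move=> a0 b0 c0 d0; rewrite /gm !powRM // mulrACA. Qed.

Lemma gm_diag t : 0 < t -> gm t t = t.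
Proof. by move=> t0; rewrite gmE // -mulrDl hpq mul1r lnK ?posrE. Qed.

(** After division by gm (a + c) (b + d), weighted arithmetic-geometric means bound the two summands
    by p^-1 and q^-1 times the shares of the sums a + c and b + d; these bounds add up to 1. *)
Lemma gm_super a b c d : 0 <= a -> 0 <= b -> 0 < c -> 0 < d ->
  gm a b + gm c d <= gm (a + c) (b + d).
Proof.
move=> a0 b0 c0 d0; have A0 : 0 < a + c by rewrite ltr_wpDl.
have B0 : 0 < b + d by rewrite ltr_wpDl.
have E x y : 0 <= x -> 0 <= y ->
    gm x y <= gm (a + c) (b + d) * (p^-1 * (x / (a + c)) + q^-1 * (y / (b + d))).
  move=> x0 y0.
  have -> : gm x y = gm (a + c) (b + d) * gm (x / (a + c)) (y / (b + d)).
    rewrite -gm_scale ?divr_ge0 //; try exact: ltW.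
    by congr (gm _ _); field; exact: lt0r_neq0.
  by rewrite ler_wpM2l ?gm_ge0 // gm_young // divr_ge0 // ltW.
apply: le_trans (lerD (E _ _ a0 b0) (E _ _ (ltW c0) (ltW d0))) _.
rewrite -mulrDr addrACA -!mulrDr -!mulrDl !divff ?gt_eqF // !mulr1 hpq mulr1 //.
Qed.

Lemma gm_le a b c d : 0 <= a -> 0 <= b -> a <= c -> b <= d -> gm a b <= gm c d.
Proof.
move=> a0 b0 ac bd; rewrite /gm ler_pM ?powR_ge0 // ge0_ler_powR ?nnegrE //; try exact: ltW.
- exact: le_trans ac.
- exact: le_trans bd.
Qed.

(** For positive coordinates this is ln (z / gm x y). *)
Definition logW (v : 'rV[R]_3) : R := ln (v 0 2) - p^-1 * ln (v 0 0) - q^-1 * ln (v 0 1).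

Definition cone_int (v : 'rV[R]_3) : Prop :=
  [/\ 0 < v 0 0, 0 < v 0 1, 0 < v 0 2 & logW v < 0].

Lemma logW_lt0 (v : 'rV[R]_3) : 0 < v 0 0 -> 0 < v 0 1 -> 0 < v 0 2 ->
  (logW v < 0) = (v 0 2 < gm (v 0 0) (v 0 1)).
Proof.
move=> a0 b0 c0; rewrite gmE // -[X in _ = (X < _)]lnK ?posrE // ltr_expR /logW.
by apply/idP/idP; lra.
Qed.

Lemma cone_intK (v : 'rV[R]_3) : cone_int v -> K v.
Proof.
move=> [a0 b0 c0]; rewrite logW_lt0 // => W0.
by rewrite /power_cone /=; split; rewrite ?ltW // c0.
Qed.

Lemma continuous_logW (v : 'rV[R]_3) : 0 < v 0 0 -> 0 < v 0 1 -> 0 < v 0 2 ->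
  {for v, continuous logW}.
Proof.
move=> a0 b0 c0.
have L (j : 'I_3) : 0 < v 0 j -> {for v, continuous (fun w : 'rV[R]_3 => ln (w 0 j))}.
  move=> vj; apply: (@continuous_comp _ _ _ (fun w : 'rV[R]_3 => w 0 j) (@ln R)).
    exact: coord_continuous.
  exact: continuous_ln.
exact: (cvgB (cvgB (L _ c0) (cvgM (cvg_cst _) (L _ a0))) (cvgM (cvg_cst _) (L _ b0))).
Qed.

Lemma interior_power_cone (v : 'rV[R]_3) : K° v <-> cone_int v.
Proof.
split=> [Kv|[a0 b0 c0 W0]].
  (* Room in the directions -e_0, -e_1, e_2 and -e_2 yields the four strict inequalities. *)
  have near_e (i : 'I_3) := near_line (delta_mx 0 i : 'rV[R]_3) (@open_interior _ K) Kv.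
  have [s0 s00 [_ /interior_subset H0]] := near0_ex (near_e 0).
  have [s1 s10 [_ /interior_subset H1]] := near0_ex (near_e 1).
  have [s2 s20 [/interior_subset H2 /interior_subset H3]] := near0_ex (near_e 2).
  move: H0 H1 H2 H3; rewrite /power_cone /= !mxE /= !mulr0 !mulr1 !addr0.
  move=> [_ h0 _] [_ _ h1] [/andP[_ h2] _ _] [/andP[h3 _] _ _].
  have a0 : 0 < v 0 0 by lra.
  have b0 : 0 < v 0 1 by lra.
  have c0 : 0 < v 0 2 by lra.
  by split=> //; rewrite logW_lt0 // /gm; lra.
have N (j : 'I_3) : 0 < v 0 j -> \forall w \near v, 0 < (w : 'rV[R]_3) 0 j.
  by move=> vj; apply: (@near_gt _ _ (fun w : 'rV[R]_3 => w 0 j)) => //; exact: coord_continuous.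
rewrite /interior /=.
have NW : \forall w \near v, logW w < 0 := near_lt (continuous_logW a0 b0 c0) W0.
by near=> w; apply: cone_intK; split; near: w; [exact: N|exact: N|exact: N|exact: NW].
Unshelve. all: by end_near. Qed.

(** On K the bound z <= x + y is a weakening of [gm_young]; linear inequalities survive the closure.
    The last one makes the section x + y = 1 bounded. *)
Lemma closure_power_cone (v : 'rV[R]_3) : closure K v ->
  [/\ 0 <= v 0 0, 0 <= v 0 1, 0 <= v 0 2 & v 0 2 <= v 0 0 + v 0 1].
Proof.
move=> cv.
have H e : 0 < e -> [/\ - e <= v 0 0, - e <= v 0 1, - e <= v 0 2 & v 0 2 <= v 0 0 + v 0 1 + 3 * e].
  move=> e0; have [k [/andP[k2 k2'] k0 k1] vk] := closure_coord cv e0.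
  have := gm_young k0 k1; rewrite -/(gm _ _) in k2'.
  have l0 : p^-1 * k 0 0 <= k 0 0 by rewrite ler_piMl //; move: hpq qi0; lra.
  have l1 : q^-1 * k 0 1 <= k 0 1 by rewrite ler_piMl //; move: hpq pi0; lra.
  have := vk 0; have := vk 1; have := vk 2; rewrite !ltr_norml.
  by move=> /andP[? ?] /andP[? ?] /andP[? ?] ?; split; lra.
split.
- by apply/ler_addgt0Pl => e /H[]; lra.
- by apply/ler_addgt0Pl => e /H[]; lra.
- by apply/ler_addgt0Pl => e /H[]; lra.
- apply/ler_addgt0Pl => e e0; have [|_ _ _] := H (e / 3); first by rewrite divr_gt0.
  lra.
Qed.

(** By superadditivity, adding the same amount to x and y raises their mean by at least that amount,
    whereas z gains only half of it. The difference absorbs the passage from the closure to a nearby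
    point k of K. *)
Lemma closure_cone_push (v w : 'rV[R]_3) (e : R) : closure K v -> 0 < e ->
  w 0 0 = v 0 0 + e -> w 0 1 = v 0 1 + e -> w 0 2 = v 0 2 + e / 2 -> cone_int w.
Proof.
move=> cv e0 w0 w1 w2; have [v0 v1 v2 _] := closure_power_cone cv.
(* Relative to k, x and y still gain at least 4 e / 5, and z gains at most e / 2 + e / 5, which is
   less. *)
have d0 : 0 < e / 5 by rewrite divr_gt0.
have [k [/andP[k2 k2'] k0 k1] vk] := closure_coord cv d0.
rewrite -/(gm _ _) in k2'.
have pw0 : 0 < w 0 0 by lra.
have pw1 : 0 < w 0 1 by lra.
have pw2 : 0 < w 0 2 by lra.
split=> //; rewrite logW_lt0 //.
have t0 : 0 < 4 * (e / 5) by lra.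
have := gm_super k0 k1 t0 t0; rewrite gm_diag // => g1.
have := vk 0; have := vk 1; have := vk 2; rewrite !ltr_norml.
move=> /andP[? ?] /andP[? ?] /andP[? ?].
have g2 : gm (k 0 0 + 4 * (e / 5)) (k 0 1 + 4 * (e / 5)) <= gm (w 0 0) (w 0 1).
  by apply: gm_le; lra.
lra.
Qed.

(* 1 + e * push maps (x, y, z) to (x, y, z) + e (x + y) (1, 1, 1/2), and hence moves
   the nonzero points of the closure of K into the interior. *)
Definition push : 'M[R]_3 :=
  \matrix_(i < 3, j < 3) ((i != 2)%:R * (if j == 2 then 2^-1 else 1)).

Definition section_set : set 'rV[R]_3 := [set v | closure K v /\ v 0 0 + v 0 1 = 1].

Lemma push_cone (e : R) (v : 'rV[R]_3) : 0 < e -> section_set v ->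
  K° (v *m (1%:M + e *: push)).
Proof.
move=> e0 [cv v01]; apply/interior_power_cone.
have E j : (v *m (1%:M + e *: push)) 0 j = v 0 j + e * (if j == 2 then 2^-1 else 1).
  rewrite mulmx_shrink !mxE sum3 !mxE /= mul0r mulr0 addr0 !mul1r -mulrDl v01 mul1r //.
by apply: (@closure_cone_push v _ e) => //; rewrite E //= mulr1.
Qed.

Lemma det_push (e : R) : \det (1%:M + e *: push) = 1 + 2 * e.
Proof. by rewrite det_mx33 !mxE /= !mulr1n !mulr0n; ring. Qed.

Lemma section_compact : compact section_set.
Proof.
have C (v : 'rV[R]_3) : {for v, continuous (fun w : 'rV[R]_3 => w 0 0 + w 0 1)}.
  exact: (cvgD (@coord_continuous _ _ _ 0 0 v) (@coord_continuous _ _ _ 0 1 v)).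
have cb : compact [set v : 'rV[R]_3 | forall j, `[0, 1]%classic (v ord0 j)].
  by apply: (@rV_compact R 3 (fun=> `[(0 : R), 1]%classic)) => j; exact: segment_compact.
apply: subclosed_compact cb _.
  apply: closedI; first exact: closed_closure.
  apply: (@closed_comp _ _ (fun v : 'rV[R]_3 => v 0 0 + v 0 1) [set 1]).
    by move=> v _; exact: C.
  exact: closed_eq.
move=> v [/closure_power_cone[v0 v1 v2 v3] v01].
by apply: ord3_ind => /=; rewrite in_itv /=; apply/andP; split; lra.
Qed.

Lemma power_cone_scale (v : 'rV[R]_3) (l : R) : K° v -> 0 < l -> K° (l *: v).
Proof.
move=> /interior_power_cone[a0 b0 c0 W0] l0; apply/interior_power_cone.
split; rewrite ?mxE ?mulr_gt0 //.
rewrite /logW !mxE !lnM ?posrE //.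
have -> : ln l + ln (v 0 2) - p^-1 * (ln l + ln (v 0 0)) - q^-1 * (ln l + ln (v 0 1)) =
   logW v + ln l * (1 - (p^-1 + q^-1)) by rewrite /logW; ring.
by rewrite hpq subrr mulr0 addr0.
Qed.

Lemma section_ray (v : 'rV[R]_3) : K° v -> exists2 l : R, 0 < l & section_set (l *: v).
Proof.
move=> Kv; have [a0 b0 _ _] := (interior_power_cone v).1 Kv.
have ab : 0 < v 0 0 + v 0 1 by rewrite addr_gt0.
have l0 : 0 < (v 0 0 + v 0 1)^-1 by rewrite invr_gt0.
exists (v 0 0 + v 0 1)^-1 => //; split.
  by apply: subset_closure; apply: interior_subset; exact: power_cone_scale.
by rewrite !mxE -mulrDr mulVf // gt_eqF.
Qed.

Lemma power_cone_potential_eq F G : potential_like K F -> potential_like K G ->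
  forall v, K° v -> F v = G v.
Proof.
suff H F' G' : potential_like K F' -> potential_like K G' -> forall v : 'rV[R]_3, K° v -> G' v <= F' v.
  by move=> pF pG v Kv; apply/eqP; rewrite eq_le !H.
move=> pF pG; apply: (@potential_le _ _ K section_set section_compact _ power_cone_scale
  section_ray F' G' push pF pG) => [v []//|e e0]; split.
  by rewrite det_push lerDl mulr_ge0 // ltW.
by move=> v; exact: push_cone.
Qed.

End PowerCone.

(** * The potential of the power cone *)

(** The Monge-Ampere equation without the coordinates: the left side is the determinant of a
    diagonal matrix plus tau^-1 w w^T, with w = (-1/p, -1/q, 1), and the right side is rho^2. Here s
    = rt x and a = sqrt(p + q). *)
Lemma sphere_form_identity (F : realFieldType) (p q s a x : F) : p + q = p * q ->
  a ^+ 2 = p + q -> s ^+ 2 = x + (p + q) - 1 -> p != 0 -> q != 0 -> a != 0 ->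
  3 * x + 2 * (p + q - 1) != 0 ->
  (x + p) / p * ((x + q) / q) * (1 - x) + (2 * x * s * (a + x * s) / (3 * x + 2 * (p + q - 1))) *
    ((x + q) / q * (1 - x) / p ^+ 2 + (x + p) / p * (1 - x) / q ^+ 2 + (x + p) / p * ((x + q) / q))
  = (1 + x * s / a) ^+ 2.
Proof.
move=> PE a2 s2 p0 q0 a0 d0.
have p1 : p - 1 != 0.
  by apply/eqP => E; move: PE; rewrite (_ : p = 1); lra.
have qE : q = p / (p - 1).
  by apply: (mulIf p1); rewrite divfK // mulrBr mulr1 [q * p]mulrC -PE; ring.
(* The cofactor of tau^-1 is the numerator of tau divided by p q, so that this numerator cancels. *)
have -> : (x + q) / q * (1 - x) / p ^+ 2 + (x + p) / p * (1 - x) / q ^+ 2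
    + (x + p) / p * ((x + q) / q) = (3 * x + 2 * (p + q - 1)) / (p * q).
  by rewrite qE; field; rewrite p0 p1.
rewrite [X in _ + X]mulrA divfK // -PE -a2.
have -> : (x + p) / p * ((x + q) / q) * (1 - x) = 1 - x ^+ 2 * s ^+ 2 / a ^+ 2.
  by rewrite s2 a2 qE; field; rewrite p0 p1 andbT /=; apply: contra p0 => /eqP; nra.
by field.
Qed.

Section SpherePotential.
Variables (R : realType) (p q : R).
Hypotheses (hp : 2 <= p) (hpq : p^-1 + q^-1 = 1).

Local Notation P := (p + q).
Local Notation K := (power_cone p q).
Local Notation rt := (rt p q).
Local Notation logt := (logt p q).
Local Notation tau := (tau p q).
Local Notation rho := (rho p q).
Local Notation logW := (logW p q).
Local Notation logt_inv := (logt_inv p q).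
Local Notation r0 := (Num.sqrt P).

Definition sphere_potential (v : 'rV[R]_3) : R :=
  ln (rho (logt_inv (logW v))) - (ln (v 0 0) + ln (v 0 1) + ln (v 0 2)).

(* With D = diag(x, y, z), the Hessian H of the potential satisfies
   D H D = tau^-1 w w^T + diag(diag_part). *)
Definition diag_part (x : R) (i : 'I_3) : R :=
  if i == 0 then (x + p) / p else if i == 1 then (x + q) / q else 1 - x.

(** The coefficients of [logW] in the logarithms of the coordinates. *)
Definition wvec (i : 'I_3) : R := if i == 0 then - p^-1 else if i == 1 then - q^-1 else 1.

Definition sphere_hessian (v : 'rV[R]_3) : 'M[R]_3 :=
  let x := logt_inv (logW v) in
  \matrix_(i < 3, j < 3)
    (((tau x)^-1 * wvec i * wvec j + diag_part x i *+ (i == j)) / (v 0 i * v 0 j)).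

Lemma qf_sphere_hessian (v w : 'rV[R]_3) :
  v 0 0 != 0 -> v 0 1 != 0 -> v 0 2 != 0 ->
  let x := logt_inv (logW v) in
  qf (sphere_hessian v) w =
  (tau x)^-1 * (w 0 2 / v 0 2 - p^-1 * (w 0 0 / v 0 0) - q^-1 * (w 0 1 / v 0 1)) ^+ 2
  + (x + p) / p * (w 0 0 / v 0 0) ^+ 2 + (x + q) / q * (w 0 1 / v 0 1) ^+ 2
  + (1 - x) * (w 0 2 / v 0 2) ^+ 2.
Proof.
move=> v0 v1 v2 x.
rewrite /qf !sum3 !mxE /wvec /diag_part /= -/x !mulr1n !mulr0n.
move: (tau x)^-1 => t; move: v0 v1 v2; move: (v 0 0) (v 0 1) (v 0 2) (w 0 0) (w 0 1) (w 0 2).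
move=> a b c d e f a0 b0 c0.
have p0 := lt0r_neq0 (p_gt0 hp); have q0 := lt0r_neq0 (q_gt0 hp hpq).
by field; rewrite a0 b0 c0 p0 q0.
Qed.

Lemma det_sphere_hessian (v : 'rV[R]_3) : cone_int p q v ->
  \det (sphere_hessian v) = expR (2 * sphere_potential v).
Proof.
move=> [v0 v1 v2 W0]; have [x0 _] := logt_invP hp hpq W0.
rewrite /sphere_potential; set x := logt_inv _ in x0 *.
have rh0 : 0 < rho x by apply: lt_trans ltr01 _; exact: rho_gt1.
have -> : expR (2 * (ln (rho x) - (ln (v 0 0) + ln (v 0 1) + ln (v 0 2)))) =
    rho x ^+ 2 / (v 0 0 * v 0 1 * v 0 2) ^+ 2.
  by rewrite expRM_natl expRB !expRD !lnK ?posrE // expr_div_n.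
have d0 : 3 * x + 2 * (P - 1) != 0.
  by rewrite gt_eqF //; have := P_ge4 hp hpq; lra.
have p0 := lt0r_neq0 (p_gt0 hp); have q0 := lt0r_neq0 (q_gt0 hp hpq).
rewrite /rho -(sphere_form_identity (P_mul hp hpq) (r0_sqr hp hpq) (rt_sqr hp hpq x0) p0 q0
  (lt0r_neq0 (r0_gt0 hp hpq)) d0).
rewrite det_mx33 !mxE /wvec /diag_part /= -/x !mulr1n !mulr0n /tau invf_div.
move: ((x + p) / p) ((x + q) / q) (1 - x) (_ / (3 * x + _)) => d1 d2 d3 t.
by field; rewrite p0 q0 !gt_eqF.
Qed.

(** The coefficient 1 - x may be negative and has to be offset by the first term. Put A = 1/p, B =
    1/q, u = A a + B b and m = c - u. Convexity of the square bounds the terms in a and b below by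
    (1 + x) u^2 + 2 A B (a^2 + b^2); completing the square in u then leaves (1/2 + x^2/6) m^2 + 2 A
    B (a^2 + b^2), where x^2/6 is 2 x^2/3 - x^2/2. *)
Lemma sphere_form_gt0 (x t a b c : R) : 0 < x -> 2 * x ^+ 2 / 3 <= t ->
  (a != 0) || (b != 0) || (c != 0) ->
  0 < t * (c - p^-1 * a - q^-1 * b) ^+ 2 + (x + p) / p * a ^+ 2 + (x + q) / q * b ^+ 2
      + (1 - x) * c ^+ 2.
Proof.
move=> x0 ht abc.
have p0 := pinv_gt0 hp; have q0 := qinv_gt0 hp hpq.
have pn := lt0r_neq0 (p_gt0 hp); have qn := lt0r_neq0 (q_gt0 hp hpq).
have -> : (x + p) / p = 1 + x * p^-1 by field.
have -> : (x + q) / q = 1 + x * q^-1 by field.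
move: p0 q0 hpq; move: p^-1 q^-1 => A B A0 B0 AB.
pose u := A * a + B * b; pose m := c - u.
have cE : c = u + m by rewrite /m; ring.
have -> : c - A * a - B * b = m by rewrite /m /u; ring.
have h1 : u ^+ 2 <= A * a ^+ 2 + B * b ^+ 2.
  have -> : A * a ^+ 2 + B * b ^+ 2 = u ^+ 2 + A * B * (a - b) ^+ 2.
    by rewrite /u (_ : B = 1 - A); [ring|lra].
  by rewrite lerDl mulr_ge0 ?sqr_ge0 // mulr_ge0 // ltW.
have h2 : u ^+ 2 + 2 * A * B * (a ^+ 2 + b ^+ 2) <= a ^+ 2 + b ^+ 2.
  rewrite -subr_ge0.
  have -> : a ^+ 2 + b ^+ 2 - (u ^+ 2 + 2 * A * B * (a ^+ 2 + b ^+ 2)) = (B * a - A * b) ^+ 2.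
    by rewrite /u (_ : B = 1 - A); [ring|lra].
  exact: sqr_ge0.
have h3 : 2 * x ^+ 2 / 3 * m ^+ 2 <= t * m ^+ 2 by rewrite ler_wpM2r // sqr_ge0.
have h4 : x * u ^+ 2 <= x * (A * a ^+ 2 + B * b ^+ 2) by rewrite ler_pM2l.
have h5 : 2 * x ^+ 2 / 3 * m ^+ 2 + (1 + x) * u ^+ 2 + (1 - x) * c ^+ 2 =
   (1 / 2 + x ^+ 2 / 6) * m ^+ 2 + 2 * (u + (1 - x) / 2 * m) ^+ 2 by rewrite cE; field.
have h6 : 0 <= 2 * (u + (1 - x) / 2 * m) ^+ 2 by rewrite mulr_ge0 // sqr_ge0.
have h7 : 0 < (1 / 2 + x ^+ 2 / 6) * m ^+ 2 + 2 * A * B * (a ^+ 2 + b ^+ 2).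
  have k1 : 0 < 1 / 2 + x ^+ 2 / 6 by rewrite ltr_pwDl // divr_ge0 // sqr_ge0.
  have k2 : 0 < 2 * A * B by rewrite !mulr_gt0.
  have [m0|m0] := eqVneq m 0; last first.
    apply: ltr_pwDl; first by rewrite mulr_gt0 // exprn_even_gt0.
    by rewrite mulr_ge0 ?addr_ge0 ?sqr_ge0 // ltW.
  rewrite m0 expr0n mulr0 add0r mulr_gt0 // lt0r addr_ge0 ?sqr_ge0 // andbT paddr_eq0 ?sqr_ge0 //.
  rewrite !sqrf_eq0; apply: contraTN abc => /andP[/eqP a0 /eqP b0].
  by rewrite a0 b0 cE m0 /u a0 b0 !mulr0 !addr0 eqxx.
lra.
Qed.

Lemma inv_tau_ge (x : R) : 0 < x -> 2 * x ^+ 2 / 3 <= (tau x)^-1.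
Proof.
move=> x0; have s0 := rt_gt0 hp hpq x0; have a0 := r0_gt0 hp hpq.
have s2 := rt_sqr hp hpq x0; have P4 := P_ge4 hp hpq.
rewrite /tau invf_div ler_pdivlMr; last by lra.
have as0 : 0 < r0 * rt x by rewrite mulr_gt0.
have -> : 2 * x * rt x * (r0 + x * rt x) = 2 * x * (r0 * rt x) + 2 * x ^+ 2 * rt x ^+ 2 by ring.
rewrite s2; have : 0 < x * (r0 * rt x) by rewrite mulr_gt0.
have -> : 2 * x ^+ 2 / 3 * (3 * x + 2 * (P - 1)) =
  2 * x ^+ 2 * (x + P - 1) - 2 * x ^+ 2 / 3 * (P - 1) by field.
have : 0 <= 2 * x ^+ 2 / 3 * (P - 1).
  by rewrite mulr_ge0 //; [rewrite divr_ge0 // mulr_ge0 // sqr_ge0|lra].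
lra.
Qed.

Lemma sphere_hessian_posdef (v : 'rV[R]_3) : cone_int p q v -> sym_posdef (sphere_hessian v).
Proof.
move=> [v0 v1 v2 W0]; have [x0 _] := logt_invP hp hpq W0.
split=> [i j|w w0].
  rewrite !mxE [v 0 i * _]mulrC -!mulrA [wvec i * _]mulrC eq_sym; congr ((_ + _) / _).
  by case: eqVneq => // ->.
rewrite qf_sphere_hessian ?gt_eqF //; apply: sphere_form_gt0 => //; first exact: inv_tau_ge.
rewrite !mulf_eq0 !invr_eq0 !(gt_eqF v0, gt_eqF v1, gt_eqF v2) !orbF.
apply: contraR w0; rewrite !negb_or !negbK => /andP[/andP[/eqP w0 /eqP w1] /eqP w2].
by apply/eqP/rowP; apply: ord3_ind; rewrite mxE.
Qed.

Lemma continuous_sphere_potential (v : 'rV[R]_3) : cone_int p q v ->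
  {for v, continuous sphere_potential}.
Proof.
move=> [v0 v1 v2 W0]; have [x0 _] := logt_invP hp hpq W0.
have rh0 : 0 < rho (logt_inv (logW v)) by apply: lt_trans ltr01 _; exact: rho_gt1.
have L (j : 'I_3) : 0 < v 0 j -> {for v, continuous (fun w : 'rV[R]_3 => ln (w 0 j))}.
  move=> vj; apply: (@continuous_comp _ _ _ (fun w : 'rV[R]_3 => w 0 j) (@ln R)).
    exact: coord_continuous.
  exact: continuous_ln.
have DC (f : R -> R) (t d : R) : is_derive t 1 f d -> {for t, continuous f}.
  by move=> [D _]; exact/differentiable_continuous/derivable1_diffP.
have C : {for v, continuous (fun w => ln (rho (logt_inv (logW w))))}.
  apply: (@continuous_comp _ _ _ logW (fun t => ln (rho (logt_inv t)))).
    exact: continuous_logW.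
  apply: (DC _ _ _ (is_derive_lnf (f := fun t => rho (logt_inv t)) rh0
     (is_derive_chain (f := logt_inv) (is_derive_rho hp hpq x0) (is_derive_logt_inv hp hpq W0)))).
exact: (cvgB C (cvgD (cvgD (L _ v0) (L _ v1)) (L _ v2))).
Qed.

Lemma sphere_potential_scale (v : 'rV[R]_3) (l : R) : cone_int p q v -> 0 < l ->
  sphere_potential (l *: v) = sphere_potential v - 3%:R * ln l.
Proof.
move=> [v0 v1 v2 W0] l0.
have E : logW (l *: v) = logW v.
  rewrite /(logW v) /(logW (l *: v)) !mxE !lnM ?posrE //.
  have -> : q^-1 = 1 - p^-1 by move: hpq; lra.
  by ring.
by rewrite /sphere_potential E !mxE !lnM ?posrE //; ring.
Qed.

(** In terms of the logarithmic derivatives y_j = w_j / c_j, which satisfy y_j' = - y_j^2, the first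
    derivative collapses to xi dW - (y_0 + y_1 + y_2) because d ln rho = xi d ln t. One more
    derivative gives tau^-1 dW^2 + xi dW' plus the sum of the y_j^2, and dW' supplies the xi in
    [diag_part]. *)
Lemma sphere_potential_deriv2 (v w : 'rV[R]_3) : cone_int p q v ->
  deriv2 (fun s => sphere_potential (v + s *: w)) 0 (qf (sphere_hessian v) w).
Proof.
move=> Cv; have Kv := (interior_power_cone p q v).2 Cv.
pose c (j : 'I_3) (s : R) : R := (v + s *: w) 0 j.
have Dc (j : 'I_3) (s : R) : is_derive s 1 (c j) (w 0 j).
  have -> : c j = (fun s => v 0 j + s * w 0 j) by apply/funext => t; rewrite /c !mxE.
  apply: is_derive_subst (is_derive_add (is_derive_const (v 0 j) s 1)
    (is_derive_mul (is_derive_id s (1 : R)) (is_derive_const (w 0 j) s 1))) _.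
  by rewrite add0r mul1r mulr0 addr0.
pose y (j : 'I_3) (s : R) := w 0 j / c j s.
have Dl (j : 'I_3) (s : R) : 0 < c j s -> is_derive s 1 (fun s => ln (c j s)) (y j s).
  by move=> cs; exact: is_derive_lnf.
have Dy (j : 'I_3) (s : R) : 0 < c j s -> is_derive s 1 (y j) (- y j s ^+ 2).
  move=> cs; have cn := lt0r_neq0 cs.
  apply: is_derive_subst (is_derive_scale (w 0 j) (is_derive_inv cn (Dc j s))) _.
  by rewrite /y; field.
pose dW s := y 2 s - p^-1 * y 0 s - q^-1 * y 1 s.
have DW (s : R) : cone_int p q (v + s *: w) ->
    is_derive s 1 (fun s => logW (v + s *: w)) (dW s).
  move=> [c0 c1 c2 _].
  have -> : (fun s => logW (v + s *: w)) =
      (fun s => ln (c 2 s) + -1 * (p^-1 * ln (c 0 s)) + -1 * (q^-1 * ln (c 1 s))).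
    by apply/funext => t; rewrite !mulN1r.
  apply: is_derive_subst (is_derive_add (is_derive_add (Dl _ _ c2)
    (is_derive_scale (-1) (is_derive_scale p^-1 (Dl _ _ c0))))
    (is_derive_scale (-1) (is_derive_scale q^-1 (Dl _ _ c1)))) _.
  by rewrite /dW; ring.
pose xi s := logt_inv (logW (v + s *: w)).
have Dxi (s : R) : cone_int p q (v + s *: w) -> is_derive s 1 xi ((tau (xi s))^-1 * dW s).
  move=> Cs; have [_ _ _ W0] := Cs.
  have D := is_derive_chain (h := logt_inv) (f := fun s : R => logW (v + s *: w))
    (is_derive_logt_inv hp hpq W0) (DW _ Cs).
  exact: D.
exists (fun s => xi s * dW s - (y 0 s + y 1 s + y 2 s)).
  apply: filterS (near_line w (@open_interior _ K) Kv) => s /(interior_power_cone p q) Cs.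
  have [c0 c1 c2 W0] := Cs; have [x0 _] := logt_invP hp hpq W0.
  have r0 : 0 < rho (xi s) by apply: lt_trans ltr01 _; exact: rho_gt1.
  have D1 := is_derive_lnf (f := fun s => rho (xi s)) r0
    (is_derive_chain (f := xi) (is_derive_rho hp hpq x0) (Dxi _ Cs)).
  have D2 := is_derive_add (is_derive_add (Dl _ _ c0) (Dl _ _ c1)) (Dl _ _ c2).
  have D := is_derive_add D1 (is_derive_scale (-1) D2).
  have -> : (fun s => sphere_potential (v + s *: w)) = (fun s => ln (rho (xi s)) +
      -1 * (ln (c 0 s) + ln (c 1 s) + ln (c 2 s))).
    by apply/funext => t; rewrite /sphere_potential mulN1r.
  apply: is_derive_subst D _; rewrite mulN1r; congr (_ - _).
  have := lt0r_neq0 (tau_gt0 hp hpq x0); have := lt0r_neq0 r0; rewrite -/(xi s).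
  by move=> rn tn; field; rewrite rn tn.
have C0 : cone_int p q (v + 0 *: w) by rewrite scale0r addr0.
have [c0 c1 c2 W0] := C0.
have Ddw := is_derive_add (is_derive_add (Dy _ _ c2) (is_derive_scale (-1) (is_derive_scale p^-1 (Dy _ _ c0))))
    (is_derive_scale (-1) (is_derive_scale q^-1 (Dy _ _ c1))).
have D1 := is_derive_mul (Dxi _ C0) Ddw.
have D2 := is_derive_add (is_derive_add (Dy _ _ c0) (Dy _ _ c1)) (Dy _ _ c2).
have D := is_derive_add D1 (is_derive_scale (-1) D2).
have -> : (fun s => xi s * dW s - (y 0 s + y 1 s + y 2 s)) =
  (fun s => xi s * (y 2 s + -1 * (p^-1 * y 0 s) + -1 * (q^-1 * y 1 s)) + -1 * (y 0 s + y 1 s + y 2 s)).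
  by apply/funext => t; rewrite /dW !mulN1r.
apply: is_derive_subst D _.
have [v0 v1 v2 _] := Cv.
rewrite qf_sphere_hessian ?gt_eqF // /dW /xi /y /c scale0r addr0.
have pn := lt0r_neq0 (p_gt0 hp); have qn := lt0r_neq0 (q_gt0 hp hpq).
move: (w 0 0 / _) (w 0 1 / _) (w 0 2 / _) (logt_inv _) => y0 y1 y2 x.
move: ((tau x)^-1) => t.
by field; rewrite pn qn.
Qed.

(** If a coordinate of b vanishes, its logarithm diverges, the other logarithms are bounded above,
    and ln rho >= 0. If none vanishes, then logW b >= 0, so that xi and with it ln rho tends to
    infinity. *)
Lemma sphere_potential_blowup (b : 'rV[R]_3) : boundary K b ->
  sphere_potential @ within K° (nbhs b) --> +oo.
Proof.
move=> [cb nb]; have [b0 b1 b2 _] := closure_power_cone hp hpq cb.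
apply/cvgryPge => A; rewrite near_withinE.
have rho0 (v : 'rV[R]_3) : cone_int p q v -> 0 <= ln (rho (logt_inv (logW v))).
  by move=> [_ _ _ W0]; have [x0 _] := logt_invP hp hpq W0; rewrite ln_ge0 // ltW // rho_gt1.
have nc j (a : R) : b 0 j < a -> \forall v \near b, (v : 'rV[R]_3) 0 j < a.
  by move=> ba; apply: (@near_lt _ _ (fun w : 'rV[R]_3 => w 0 j)) => //; exact: coord_continuous.
pose B (j : 'I_3) := ln (b 0 j + 1).
have lnB (v : 'rV[R]_3) j : 0 < v 0 j -> v 0 j < b 0 j + 1 -> ln (v 0 j) <= B j.
  by move=> vj vb; rewrite ler_ln ?posrE ?(lt_trans vj vb) //; exact: ltW.
have NB j : \forall v \near b, (v : 'rV[R]_3) 0 j < b 0 j + 1 by apply: nc; rewrite ltrDl.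
have zero j (C : R) : b 0 j = 0 -> \forall v \near b, 0 < (v : 'rV[R]_3) 0 j -> ln (v 0 j) <= C.
  move=> bj; have : \forall v \near b, (v : 'rV[R]_3) 0 j < expR C by apply: nc; rewrite bj expR_gt0.
  by apply: filterS => v vC v0; rewrite -[C]expRK ler_ln ?posrE ?expR_gt0 // ltW.
have [E0|n0] := eqVneq (b 0 0) 0.
  near=> v; move=> /(interior_power_cone p q) Cv; have [v0 v1 v2 _] := Cv.
  have h1 : ln (v 0 1) <= B 1 by apply: lnB => //; near: v; exact: NB.
  have h2 : ln (v 0 2) <= B 2 by apply: lnB => //; near: v; exact: NB.
  have h0 : ln (v 0 0) <= - A - B 1 - B 2 by move: v0; near: v; exact: zero.
  by have := rho0 _ Cv; rewrite /sphere_potential; lra.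
have [E1|n1] := eqVneq (b 0 1) 0.
  near=> v; move=> /(interior_power_cone p q) Cv; have [v0 v1 v2 _] := Cv.
  have h1 : ln (v 0 0) <= B 0 by apply: lnB => //; near: v; exact: NB.
  have h2 : ln (v 0 2) <= B 2 by apply: lnB => //; near: v; exact: NB.
  have h0 : ln (v 0 1) <= - A - B 0 - B 2 by move: v1; near: v; exact: zero.
  by have := rho0 _ Cv; rewrite /sphere_potential; lra.
have [E2|n2] := eqVneq (b 0 2) 0.
  near=> v; move=> /(interior_power_cone p q) Cv; have [v0 v1 v2 _] := Cv.
  have h1 : ln (v 0 0) <= B 0 by apply: lnB => //; near: v; exact: NB.
  have h2 : ln (v 0 1) <= B 1 by apply: lnB => //; near: v; exact: NB.
  have h0 : ln (v 0 2) <= - A - B 0 - B 1 by move: v2; near: v; exact: zero.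
  by have := rho0 _ Cv; rewrite /sphere_potential; lra.
have c0 : 0 < b 0 0 by rewrite lt0r n0.
have c1 : 0 < b 0 1 by rewrite lt0r n1.
have c2 : 0 < b 0 2 by rewrite lt0r n2.
have W0 : 0 <= logW b.
  rewrite leNgt; apply/negP => W0; apply: nb; apply/(interior_power_cone p q).
  by split.
(* For xi >= X, since rt xi >= 1, rho is at least xi / r0, hence at least the exponential here. *)
pose X := Num.max 1 (expR (A + B 0 + B 1 + B 2) * r0).
have X0 : 0 < X by rewrite lt_max ltr01.
have NW : \forall v \near b, logt X < logW v.
  apply: near_gt; first exact: continuous_logW.
  by apply: lt_le_trans W0; exact: logt_lt0.
near=> v; move=> /(interior_power_cone p q) Cv; have [v0 v1 v2 Wv] := Cv.
have h0 : ln (v 0 0) <= B 0 by apply: lnB => //; near: v; exact: NB.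
have h1 : ln (v 0 1) <= B 1 by apply: lnB => //; near: v; exact: NB.
have h2 : ln (v 0 2) <= B 2 by apply: lnB => //; near: v; exact: NB.
have [x0 xE] := logt_invP hp hpq Wv.
have Xx : X <= logt_inv (logW v).
  rewrite leNgt; apply/negP => /(logt_lt hp hpq x0); rewrite xE ltNge => /negP; apply.
  by apply: ltW; near: v; exact: NW.
have h3 : A + B 0 + B 1 + B 2 <= ln (rho (logt_inv (logW v))).
  rewrite -[leLHS]expRK ler_ln ?posrE ?expR_gt0 //; last first.
    by apply: lt_trans ltr01 _; exact: rho_gt1.
  move: Xx; rewrite ge_max => /andP[x1 Xx].
  have a0 := r0_gt0 hp hpq.
  have s1 : 1 <= rt (logt_inv (logW v)).
    have s2 := rt_sqr hp hpq x0; have s0 := rt_gt0 hp hpq x0; have P4 := P_ge4 hp hpq.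
    have h : 1 <= rt (logt_inv (logW v)) ^+ 2 by rewrite s2; lra.
    by nra.
  rewrite /rho; apply: le_trans (_ : logt_inv (logW v) * rt (logt_inv (logW v)) / r0 <= _); last first.
    by rewrite lerDr.
  rewrite ler_pdivlMr //; apply: le_trans Xx _; rewrite ler_peMr //; exact: ltW.
by rewrite /sphere_potential; lra.
Unshelve. all: by end_near. Qed.

Lemma sphere_potential_like : potential_like K sphere_potential.
Proof.
split=> [v /(interior_power_cone p q)|b|v l /(interior_power_cone p q) Cv l0|v].
- exact: continuous_sphere_potential.
- exact: sphere_potential_blowup.
- exact: sphere_potential_scale.
move=> /(interior_power_cone p q) Cv; exists (sphere_hessian v); split.
- exact: sphere_hessian_posdef.
- exact: det_sphere_hessian.
- by move=> w; exact: sphere_potential_deriv2.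
Qed.

Lemma canonical_potentialE F : canonical_potential K F ->
  forall v, K° v -> F v = sphere_potential v.
Proof.
move=> /canonical_potential_like pF.
exact: (power_cone_potential_eq hp hpq pF sphere_potential_like).
Qed.

End SpherePotential.

(** * Smoothness of the immersion *)

Lemma near_eq_differentiable (R : realType) (V W : normedModType R) (f g : V -> W) (x : V) :
  {near x, f =1 g} -> differentiable f x -> differentiable g x.
Proof.
move=> fg df; have fgx : f x = g x := nbhs_singleton fg.
have E : g \o shift x = cst (g x) + 'd f x +o_ 0 id.
  apply/eqaddoP => e e0; have /eqaddoP /(_ _ e0) := diff_locally df.
  have N : \forall y \near (0 : V), f (y + x) = g (y + x).
    by move: fg; rewrite (near_shift 0) subr0.
  by apply: filterS2 N => y /= fgy; rewrite !fctE /= fgy fgx.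
have dE := diff_unique (diff_continuous df) E.
by apply/diff_locallyP; rewrite dE; split; [exact: diff_continuous|exact: E].
Qed.

Lemma differentiable_row (R : realType) (V : normedModType R) n (f : V -> 'rV[R]_n) (x : V) :
  (forall j, differentiable (fun y => f y 0 j) x) -> differentiable f x.
Proof.
move=> df; have -> : f = \sum_(j < n) (fun y => f y 0 j *: delta_mx 0 j).
  by apply/funext => y; rewrite fct_sumE [LHS]row_sum_delta.
by apply: differentiable_sum => j; exact: differentiableZl.
Qed.

Lemma is_derive_rowP (R : realType) (V : normedModType R) n (f : V -> 'rV[R]_n) (x v : V)
    (d : 'rV[R]_n) :
  (forall j, is_derive x v (fun y => f y 0 j) (d 0 j)) -> is_derive x v f d.
Proof.
move=> fd; have D : derivable f x v.
  by apply/derivable_mxP => i j; rewrite (ord1 i); have [] := fd j.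
split=> //; rewrite derive_mx //; apply/rowP => j; rewrite !mxE.
by have [_ ->] := fd j.
Qed.

Lemma is_derive_coord (R : realType) n (x v : 'rV[R]_n) j :
  is_derive x v (fun y : 'rV[R]_n => y 0 j) (v 0 j).
Proof.
have := (is_derive_lineP (fun y : 'rV[R]_n => y 0 j) x v 0 (v 0 j)).2.
rewrite scale0r addr0; apply.
have -> : (fun s : R => (x + s *: v) 0 j) = (fun s => x 0 j + s * v 0 j).
  by apply/funext => s; rewrite !mxE.
apply: is_derive_subst (is_derive_add (is_derive_const (x 0 j) (0 : R) 1)
  (is_derive_mul (is_derive_id (0 : R) (1 : R)) (is_derive_const (v 0 j) (0 : R) 1))) _.
by rewrite add0r mul1r mul0r addr0.
Qed.

Section Elementary.
Variables (R : realType) (n : nat) (U : set 'rV[R]_n).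
Hypothesis oU : open U.

(* A class closed under directional derivatives, so that its members are smooth. *)
Inductive elementary : ('rV[R]_n -> R) -> Prop :=
| elem_cst c : elementary (fun=> c)
| elem_coord j : elementary (fun x => x 0 j)
| elem_add f g : elementary f -> elementary g -> elementary (fun x => f x + g x)
| elem_mul f g : elementary f -> elementary g -> elementary (fun x => f x * g x)
| elem_exp f : elementary f -> elementary (fun x => expR (f x))
| elem_ln f : (forall x, U x -> 0 < f x) -> elementary f -> elementary (fun x => ln (f x))
| elem_ext f g : elementary f -> (forall x, U x -> f x = g x) -> elementary g.

Lemma elem_opp f : elementary f -> elementary (fun x => - f x).
Proof.
move=> fe; apply: elem_ext (elem_mul (elem_cst (-1)) fe) _ => x _; exact: mulN1r.
Qed.

Lemma elem_inv f : (forall x, U x -> 0 < f x) -> elementary f -> elementary (fun x => (f x)^-1).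
Proof.
move=> f0 fe; apply: elem_ext (elem_exp (elem_opp (elem_ln f0 fe))) _ => x Ux.
by rewrite expRN lnK // posrE f0.
Qed.

Lemma elem_sqrt f : (forall x, U x -> 0 < f x) -> elementary f ->
  elementary (fun x => Num.sqrt (f x)).
Proof.
move=> f0 fe; apply: elem_ext (elem_exp (elem_mul (elem_cst 2^-1) (elem_ln f0 fe))) _ => x Ux.
have fx := f0 _ Ux; have s0 : 0 < Num.sqrt (f x) by rewrite sqrtr_gt0.
rewrite -[in ln _](sqr_sqrtr (ltW fx)) lnXn // -[ln _ *+ 2]mulr_natl mulrA mulVf // mul1r lnK // posrE.
Qed.

Lemma elem_derive f v : elementary f -> exists2 g, elementary g &
  forall x, U x -> is_derive x v f (g x).
Proof.
elim=> {f} [c|j|f g _ [df ed Df] _ [dg eg Dg]|f g fe [df ed Df] ge [dg eg Dg]|f fe [df ed Df]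
  |f f0 fe [df ed Df]|f g _ [df ed Df] fg].
- by exists (fun=> 0); [exact: elem_cst|move=> x _; exact: is_derive_const].
- by exists (fun=> v 0 j); [exact: elem_cst|move=> x _; exact: is_derive_coord].
- exists (fun x => df x + dg x); first exact: elem_add.
  by move=> x Ux; apply: is_derive_add; [exact: Df|exact: Dg].
- exists (fun x => df x * g x + f x * dg x).
    by apply: elem_add; exact: elem_mul.
  by move=> x Ux; apply: is_derive_mul; [exact: Df|exact: Dg].
- exists (fun x => expR (f x) * df x); first by apply: elem_mul => //; exact: elem_exp.
  by move=> x Ux; apply: is_derive_expf; exact: Df.
- exists (fun x => df x * (f x)^-1); first by apply: elem_mul => //; exact: elem_inv.
  by move=> x Ux; apply: is_derive_lnf; [exact: f0|exact: Df].
- exists df => // x Ux; apply: near_eq_is_derive (Df _ Ux).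
  by apply: filterS (open_nbhs_nbhs (conj oU Ux)) => y /fg.
Qed.

Lemma elem_differentiable f x : elementary f -> U x -> differentiable f x.
Proof.
move=> fe Ux; elim: fe => {f} [c|j|f g _ df _ dg|f g _ df _ dg|f _ df|f f0 _ df|f g _ df fg].
- exact: differentiable_cst.
- exact: differentiable_coord.
- exact: differentiableD.
- exact: differentiableM.
- apply: (@differentiable_comp _ _ _ _ f expR) => //.
  exact/derivable1_diffP.
- apply: (@differentiable_comp _ _ _ _ f (@ln R)) => //.
  by have [D _] := is_derive1_ln (f0 _ Ux); exact/derivable1_diffP.
- apply: near_eq_differentiable df.
  by apply: filterS (open_nbhs_nbhs (conj oU Ux)) => y /fg.
Qed.

Lemma elem_continuous f x : elementary f -> U x -> {for x, continuous f}.
Proof. by move=> fe Ux; exact/differentiable_continuous/elem_differentiable. Qed.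

Lemma elem_row_derive m (F : 'rV[R]_n -> 'rV[R]_m) v :
  (forall j, elementary (fun x => F x 0 j)) -> (forall x, U x -> derivable F x v) /\
  forall j, elementary (fun x => ('D_v F x) 0 j).
Proof.
move=> Fe.
have H j x : U x -> derivable (fun x => F x 0 j) x v.
  by move=> Ux; have [g _ /(_ _ Ux)[]] := elem_derive v (Fe j).
have D x : U x -> derivable F x v.
  by move=> Ux; apply/derivable_mxP => i j; rewrite (ord1 i); exact: H.
split=> // j; have [g ge Dg] := elem_derive v (Fe j).
apply: elem_ext ge _ => x Ux; rewrite derive_mx ?mxE; last exact: D.
by have [_ ->] := Dg _ Ux.
Qed.

Lemma elem_row_Ck m (F : 'rV[R]_n -> 'rV[R]_m) k :
  (forall j, elementary (fun x => F x 0 j)) -> Ck_on k U F.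
Proof.
elim: k F => [|k IH] F Fe; (split; [move=> x Ux|]) => //.
- apply: (@cvg_rowP R _ (nbhs x) (nbhs_filter x) m F) => j.
  exact: (elem_continuous (Fe j) Ux).
- apply: (@cvg_rowP R _ (nbhs x) (nbhs_filter x) m F) => j.
  exact: (elem_continuous (Fe j) Ux).
by move=> v; have [D De] := elem_row_derive v Fe; split; [exact: D|exact: IH].
Qed.

Lemma elem_row_differentiable m (F : 'rV[R]_n -> 'rV[R]_m) x :
  (forall j, elementary (fun x => F x 0 j)) -> U x -> differentiable F x.
Proof.
by move=> Fe Ux; apply: differentiable_row => j; exact: elem_differentiable.
Qed.

End Elementary.

Section SphereParam.
Variables (R : realType) (p q : R).
Hypotheses (hp : 2 <= p) (hpq : p^-1 + q^-1 = 1).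

Local Notation P := (p + q).
Local Notation rt := (rt p q).
Local Notation logt := (logt p q).
Local Notation tau := (tau p q).
Local Notation rho := (rho p q).
Local Notation f := (sphere_param p q).

Definition half_plane : set 'rV[R]_2 := [set u | 0 < u 0 0].
Local Notation U := half_plane.

Lemma open_half_plane : open U.
Proof.
apply: (@open_comp _ _ (fun u : 'rV[R]_2 => u 0 0) [set t | 0 < t]); last exact: open_gt.
by move=> u _; exact: coord_continuous.
Qed.

(* The coordinates of the immersion are exp (phi_i xi + m_i mu), with
   phi_i = (ln rho + a_i ln t) / 3. *)
Definition sph_a (i : 'I_3) : R := if i == 2 then 2 else -1.

Definition sph_m (i : 'I_3) : R :=
  if i == 0 then (q + 1) / (3 * q) else if i == 1 then - ((p + 1) / (3 * p))
  else - ((p - q) / (3 * P)).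

Definition sph_phi (i : 'I_3) (x : R) : R := (ln (rho x) + sph_a i * logt x) / 3.

Definition sph_dphi (i : 'I_3) (x : R) : R := (x + sph_a i) * tau x / 3.

Lemma sphere_paramE (u : 'rV[R]_2) i : U u ->
  f u 0 i = expR (sph_phi i (u 0 0) + sph_m i * u 0 1).
Proof.
move=> x0; have r0 : 0 < rho (u 0 0) by apply: lt_trans ltr01 _; exact: rho_gt1.
rewrite /sphere_param mxE -/(rt _) -/(rho _) (sphere_tE hp hpq) // !mxE.
rewrite {1}/powR (gt_eqF r0).
have T (a : R) : expR (logt (u 0 0)) `^ a = expR (a * logt (u 0 0)).
  by rewrite /powR gt_eqF ?expR_gt0 // expRK.
have pn := lt0r_neq0 (p_gt0 hp); have qn := lt0r_neq0 (q_gt0 hp hpq).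
have Pn : P != 0 by rewrite gt_eqF // addr_gt0 ?(p_gt0 hp) // (q_gt0 hp hpq).
by move: i; apply: ord3_ind; rewrite /sph_phi /sph_m /sph_a /= T -!expRD; congr expR;
  field; rewrite ?pn ?qn ?Pn.
Qed.

Lemma elem_rt : elementary U (fun u => rt (u 0 0)).
Proof.
apply: elem_sqrt; last by do 3![apply: elem_add; last exact: elem_cst]; exact: elem_coord.
by move=> u u0; have := P_ge4 hp hpq; move: u0; rewrite /half_plane /=; lra.
Qed.

Lemma elem_rho : elementary U (fun u => rho (u 0 0)).
Proof.
apply: elem_add; first exact: elem_cst.
by apply: elem_mul; [apply: elem_mul; [exact: elem_coord|exact: elem_rt]|exact: elem_cst].
Qed.

Lemma elem_logt : elementary U (fun u => logt (u 0 0)).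
Proof.
have L c : (forall u, U u -> 0 < rt (u 0 0) + c) ->
    elementary U (fun u => ln (rt (u 0 0) + c)).
  by move=> h; apply: elem_ln => //; apply: elem_add; [exact: elem_rt|exact: elem_cst].
rewrite /(logt _).
apply: elem_add; first apply: elem_add; first apply: elem_add.
- by apply: L => u u0; apply: addr_gt0; [exact: rt_gt0|exact: r0_gt0].
- apply: elem_mul; first exact: elem_cst.
  apply: elem_add; first by apply: elem_ln; [|exact: elem_coord].
  apply/elem_opp/elem_mul; first exact: elem_cst.
  by apply: L => u u0; apply: addr_gt0; [exact: rt_gt0|exact: r1_gt0].
- apply/elem_opp/elem_mul; first exact: elem_cst.
  by apply: L => u u0; rewrite subr_gt0 rt_gtq.
- apply/elem_opp/elem_mul; first exact: elem_cst.
  by apply: L => u u0; rewrite subr_gt0 rt_gtp.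
Qed.

Lemma elem_sphere_param i : elementary U (fun u => f u 0 i).
Proof.
apply: (@elem_ext _ _ _ (fun u => expR ((ln (rho (u 0 0)) + sph_a i * logt (u 0 0)) * 3^-1
    + sph_m i * u 0 1))); last by move=> u Uu; rewrite sphere_paramE.
apply: elem_exp; apply: elem_add; last first.
  by apply: elem_mul; [exact: elem_cst|exact: elem_coord].
apply: elem_mul; last exact: elem_cst.
apply: elem_add.
  apply: elem_ln; last exact: elem_rho.
  by move=> u u0; apply: lt_trans ltr01 _; exact: rho_gt1.
by apply: elem_mul; [exact: elem_cst|exact: elem_logt].
Qed.

Lemma sphere_param_smooth : smooth_on U f.
Proof. by move=> k; apply: (elem_row_Ck open_half_plane) => j; exact: elem_sphere_param. Qed.

Lemma sphere_param_differentiable u : U u -> differentiable f u.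
Proof.
by move=> Uu; apply: (elem_row_differentiable open_half_plane) => // j; exact: elem_sphere_param.
Qed.

Lemma is_derive_sph_phi i (x : R) : 0 < x -> is_derive x 1 (sph_phi i) (sph_dphi i x).
Proof.
move=> x0; have r0 : 0 < rho x by apply: lt_trans ltr01 _; exact: rho_gt1.
have D := is_derive_mul (is_derive_add (is_derive_lnf r0 (is_derive_rho hp hpq x0))
  (is_derive_scale (sph_a i) (is_derive_logt hp hpq x0))) (is_derive_const 3^-1 x 1).
apply: is_derive_subst D _; rewrite /sph_dphi.
by field; rewrite gt_eqF.
Qed.

(* The derivative of the logarithm of the i-th coordinate along v. *)
Definition sph_X (u v : 'rV[R]_2) (i : 'I_3) : R :=
  sph_dphi i (u 0 0) * v 0 0 + sph_m i * v 0 1.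

Lemma sphere_param_derive u v : U u -> is_derive u v f (\row_i (f u 0 i * sph_X u v i)).
Proof.
move=> Uu; apply: is_derive_rowP => i; rewrite mxE.
have D : is_derive u v (fun w : 'rV[R]_2 => expR (sph_phi i (w 0 0) + sph_m i * w 0 1))
    (f u 0 i * sph_X u v i).
  rewrite sphere_paramE //; apply: is_derive_expf; apply: is_derive_add.
    apply: (is_derive_chain (h := sph_phi i) (f := fun w : 'rV[R]_2 => w 0 0)).
      exact: is_derive_sph_phi.
    exact: is_derive_coord.
  by apply: is_derive_scale; exact: is_derive_coord.
apply: near_eq_is_derive D.
by apply: filterS (open_nbhs_nbhs (conj open_half_plane Uu)) => w Uw; rewrite sphere_paramE.
Qed.

Lemma sphere_param_diff u v : U u -> 'd f u v = \row_i (f u 0 i * sph_X u v i).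
Proof.
move=> Uu; rewrite -deriveE; last exact: sphere_param_differentiable.
by have [_ ->] := sphere_param_derive v Uu.
Qed.

End SphereParam.

(** * Affine normal and affine metric *)

(** With a = sqrt(p + q), d = p - q and t = tau x, the left side is the determinant of [met_form]
    and 1 + x s / a is rho. The relation d^2 = a^2 (a^2 - 4) is (p - q)^2 = (p + q)^2 - 4 p q with p
    q = p + q. *)
Lemma metric_det_identity (F : realFieldType) (x s a d t : F) :
  s ^+ 2 = x + a ^+ 2 - 1 -> d ^+ 2 = a ^+ 2 * (a ^+ 2 - 4) ->
  a != 0 -> x != 0 -> s != 0 -> a + x * s != 0 ->
  t = (3 * x + 2 * (a ^+ 2 - 1)) / (2 * x * s * (a + x * s)) ->
  (t - t ^+ 2 * (x ^+ 2 + x - 2) / 3) * ((3 * x + 2 * (a ^+ 2 - 1)) / (3 * a ^+ 2))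
    - (t * (x - 1) * d / (3 * a ^+ 2)) ^+ 2 = (1 + x * s / a) ^+ 2 * t ^+ 2 / 3.
Proof.
move=> s2 d2 a0 x0 s0 as0 tE.
have E : 3 * x + 2 * (a ^+ 2 - 1) = t * (2 * x * s * (a + x * s)).
  by rewrite tE divfK // !mulf_neq0.
have -> : (t * (x - 1) * d / (3 * a ^+ 2)) ^+ 2 = t ^+ 2 * (x - 1) ^+ 2 * (a ^+ 2 - 4) / (9 * a ^+ 2).
  by rewrite !exprMn d2 exprVn; field.
have -> : (t - t ^+ 2 * (x ^+ 2 + x - 2) / 3) * ((3 * x + 2 * (a ^+ 2 - 1)) / (3 * a ^+ 2)) =
  t ^+ 2 * (2 * x * s * (a + x * s)) / (3 * a ^+ 2)
   - t ^+ 2 * (3 * x + 2 * (a ^+ 2 - 1)) * (x ^+ 2 + x - 2) / (9 * a ^+ 2).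
  by rewrite {2}E E; field.
have -> : (1 + x * s / a) ^+ 2 = (a ^+ 2 + 2 * a * x * s + x ^+ 2 * s ^+ 2) / a ^+ 2 by field.
have -> : 2 * x * s * (a + x * s) = 2 * x * s * a + 2 * x ^+ 2 * s ^+ 2 by ring.
by rewrite s2; field.
Qed.

(** For e = 3 x + 2 (p + q - 1), the numerator of tau, this splits the factor [met_mm] off rho^2
    tau^2 / 3; the next identity splits off tau. *)
Lemma metric_det_factor (F : realFieldType) (x s a e : F) :
  a != 0 -> x != 0 -> s != 0 -> a + x * s != 0 ->
  (1 + x * s / a) ^+ 2 * (e / (2 * x * s * (a + x * s))) ^+ 2 / 3 =
  e / (4 * x ^+ 2 * s ^+ 2) * (e / (3 * a ^+ 2)).
Proof. by move=> a0 x0 s0 as0; field; rewrite a0 x0 s0 as0. Qed.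

Lemma metric_tau_factor (F : realFieldType) (x s a e : F) :
  a != 0 -> x != 0 -> s != 0 -> a + x * s != 0 ->
  (1 + x * s / a) ^+ 2 * (e / (2 * x * s * (a + x * s))) ^+ 2 =
  (a + x * s) * e / (2 * a ^+ 2 * x * s) * (e / (2 * x * s * (a + x * s))).
Proof. by move=> a0 x0 s0 as0; field; rewrite a0 x0 s0 as0. Qed.

Lemma sum2 (V : zmodType) (f : 'I_2 -> V) : \sum_i f i = f 0 + f 1.
Proof. by rewrite !big_ord_recl big_ord0 addr0; congr (f _ + f _); exact/val_inj. Qed.

Lemma ord2_ind (Q : 'I_2 -> Prop) : Q 0 -> Q 1 -> forall i, Q i.
Proof.
move=> Q0 Q1 [[|[|//]] i2].
- by have <- : 0 = Ordinal i2 by apply/val_inj.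
- by have <- : 1 = Ordinal i2 by apply/val_inj.
Qed.

Section Metric.
Variables (R : realType) (p q : R).
Hypotheses (hp : 2 <= p) (hpq : p^-1 + q^-1 = 1).

Local Notation P := (p + q).
Local Notation rt := (rt p q).
Local Notation tau := (tau p q).
Local Notation rho := (rho p q).
Local Notation f := (sphere_param p q).
Local Notation U := (@half_plane R).
Local Notation r0 := (Num.sqrt P).

Let pn : p != 0. Proof. exact: lt0r_neq0 (p_gt0 hp). Qed.
Let qn : q != 0. Proof. exact: lt0r_neq0 (q_gt0 hp hpq). Qed.
Let Pn : P != 0.
Proof. by rewrite gt_eqF //; have := P_ge4 hp hpq; lra. Qed.

(** [met_xx], [met_xm] and [met_mm] are the coefficients of the form H in the Gauss formula with
    transversal vector f / 3. *)
Definition met_xx (x : R) : R := tau x - tau x ^+ 2 * (x ^+ 2 + x - 2) / 3.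
Definition met_xm (x : R) : R := tau x * (x - 1) * (p - q) / (3 * P).
Definition met_mm (x : R) : R := (3 * x + 2 * (P - 1)) / (3 * P).

Definition met_form (x : R) (v w : 'rV[R]_2) : R :=
  met_xx x * (v 0 0 * w 0 0) + met_xm x * (v 0 0 * w 0 1 + v 0 1 * w 0 0)
  + met_mm x * (v 0 1 * w 0 1).

(* The volume condition forces c^4 = 1/27. *)
Definition sph_c : R := (Num.sqrt (Num.sqrt 27))^-1.

Lemma sph_c_gt0 : 0 < sph_c.
Proof. by rewrite invr_gt0 !sqrtr_gt0. Qed.

Lemma sph_c4 : sph_c ^+ 4 = 27^-1.
Proof. by rewrite exprVn (exprM _ 2 2) !sqr_sqrtr // sqrtr_ge0. Qed.

(** The factor (3 c)^-1 turns H f / 3 into h N for N = c f. *)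
Definition sph_metric (u : 'rV[R]_2) : 'M[R]_2 :=
  \matrix_(i < 2, j < 2) ((3 * sph_c)^-1 *
    (if i == 0 then if j == 0 then met_xx (u 0 0) else met_xm (u 0 0)
     else if j == 0 then met_xm (u 0 0) else met_mm (u 0 0))).

Definition sph_normal (u : 'rV[R]_2) : 'rV[R]_3 := sph_c *: f u.

Lemma sph_metricE u v w :
  (v *m sph_metric u *m w^T) 0 0 = (3 * sph_c)^-1 * met_form (u 0 0) v w.
Proof. by rewrite !mxE sum2 !mxE !sum2 !mxE /= /met_form; ring. Qed.

Lemma met_det (x : R) : 0 < x -> met_xx x * met_mm x - met_xm x ^+ 2 = rho x ^+ 2 * tau x ^+ 2 / 3.
Proof.
move=> x0; have a0 := r0_gt0 hp hpq; have s0 := rt_gt0 hp hpq x0.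
have a2 := r0_sqr hp hpq; have s2 := rt_sqr hp hpq x0.
have s2' : rt x ^+ 2 = x + r0 ^+ 2 - 1 by rewrite a2.
have d2 : (p - q) ^+ 2 = r0 ^+ 2 * (r0 ^+ 2 - 4).
  have -> : (p - q) ^+ 2 = P ^+ 2 - 4 * (p * q) by ring.
  by rewrite -(P_mul hp hpq) a2; ring.
have as0 : 0 < r0 + x * rt x by rewrite addr_gt0 // mulr_gt0.
have tE : tau x = (3 * x + 2 * (r0 ^+ 2 - 1)) / (2 * x * rt x * (r0 + x * rt x)) by rewrite a2.
have := metric_det_identity s2' d2 (lt0r_neq0 a0) (lt0r_neq0 x0) (lt0r_neq0 s0) (lt0r_neq0 as0) tE.
by rewrite a2.
Qed.

Lemma met_mm_gt0 (x : R) : 0 < x -> 0 < met_mm x.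
Proof. by move=> x0; have P4 := P_ge4 hp hpq; rewrite divr_gt0 //; lra. Qed.

Lemma rho_gt0 (x : R) : 0 < x -> 0 < rho x.
Proof. by move=> x0; apply: lt_trans ltr01 _; exact: rho_gt1. Qed.

Lemma met_det_gt0 (x : R) : 0 < x -> 0 < met_xx x * met_mm x - met_xm x ^+ 2.
Proof.
by move=> x0; rewrite met_det // divr_gt0 // mulr_gt0 // exprn_gt0 ?rho_gt0 // tau_gt0.
Qed.

Lemma met_xx_gt0 (x : R) : 0 < x -> 0 < met_xx x.
Proof.
move=> x0; have := met_det_gt0 x0; rewrite subr_gt0 => /(le_lt_trans (sqr_ge0 _)).
by rewrite pmulr_lgt0 // met_mm_gt0.
Qed.

(** Minimising the form over w leaves ((a c - b^2) / c) v^2. *)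
Lemma form_ge (a b c d v w : R) : 0 < c -> d * c <= a * c - b ^+ 2 ->
  d * v ^+ 2 <= a * (v * v) + b * (v * w + w * v) + c * (w * w).
Proof.
move=> c0 dc; rewrite -(ler_pM2l c0) -subr_ge0.
have -> : c * (a * (v * v) + b * (v * w + w * v) + c * (w * w)) - c * (d * v ^+ 2) =
  (c * w + b * v) ^+ 2 + (a * c - b ^+ 2 - d * c) * v ^+ 2 by ring.
by rewrite addr_ge0 ?sqr_ge0 // mulr_ge0 ?sqr_ge0 // subr_ge0.
Qed.

(** The determinant divided by [met_mm] is (3 x + 2 (P - 1)) / (4 x^2 s^2) with s = rt x, and the
    numerator is at least 2 s^2 = 2 (x + P - 1). *)
Lemma met_form_ge_xi (x : R) (v : 'rV[R]_2) : 0 < x -> 2^-1 * (v 0 0 / x) ^+ 2 <= met_form x v v.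
Proof.
move=> x0.
have a0 := r0_gt0 hp hpq; have s0 := rt_gt0 hp hpq x0.
have a2 := r0_sqr hp hpq; have s2 := rt_sqr hp hpq x0; have P4 := P_ge4 hp hpq.
have -> : 2^-1 * (v 0 0 / x) ^+ 2 = (2 * x ^+ 2)^-1 * v 0 0 ^+ 2 by field; rewrite gt_eqF.
apply: form_ge; rewrite ?met_mm_gt0 // met_det //.
have as0 : 0 < r0 + x * rt x by rewrite addr_gt0 // mulr_gt0.
have -> : rho x ^+ 2 * tau x ^+ 2 / 3 =
    (3 * x + 2 * (P - 1)) / (4 * x ^+ 2 * rt x ^+ 2) * met_mm x.
  have := metric_det_factor (3 * x + 2 * (P - 1)) (lt0r_neq0 a0) (lt0r_neq0 x0) (lt0r_neq0 s0)
    (lt0r_neq0 as0).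
  by rewrite a2 => <-.
rewrite ler_pM2r ?met_mm_gt0 // ler_pdivlMr ?mulr_gt0 ?exprn_gt0 // s2.
have -> : (2 * x ^+ 2)^-1 * (4 * x ^+ 2 * (x + P - 1)) = 2 * (x + P - 1) by field; rewrite gt_eqF.
lra.
Qed.

(** The constant 1/16 leaves room: [met_xx] is at most tau + (2/3) tau^2, which is at most 2 rho^2
    tau^2, six times the determinant. *)
Lemma met_form_ge_mu (x : R) (v : 'rV[R]_2) : 0 < x -> 16^-1 * v 0 1 ^+ 2 <= met_form x v v.
Proof.
move=> x0.
have a0 := r0_gt0 hp hpq; have s0 := rt_gt0 hp hpq x0.
have a2 := r0_sqr hp hpq; have s2 := rt_sqr hp hpq x0; have P4 := P_ge4 hp hpq.
have as0 : 0 < r0 + x * rt x by rewrite addr_gt0 // mulr_gt0.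
have t0 := tau_gt0 hp hpq x0.
have -> : met_form x v v = met_mm x * (v 0 1 * v 0 1)
    + met_xm x * (v 0 1 * v 0 0 + v 0 0 * v 0 1) + met_xx x * (v 0 0 * v 0 0).
  by rewrite /met_form; ring.
apply: form_ge; rewrite ?met_xx_gt0 // [met_mm x * _]mulrC met_det //.
have h1 : 3 / 4 * tau x <= rho x ^+ 2 * tau x ^+ 2.
  have -> : rho x ^+ 2 * tau x ^+ 2 =
      (r0 + x * rt x) * (3 * x + 2 * (P - 1)) / (2 * P * x * rt x) * tau x.
    have := metric_tau_factor (3 * x + 2 * (P - 1)) (lt0r_neq0 a0) (lt0r_neq0 x0) (lt0r_neq0 s0)
      (lt0r_neq0 as0).
    by rewrite a2 => <-.
  rewrite ler_pM2r // ler_pdivlMr; last by rewrite !mulr_gt0 //; lra.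
  have xs : 0 < x * rt x by rewrite mulr_gt0.
  have -> : 3 / 4 * (2 * P * x * rt x) = x * rt x * (3 / 2 * P) by field.
  rewrite ler_pM //; [exact: ltW|lra|lra|lra].
have h2 : tau x ^+ 2 <= rho x ^+ 2 * tau x ^+ 2.
  by rewrite ler_peMl ?sqr_ge0 // exprn_ege1 // ltW // rho_gt1.
have h3 : met_xx x <= tau x + 2 / 3 * tau x ^+ 2.
  rewrite /met_xx -subr_ge0.
  have -> : tau x + 2 / 3 * tau x ^+ 2 - (tau x - tau x ^+ 2 * (x ^+ 2 + x - 2) / 3) =
     tau x ^+ 2 * (x ^+ 2 + x) / 3 by field.
  by rewrite divr_ge0 // mulr_ge0 ?sqr_ge0 // addr_ge0 ?sqr_ge0 // ltW.
have := sqr_ge0 (tau x); lra.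
Qed.

Lemma sph_metric_posdef u : U u -> posdef (sph_metric u).
Proof.
move=> u0 v v0; rewrite sph_metricE mulr_gt0 ?invr_gt0 ?mulr_gt0 ?sph_c_gt0 //.
have h1 := met_form_ge_xi v u0; have h2 := met_form_ge_mu v u0.
have m0 : 0 <= met_form (u 0 0) v v.
  by apply: le_trans h1; rewrite mulr_ge0 // sqr_ge0.
rewrite lt0r m0 andbT.
apply: contra v0 => /eqP E; rewrite E in h1 h2.
have e1 : v 0 1 = 0.
  by apply/eqP; rewrite -sqrf_eq0 eq_le sqr_ge0 andbT; move: h2; rewrite pmulr_rle0.
have e0 : v 0 0 = 0.
  have /eqP : (v 0 0 / u 0 0) ^+ 2 = 0.
    by apply/eqP; rewrite eq_le sqr_ge0 andbT; move: h1; rewrite pmulr_rle0.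
  by rewrite sqrf_eq0 mulf_eq0 invr_eq0 [u 0 0 == 0]gt_eqF // orbF => /eqP.
by apply/eqP/rowP; apply: ord2_ind; rewrite mxE.
Qed.

(** Affine expressions in the single parameter q^-1, which turn the later identities into routine
    algebra. *)
Lemma sph_mE : [/\ sph_m p q 0 = (1 + q^-1) / 3, sph_m p q 1 = (q^-1 - 2) / 3 &
  sph_m p q 2 = (1 - 2 * q^-1) / 3].
Proof.
have pE : p^-1 = 1 - q^-1 by move: hpq; lra.
rewrite /sph_m /=; split.
- by field.
- have -> : - ((p + 1) / (3 * p)) = - (1 + p^-1) / 3 by field.
  by rewrite pE; field.
- have -> : (p - q) / (3 * P) = (q^-1 - p^-1) / 3.
    by rewrite {1}(P_mul hp hpq); field; rewrite pn qn.
  by rewrite pE; field.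
Qed.

Lemma sph_gt0 u i : U u -> 0 < f u 0 i.
Proof. by move=> Uu; rewrite sphere_paramE // expR_gt0. Qed.

Lemma sph_X_inj u v w : U u -> (forall i, sph_X p q u v i = sph_X p q u w i) -> v = w.
Proof.
move=> u0 E; have [m0 m1 m2] := sph_mE.
have t0 := tau_gt0 hp hpq u0.
move: (E 0) (E 1) (E 2); rewrite /sph_X /sph_dphi /sph_a /= m0 m1 m2 => E0 E1 E2.
(* Coordinates 0 and 1 have the same phi, and sph_m 0 - sph_m 1 = 1, so E0 - E1 isolates the
   mu-component. *)
have e1 : v 0 1 = w 0 1 by lra.
have e0 : v 0 0 = w 0 0.
  apply: (mulfI (lt0r_neq0 t0)); move: E0 E2; rewrite e1; lra.
by apply/rowP; apply: ord2_ind.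
Qed.

Lemma sphere_param_immersion : immersion U f.
Proof.
split; first exact: sphere_param_smooth.
move=> u Uu v w; rewrite !sphere_param_diff // => /rowP E.
apply: (sph_X_inj Uu) => i; have := E i; rewrite [X in X = _]mxE [X in _ = X]mxE.
exact/mulfI/lt0r_neq0/sph_gt0.
Qed.

(** Existence is enough for the Gauss formula, where the term with the derivative of tau is a
    multiple of the tangent vector in direction xi. *)
Lemma is_derive_tau_ex (x : R) : 0 < x -> exists d : R, is_derive x 1 tau d.
Proof.
move=> x0; have s0 := rt_gt0 hp hpq x0; have a0 := r0_gt0 hp hpq.
have D := is_derive_rt hp hpq x0; have I := is_derive_id x (1 : R).
have C c := is_derive_const c x (1 : R).
have D1 := is_derive_add (is_derive_mul (C 3) I) (C (2 * (P - 1))).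
have D2 := is_derive_mul (is_derive_mul (is_derive_mul (C 2) I) D)
   (is_derive_add (C r0) (is_derive_mul I D)).
have n0 : 2 * x * rt x * (r0 + x * rt x) != 0.
  by rewrite gt_eqF // !mulr_gt0 // addr_gt0 // mulr_gt0.
have D3 := is_derive_inv (f := fun y : R => 2 * y * rt y * (r0 + y * rt y)) n0 D2.
by eexists; exact: is_derive_mul D1 D3.
Qed.

(** Dividing the i-th coordinate by f_i leaves three scalar equations y_i = X_i(z) + H / 3. Two of
    them determine z, and the remaining one is the formula for H. *)
Lemma sphere_param_gauss u v w : U u ->
  exists z, 'D_v ('D_w f) u = 'd f u z + (v *m sph_metric u *m w^T) 0 0 *: sph_normal u.
Proof.
move=> Uu; have [dt Dt] := is_derive_tau_ex Uu.
have t0 := tau_gt0 hp hpq Uu; have [m0 m1 m2] := sph_mE.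
pose x := u 0 0.
pose y i := sph_X p q u v i * sph_X p q u w i
  + (tau x + (x + sph_a R i) * dt) / 3 * (v 0 0 * w 0 0).
have D : is_derive u v ('D_w f) (\row_i (f u 0 i * y i)).
  apply: (@near_eq_is_derive _ _ _ (fun u => \row_i (f u 0 i * sph_X p q u w i))).
    apply: filterS (open_nbhs_nbhs (conj (@open_half_plane R) Uu)) => u' Uu'.
    by have [_ ->] := sphere_param_derive hp hpq w Uu'.
  apply: is_derive_rowP => i; rewrite mxE.
  have Df : is_derive u v (fun u => f u 0 i) (f u 0 i * sph_X p q u v i).
    have [Dfu Ef] := sphere_param_derive hp hpq v Uu.
    have Dfi : derivable (fun u => f u 0 i) u v by move/derivable_mxP : Dfu; exact.
    by split=> //; move/rowP: Ef => /(_ i); rewrite derive_mx // !mxE.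
  have Dphi : is_derive x 1 (sph_dphi p q i) ((tau x + (x + sph_a R i) * dt) / 3).
    apply: is_derive_subst (is_derive_mul (is_derive_mul (is_derive_add (is_derive_id x (1 : R))
      (is_derive_const (sph_a R i) x 1)) Dt) (is_derive_const 3^-1 x 1)) _.
    by rewrite addr0 mul1r mulr0 addr0.
  have DX : is_derive u v (fun u => sph_X p q u w i)
      ((tau x + (x + sph_a R i) * dt) / 3 * (v 0 0 * w 0 0)).
    apply: is_derive_subst (is_derive_add (is_derive_mul (is_derive_chain (h := sph_dphi p q i)
      (f := fun u : 'rV[R]_2 => u 0 0) Dphi (is_derive_coord u v 0)) (is_derive_const (w 0 0) u v))
      (is_derive_const (sph_m p q i * w 0 1) u v)) _.
    by rewrite mulr0 !addr0 mulrA.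
  have -> : (fun u => (\row_i (f u 0 i * sph_X p q u w i)) 0 i) =
     (fun u => f u 0 i * sph_X p q u w i) by apply/funext => u'; rewrite mxE.
  apply: is_derive_subst (is_derive_mul Df DX) _; rewrite /y; ring.
(* H / 3 drops out of the differences of the equations. The difference of the first two is z1 = y 0
   - y 1; that of the third and the first has coefficient tau at z0, because sph_a 2 - sph_a 0 =
   3. *)
pose z1 := y 0 - y 1; pose z0 := (y 2 - y 0 - (sph_m p q 2 - sph_m p q 0) * z1) / tau x.
pose z : 'rV[R]_2 := \row_i (if i == 0 then z0 else z1).
exists z; have [_ ->] := D; rewrite sphere_param_diff // sph_metricE /sph_normal.
have c0 := sph_c_gt0.
have key i : y i = sph_X p q u z i + met_form x v w / 3.
  have tn := lt0r_neq0 t0.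
  have k0 : y 0 = sph_X p q u z 0 + met_form x v w / 3.
    rewrite /z /sph_X !mxE /= -/x /z0 /z1 /y /sph_X -/x /sph_dphi /sph_a /= m0 m1 m2.
    rewrite /met_form /met_xx /met_xm /met_mm.
    have -> : (3 * x + 2 * (P - 1)) / (3 * P) = x * (q^-1 * (1 - q^-1)) + 2 / 3 - 2 / 3 * (q^-1 * (1 - q^-1)).
      have <- : P^-1 = q^-1 * (1 - q^-1).
        by rewrite (P_mul hp hpq) invfM mulrC (_ : 1 - q^-1 = p^-1) //; move: hpq; lra.
      by field.
    have -> : tau x * (x - 1) * (p - q) / (3 * P) = tau x * (x - 1) * (2 * q^-1 - 1) / 3.
      have -> : 2 * q^-1 - 1 = q^-1 - p^-1 by move: hpq; lra.
      by rewrite {1}(P_mul hp hpq); field; rewrite pn qn.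
    rewrite -/x in t0 tn *; move: tn; move: (tau x) (q^-1) => t B tn.
    by field.
  have E1 : y 1 = y 0 - z1 by rewrite /z1 subKr.
  have E2 : y 2 = y 0 + tau x * z0 + (sph_m p q 2 - sph_m p q 0) * z1.
    by rewrite /z0; field.
  move: i; apply: ord3_ind; first exact: k0.
    by rewrite E1 k0 /z /sph_X !mxE /= /sph_dphi /sph_a /= m0 m1 -/x; field.
  by rewrite E2 k0 /z /sph_X !mxE /= /sph_dphi /sph_a /= -/x; field.
move: (f u) => g; apply/rowP => i; rewrite !mxE key; field.
by rewrite gt_eqF.
Qed.

Lemma sph_normal_smooth : smooth_on U sph_normal.
Proof.
move=> k; apply: (elem_row_Ck (@open_half_plane R)) => j.
apply: (@elem_ext _ _ _ (fun u => sph_c * f u 0 j)); last by move=> u _; rewrite /sph_normal [RHS]mxE.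
by apply: elem_mul; [exact: elem_cst|exact: elem_sphere_param].
Qed.

Lemma sph_normal_derive u v : U u -> exists z, 'D_v sph_normal u = 'd f u z.
Proof.
move=> Uu; exists (sph_c *: v); rewrite linearZ -deriveE; last exact: sphere_param_differentiable.
have [D _] := sphere_param_derive hp hpq v Uu.
exact: (deriveZ sph_c D).
Qed.

Lemma sph_volume u : U u ->
  (\det (col_mx ('J f u) (sph_normal u) : 'M[R]_3)) ^+ 2 = \det (sph_metric u).
Proof.
move=> Uu; pose x := u 0 0; have c0 := sph_c_gt0; have [m0 m1 m2] := sph_mE.
have f0 := sph_gt0 0 Uu; have f1 := sph_gt0 1 Uu; have f2 := sph_gt0 2 Uu.
have prodf : f u 0 0 * f u 0 1 * f u 0 2 = rho x.
  rewrite !sphere_paramE // -!expRD -[RHS]lnK ?posrE ?rho_gt0 //; congr expR.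
  by rewrite /sph_phi /sph_a /= m0 m1 m2 -/x; field.
pose A : 'M[R]_3 := col_mx ('J f u) (sph_normal u).
have A0 j : A 0 j = f u 0 j * sph_dphi p q j x.
  have -> : A 0 j = (col_mx ('J f u) (sph_normal u)) (lshift 1 (0 : 'I_2)) j.
    by congr (col_mx _ _ _ _); exact/val_inj.
  by rewrite col_mxEu !mxE sphere_param_diff // !mxE /sph_X !mxE /= mulr1 mulr0 addr0.
have A1 j : A 1 j = f u 0 j * sph_m p q j.
  have -> : A 1 j = (col_mx ('J f u) (sph_normal u)) (lshift 1 (1 : 'I_2)) j.
    by congr (col_mx _ _ _ _); exact/val_inj.
  by rewrite col_mxEu !mxE sphere_param_diff // !mxE /sph_X !mxE /= mulr1 mulr0 add0r.
have A2 j : A 2 j = f u 0 j * sph_c.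
  have -> : A 2 j = (col_mx ('J f u) (sph_normal u)) (rshift 2 (0 : 'I_1)) j.
    by congr (col_mx _ _ _ _); exact/val_inj.
  by rewrite col_mxEd mxE mulrC.
(* The columns carry the factors f_j, whose product is rho; the remaining determinant is c tau. *)
have dA : \det A = sph_c * rho x * tau x.
  rewrite det_mx33 !A0 !A1 !A2 -prodf /sph_dphi /sph_a /= m0 m1 m2.
  by move: (f u 0 0) (f u 0 1) (f u 0 2) (tau x) => a b c t; field.
rewrite -/A dA (expand_det_row _ 0) sum2 /cofactor !det_mx11 !mxE /=.
have -> : (0 + 1 %% 2 = 1)%N by [].
rewrite addn0 expr0 expr1 -/x.
(* By [met_det] the right side equals rho^2 tau^2 / (27 c^2), so the claim amounts to c^4 = 1/27. *)
transitivity ((3 * sph_c)^-1 ^+ 2 * (met_xx x * met_mm x - met_xm x ^+ 2)); last by ring.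
rewrite met_det //.
have c4 : sph_c ^+ 2 = 27^-1 / sph_c ^+ 2 by rewrite -sph_c4; field; rewrite gt_eqF.
have -> : (sph_c * rho x * tau x) ^+ 2 = sph_c ^+ 2 * (rho x ^+ 2 * tau x ^+ 2) by ring.
by rewrite c4; field; rewrite gt_eqF.
Qed.

Lemma sph_affine_normal : affine_normal_metric U f sph_normal sph_metric.
Proof.
split; first exact: sph_normal_smooth.
move=> u Uu; split.
- exact: sph_metric_posdef.
- by move=> v w; exact: sphere_param_gauss.
- by move=> v; exact: sph_normal_derive.
- exact: sph_volume.
Qed.

Lemma sph_center u : exists s : R, f u + s *: sph_normal u = 0.
Proof.
exists (- sph_c^-1); rewrite /sph_normal scalerA mulNr mulVf ?gt_eqF ?sph_c_gt0 //.
by rewrite scaleN1r subrr.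
Qed.

End Metric.

(** * Completeness *)

Section CurveLength.
Variable R : realType.
Local Notation mu := (@lebesgue_measure R).

(* Unlike [ge0_le_integral], this does not ask for measurability: the integral of
   a nonnegative function is a supremum over the simple functions below it. *)
Lemma ge0_le_integral_sub (D E : set R) (f g : R -> \bar R) : D `<=` E ->
  (forall x, E x -> 0 <= g x)%E -> (forall x, D x -> 0 <= f x <= g x)%E ->
  (\int[mu]_(x in D) f x <= \int[mu]_(x in E) g x)%E.
Proof.
move=> DE g0 fg; rewrite [leLHS]integral_mkcond [leRHS]integral_mkcond.
have f1 x : (0 <= (f \_ D) x)%E by rewrite patchE; case: ifPn => // /set_mem/fg/andP[].
have g1 x : (0 <= (g \_ E) x)%E by rewrite patchE; case: ifPn => // /set_mem/g0.
rewrite !ge0_integralTE //; apply: ereal_sup_le => _ [h /= hf <-]; exists h => //= x; apply: le_trans (hf x) _.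
rewrite !patchE; case: ifPn => [xD|_]; last by have := g1 x; rewrite patchE.
by rewrite (mem_set (DE _ (set_mem xD))); have /andP[] := fg _ (set_mem xD).
Qed.

(** By the fundamental theorem of calculus on [1, t], a |f t - f 1| is at most the integral of a
    |df|, hence at most the length. The base point 1 keeps the interval compact, as the curve is
    given on t > 0 only. *)
Lemma displacement_bounded (S f df : R -> R) (a : R) : 0 < a ->
  (forall t : R, 0 < t -> is_derive t 1 f (df t)) ->
  (forall t : R, 0 < t -> {for t, continuous df}) ->
  (forall t : R, 0 < t -> a * `|df t| <= S t) ->
  (\int[mu]_(t in `]0%R, +oo[) (S t)%:E < +oo)%E ->
  exists B, forall t : R, 1 <= t -> `|f t - f 1| <= B.
Proof.
move=> a0 Df cdf dS LS.
have S0 (t : R) : 0 < t -> 0 <= S t by move=> /dS; apply: le_trans; rewrite mulr_ge0 // ltW.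
set L := (\int[mu]_(t in _) _)%E in LS.
have L0 : (0 <= L)%E.
  by apply: integral_ge0 => t /=; rewrite in_itv /= andbT => /S0; rewrite lee_fin.
exists (a^-1 * fine L) => t t1.
have [->|tn1] := eqVneq t 1.
  by rewrite subrr normr0 mulr_ge0 ?invr_ge0 ?(ltW a0) // fine_ge0.
have t1' : 1 < t by rewrite lt_neqAle eq_sym tn1.
rewrite -ler_pdivrMl ?invr_gt0 // invrK -lee_fin fineK; last by rewrite ge0_fin_numE.
have pos (s : R) : s \in `[1, t] -> 0 < s.
  by rewrite in_itv /= => /andP[s1 _]; exact: lt_le_trans s1.
have cf (s : R) : 0 < s -> {for s, continuous f}.
  by move=> /Df[D _]; exact/differentiable_continuous/derivable1_diffP.
have cW : {within `[1, t], continuous (fun s => a * df s)}.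
  apply: continuous_in_subspaceT => s /set_mem/= /pos s0.
  by apply: cvgM; [exact: cvg_cst|exact: cdf].
have Daf (s : R) : 0 < s -> is_derive s 1 (fun s => a * f s) (a * df s).
  by move=> /Df; exact: is_derive_scale.
have := @continuous_FTC2 R (fun s => a * df s) (fun s => a * f s) 1 t t1' cW.
have dLR : derivable_oo_LRcontinuous (fun s => a * f s) 1 t.
  split.
  - move=> s; rewrite in_itv /= => /andP[s1 _].
    by have [] := Daf s (lt_trans ltr01 s1).
  - apply: cvg_at_right_filter; apply: cvgM; first exact: cvg_cst.
    exact: cf.
  - apply: cvg_at_left_filter; apply: cvgM; first exact: cvg_cst.
    by apply: cf; exact: lt_trans t1'.
move=> /(_ dLR) FTC.
have {}FTC : (\int[mu]_(x in `[1%R, t]) (a * df x)%:E = (a * f t)%:E - (a * f 1)%:E)%E.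
  apply: FTC => s; rewrite in_itv /= => /andP[s1 _].
  by rewrite derive1E; have [_ ->] := Daf s (lt_trans ltr01 s1).
have -> : (a * `|f t - f 1|)%:E = (`|\int[mu]_(x in `[1%R, t]) (a * df x)%:E|)%E.
  by rewrite FTC -EFinB abse_EFin -mulrBr normrM (gtr0_norm a0).
have mI : measurable (`[1, t]%classic : set R) by exact: measurable_itv.
have mdf : measurable_fun (`[1, t]%classic : set R) (fun s : R => a * df s) :=
  subspace_continuous_measurable_fun mI cW.
have mf := (measurable_EFinP _ _).2 mdf.
apply: le_trans (le_abse_integral mu mI mf) _.
apply: ge0_le_integral_sub => [s /= /pos s0|s /=|s /= /pos s0].
- by rewrite in_itv /= s0.
- by rewrite in_itv /= andbT => /S0; rewrite lee_fin.
- by rewrite !lee_fin normr_ge0 normrM (gtr0_norm a0) dS.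
Qed.

End CurveLength.

Section Completeness.
Variables (R : realType) (p q : R).
Hypotheses (hp : 2 <= p) (hpq : p^-1 + q^-1 = 1).
Local Notation U := (@half_plane R).

Lemma sqrt_ge_norm (k x y : R) : 0 <= k -> k * x ^+ 2 <= y -> Num.sqrt k * `|x| <= Num.sqrt y.
Proof.
by move=> k0 kxy; rewrite -sqrtr_sqr -sqrtrM // ler_wsqrtr.
Qed.

(** Finite length would keep ln xi and mu bounded for t >= 1, and thus the curve in a compact
    rectangle of the half-plane. *)
Lemma sph_metric_complete : complete_metric U (sph_metric p q).
Proof.
move=> c [cc Dc] cU cC.
have [dc [cdc _]] := Dc 1.
pose S := speed (sph_metric p q) c.
have pos (t : R) : 0 < t -> t \in `]0, +oo[ by move=> t0; rewrite in_itv /= t0.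
have c0 := @sph_c_gt0 R.
have k0 : 0 < (3 * sph_c R)^-1 by rewrite invr_gt0 mulr_gt0.
have SE (t : R) : S t = Num.sqrt ((3 * sph_c R)^-1 * met_form p q (c t 0 0) ('D_1 c t) ('D_1 c t)).
  by rewrite /S /speed sph_metricE.
have Dcj (j : 'I_2) (t : R) : 0 < t -> is_derive t 1 (fun s => c s 0 j) ('D_1 c t 0 j).
  move=> t0; have D := dc _ (pos _ t0).
  have Dj : derivable (fun s => c s 0 j) t 1 by move/derivable_mxP : D; exact.
  by split=> //; rewrite derive_mx // mxE.
have Cdj (j : 'I_2) (t : R) : 0 < t -> {for t, continuous (fun s => 'D_1 c s 0 j)}.
  move=> t0; apply: (@continuous_comp _ _ _ ('D_1 c) (fun v : 'rV[R]_2 => v 0 j)).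
    exact: cdc (pos _ t0).
  exact: coord_continuous.
have Ccj (j : 'I_2) (t : R) : 0 < t -> {for t, continuous (fun s => c s 0 j)}.
  by move=> /(Dcj j)[D _]; exact/differentiable_continuous/derivable1_diffP.
apply/eqP; rewrite eq_le leey /= leNgt; apply/negP => LS.
have [||||B1 HB1] := @displacement_bounded R S (fun t => ln (c t 0 0))
    (fun t => 'D_1 c t 0 0 / c t 0 0) (Num.sqrt ((3 * sph_c R)^-1 * 2^-1)) _ _ _ _ LS.
- by rewrite sqrtr_gt0 mulr_gt0.
- by move=> t t0; apply: is_derive_lnf; [exact: cU|exact: Dcj].
- move=> t t0; apply: cvgM; first exact: Cdj.
  by apply: cvgV; [rewrite gt_eqF //; exact: cU|exact: Ccj].
- move=> t t0; rewrite SE; apply: sqrt_ge_norm; first by rewrite ltW // mulr_gt0.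
  by rewrite -mulrA ler_pM2l //; apply: met_form_ge_xi => //; exact: cU.
have s16 : 0 < Num.sqrt ((3 * sph_c R)^-1 * 16^-1) by rewrite sqrtr_gt0 mulr_gt0.
have [|B2 HB2] := @displacement_bounded R S _ _ _ s16 (Dcj 1) (Cdj 1) _ LS.
  move=> t t0; rewrite SE; apply: sqrt_ge_norm; first by rewrite ltW // mulr_gt0.
  by rewrite -mulrA ler_pM2l //; apply: met_form_ge_mu => //; exact: cU.
pose x1 := c 1 0 0; pose m1 := c 1 0 1.
pose A (j : 'I_2) : set R := if j == 0 then `[expR (ln x1 - B1), expR (ln x1 + B1)]%classic
   else `[m1 - B2, m1 + B2]%classic.
have cA : compact [set v : 'rV[R]_2 | forall j, A j (v ord0 j)].
  by apply: (@rV_compact R 2 A) => j; rewrite /A; case: ifP => _; exact: segment_compact.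
have AU : [set v : 'rV[R]_2 | forall j, A j (v ord0 j)] `<=` U.
  move=> v /(_ 0); rewrite /A /= in_itv /= => /andP[h _].
  by apply: lt_le_trans h; exact: expR_gt0.
have [t [t1 nA]] : exists t, 1 <= t /\ ~ [set v : 'rV[R]_2 | forall j, A j (v ord0 j)] (c t).
  have N := cC _ cA AU.
  have : \forall t \near +oo, 1 <= t /\ ~ [set v : 'rV[R]_2 | forall j, A j (v ord0 j)] (c t).
    by near=> t; split; near: t; [exact: nbhs_pinfty_ge|exact: N].
  by move=> /(@filter_ex _ _ _)[t]; exists t.
have t0 : 0 < t by exact: lt_le_trans t1.
apply: nA; apply: ord2_ind; rewrite /A /= in_itv /=.
  have x0 := cU _ t0; have := HB1 _ t1; rewrite ler_norml => /andP[h1 h2].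
  by rewrite -[c t _ _]lnK ?posrE // !ler_expR; apply/andP; split; rewrite -/x1 in h1 h2; lra.
by have := HB2 _ t1; rewrite ler_norml -/m1 => /andP[h1 h2]; apply/andP; split; lra.
Unshelve. all: by end_near. Qed.

End Completeness.

(** * The level set and its convex hull *)

Section ConvexPotential.
Variables (R : realType) (p q : R).
Hypotheses (hp : 2 <= p) (hpq : p^-1 + q^-1 = 1).
Local Notation K := (power_cone p q).
Local Notation pot := (sphere_potential p q).

(** The weights are absorbed by homogeneity; for a sum of two interior points [gm_super] applies. *)
Lemma power_cone_int_conv (v w : 'rV[R]_3) (s : R) : K° v -> K° w -> 0 <= s <= 1 ->
  K° (s *: v + (1 - s) *: w).
Proof.
move=> Kv Kw /andP[]; rewrite le_eqVlt => /predU1P[<- _|s0].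
  by rewrite scale0r add0r subr0 scale1r.
rewrite le_eqVlt => /predU1P[->|s1]; first by rewrite subrr scale0r addr0 scale1r.
have s1' : 0 < 1 - s by rewrite subr_gt0.
have := power_cone_scale hpq Kv s0; have := power_cone_scale hpq Kw s1'.
move: (s *: v) ((1 - s) *: w) => {Kv Kw}{}v {}w.
move=> /interior_power_cone[w0 w1 w2 Ww] /interior_power_cone[v0 v1 v2 Wv].
apply/interior_power_cone; split; rewrite ?mxE ?addr_gt0 //.
rewrite logW_lt0 !mxE ?addr_gt0 //.
apply: lt_le_trans (gm_super hp hpq (ltW v0) (ltW v1) w0 w1).
by apply: ltrD; rewrite -logW_lt0.
Qed.

Lemma sphere_potential_no_max (v w : 'rV[R]_3) : K° v -> w != 0 ->
  ~ (\forall s \near (0 : R), pot (v + s *: w) <= pot v).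
Proof.
move=> /interior_power_cone Cv w0 M.
have [_ /(_ _ w0) H0] := sphere_hessian_posdef hp hpq Cv.
have [df df1 df2] := sphere_potential_deriv2 hp hpq w Cv.
have D : deriv2 (- (fun s : R => pot (v + s *: w))) 0 (- qf (sphere_hessian p q v) w).
  by exists (- df); [apply: filterS df1 => s ds; exact: is_deriveN|exact: is_deriveN].
have := deriv2_min_ge0 D; rewrite leNgt oppr_lt0 H0 => F; suff: false by []; apply: F.
by apply: filterS M => s Ms; rewrite !fctE lerN2 scale0r addr0.
Qed.

(** By [sphere_potential_no_max] the maximum of the potential over the segment is not attained
    between the end points. *)
Lemma sphere_potential_quasiconvex (v w : 'rV[R]_3) (s : R) : K° v -> K° w ->
  pot v <= 0 -> pot w <= 0 -> 0 <= s <= 1 -> pot (s *: v + (1 - s) *: w) <= 0.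
Proof.
move=> Kv Kw pv pw s01.
have [->|vw] := eqVneq v w; first by rewrite -scalerDl addrC subrK scale1r.
have d0 : v - w != 0 by rewrite subr_eq0.
have lE (t : R) : t *: v + (1 - t) *: w = w + t *: (v - w).
  by rewrite scalerBr scalerBl scale1r addrCA.
have Kl (t : R) : 0 <= t <= 1 -> K° (w + t *: (v - w)).
  by move=> t01; rewrite -lE; exact: power_cone_int_conv.
have cl (t : R) : 0 <= t <= 1 -> {for t, continuous (fun t : R => pot (w + t *: (v - w)))}.
  move=> /Kl/interior_power_cone Ct.
  apply: (@continuous_comp _ _ _ (fun t : R => w + t *: (v - w)) pot).
    by apply: cvgD; [exact: cvg_cst|apply: cvgZr_tmp; exact: cvg_id].
  exact: continuous_sphere_potential.
have cw : {within `[0, 1], continuous (fun t : R => pot (w + t *: (v - w)))}.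
  by apply: continuous_in_subspaceT => t /set_mem/=; rewrite in_itv /=; exact: cl.
have [c] := EVT_max ler01 cw; rewrite in_itv /= => c01 cmax.
rewrite lE; apply: le_trans (cmax s _) _; first by rewrite in_itv.
rewrite leNgt; apply/negP => c0.
have cn0 : c != 0 by apply/eqP => E; move: c0; rewrite E scale0r addr0 ltNge pw.
have cn1 : c != 1 by apply/eqP => E; move: c0; rewrite E scale1r addrC subrK ltNge pv.
move: (c01) => /andP[c0' c1'].
apply: (sphere_potential_no_max (Kl _ c01) d0).
near=> t; rewrite -addrA -scalerDl; apply: cmax; rewrite in_itv /=; apply/andP; split.
  rewrite -lerBlDl sub0r ltW //; near: t; apply: (@near_gt _ _ id) => //=.
  by rewrite oppr_lt0 lt_neqAle eq_sym cn0.
rewrite -lerBrDl ltW //; near: t; apply: (@near_lt _ _ id) => //=.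
by rewrite subr_gt0 lt_neqAle cn1.
Unshelve. all: by end_near. Qed.

Lemma convex_hull_sub_sublevel (M : set 'rV[R]_3) :
  M `<=` [set v | K° v /\ pot v <= 0] ->
  convex_hull M `<=` [set v | K° v /\ pot v <= 0].
Proof.
move=> MA v; apply; split=> // x y l /set_mem[Kx px] /set_mem[Ky py]; apply/mem_set.
have l01 : 0 <= l%:inum <= (1 : R) by apply/andP; split.
by split; [exact: power_cone_int_conv|exact: sphere_potential_quasiconvex].
Qed.

End ConvexPotential.

Section LevelSet.
Variables (R : realType) (p q : R).
Hypotheses (hp : 2 <= p) (hpq : p^-1 + q^-1 = 1).
Local Notation K := (power_cone p q).
Local Notation pot := (sphere_potential p q).
Local Notation f := (sphere_param p q).
Local Notation U := (@half_plane R).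

Let pE : p^-1 = 1 - q^-1. Proof. by move: hpq; lra. Qed.
Let qn : q != 0. Proof. exact: lt0r_neq0 (q_gt0 hp hpq). Qed.

Lemma ln_sphere_param u i : U u ->
  ln (f u 0 i) = sph_phi p q i (u 0 0) + sph_m p q i * u 0 1.
Proof. by move=> Uu; rewrite sphere_paramE // expRK. Qed.

Lemma logW_sphere_param u : U u -> logW p q (f u) = logt p q (u 0 0).
Proof.
move=> Uu; have [m0 m1 m2] := sph_mE hp hpq.
by rewrite /logW !ln_sphere_param // /sph_phi /sph_a /= m0 m1 m2 pE; field; rewrite qn.
Qed.

Lemma sphere_param_cone u : U u -> K° (f u).
Proof.
move=> Uu; apply/interior_power_cone; split; try exact: sph_gt0.
by rewrite logW_sphere_param // logt_lt0.
Qed.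

Lemma sum_ln_sphere_param u : U u ->
  ln (f u 0 0) + ln (f u 0 1) + ln (f u 0 2) = ln (rho p q (u 0 0)).
Proof.
move=> Uu; have [m0 m1 m2] := sph_mE hp hpq.
by rewrite !ln_sphere_param // /sph_phi /sph_a /= m0 m1 m2; field; rewrite qn.
Qed.

Lemma sphere_param_potential u : U u -> pot (f u) = 0.
Proof.
by move=> Uu; rewrite /sphere_potential logW_sphere_param // logtK // sum_ln_sphere_param // subrr.
Qed.

Lemma sphere_param_surj v : K° v -> pot v = 0 -> (f @` U) v.
Proof.
move=> /interior_power_cone[v0 v1 v2 W0] pv; have [x0 Ex] := logt_invP hp hpq W0.
move: pv; rewrite /sphere_potential => /eqP; rewrite subr_eq0 => /eqP pv.
set x := logt_inv _ _ _ in x0 Ex pv.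
(* On the surface mu = ln x - ln y, since phi_0 = phi_1 and sph_m 0 - sph_m 1 = 1. *)
pose u : 'rV[R]_2 := \row_(j < 2) (if j == 0 then x else ln (v 0 0) - ln (v 0 1)).
have u0 : u 0 0 = x by rewrite mxE.
have u1 : u 0 1 = ln (v 0 0) - ln (v 0 1) by rewrite mxE.
have Uu : U u by rewrite /half_plane /= u0.
exists u => //; apply/rowP => i; have [m0 m1 m2] := sph_mE hp hpq.
suff E : ln (f u 0 i) = ln (v 0 i).
  apply: ln_inj E; rewrite posrE; first exact: sph_gt0.
  by move: i; exact: ord3_ind.
move: Ex; rewrite ln_sphere_param // /sph_phi u0 u1 pv => ->.
move: i; apply: ord3_ind; rewrite /sph_a /= ?m0 ?m1 ?m2 /logW pE; field; exact: qn.
Qed.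

Lemma sphere_param_sub_sublevel : f @` U `<=` [set v | K° v /\ pot v <= 0].
Proof. by move=> _ [u Uu <-]; split; [exact: sphere_param_cone|rewrite sphere_param_potential]. Qed.

Lemma sub_convex_hull n (M : set 'rV[R]_n) : M `<=` convex_hull M.
Proof. by move=> v Mv C [_]; apply. Qed.

Lemma sphere_potential_shift (v : 'rV[R]_3) (l : R) : K° v -> 0 < l ->
  pot (l *: v) = pot v - 3%:R * ln l.
Proof. by move=> /interior_power_cone; exact: sphere_potential_scale. Qed.

(** If v were interior to the hull, the hull would contain (1 - s) v for some s > 0; but by
    homogeneity the potential increases towards the origin and would be positive there. *)
Lemma sphere_convex_hypersurface : convex_hypersurface (f @` U).
Proof.
move=> v Mv; split; first by apply: subset_closure; exact: sub_convex_hull.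
move=> iv; have [Kv _] := sphere_param_sub_sublevel Mv.
have pv : pot v = 0 by case: Mv => u Uu <-; rewrite sphere_param_potential.
have [s s0 [_ Hs]] := near0_ex (near_line v (@open_interior _ _) iv).
move: Hs; rewrite -{1}[v]scale1r -scalerDl => /interior_subset.
move=> /(convex_hull_sub_sublevel hp hpq sphere_param_sub_sublevel)[].
(* For s >= 1 the point (1 - s) v is not even in the open octant. *)
have [s1|s1] := leP 1 s.
  move=> /interior_power_cone[+ _ _ _] _; have /interior_power_cone[v0 _ _ _] := Kv.
  by rewrite mxE pmulr_lgt0 // ltNge subr_le0 s1.
move=> _; rewrite sphere_potential_shift ?subr_gt0 // pv sub0r oppr_le0 pmulr_rge0 //.
by rewrite leNgt ln_lt0 // subr_gt0 s1 gtrBl s0.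
Qed.

Lemma sphere_separates : separates_hull_from_origin (f @` U).
Proof.
have H := convex_hull_sub_sublevel hp hpq sphere_param_sub_sublevel.
split=> [/H[/interior_power_cone[]]|v /H[Kv pv]]; first by rewrite mxE ltxx.
(* Scaling by l subtracts 3 ln l from the potential, so this factor brings it to 0; it is at most 1
   because the potential is nonpositive on the hull. *)
exists (expR (pot v / 3)).
  by rewrite expR_ge0 expR_le1 pmulr_lle0 // invr_gt0.
apply: sphere_param_surj; first by apply: power_cone_scale => //; exact: expR_gt0.
by rewrite sphere_potential_shift ?expR_gt0 // expRK; field.
Qed.

End LevelSet.

(** * Asymptotics *)

Lemma norm_row_lt (R : realType) n (v : 'rV[R]_n) (e : R) : 0 < e ->
  (forall i, `|v 0 i| < e) -> `|v| < e.
Proof.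
move=> e0 H; have [->|v0] := eqVneq v 0; first by rewrite normr0.
have [|[i j] E] := @mx_norm_neq0 _ _ _ v; first by rewrite -[mx_norm v]/(`|v|) normr_eq0.
by rewrite -[`|v|]/(mx_norm v) E /= (ord1 i).
Qed.

(** Otherwise the product would be at least A e^2. *)
Lemma large_product (R : realFieldType) (a b c e A r : R) : 0 < e -> 0 < a -> 0 < b -> 0 < c ->
  a * b * c <= r -> r < A * e ^+ 2 -> A <= a \/ A <= b -> [\/ a < e, b < e | c < e].
Proof.
move=> e0 a0 b0 c0 abc rA Aab.
have [?|ae] := ltP a e; first by constructor 1.
have [?|be] := ltP b e; first by constructor 2.
have [?|ce] := ltP c e; first by constructor 3.
exfalso; case: Aab => [Aa|Ab].
  have h1 : A * e ^+ 2 <= a * e ^+ 2 by rewrite ler_wpM2r // exprn_ge0 // ltW.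
  have h2 : e ^+ 2 <= b * c by rewrite expr2 ler_pM // ltW.
  have : a * e ^+ 2 <= a * (b * c) by rewrite ler_wpM2l // ltW.
  by rewrite mulrA; lra.
have h1 : A * e ^+ 2 <= b * e ^+ 2 by rewrite ler_wpM2r // exprn_ge0 // ltW.
have h2 : e ^+ 2 <= a * c by rewrite expr2 ler_pM // ltW.
have : b * e ^+ 2 <= b * (a * c) by rewrite ler_wpM2l // ltW.
by rewrite mulrCA mulrA; lra.
Qed.

Section Asymptotic.
Variables (R : realType) (p q : R).
Hypotheses (hp : 2 <= p) (hpq : p^-1 + q^-1 = 1).
Local Notation K := (power_cone p q).
Local Notation f := (sphere_param p q).
Local Notation U := (@half_plane R).
Local Notation P := (p + q).

Lemma tau_le (x : R) : 0 < x -> tau p q x <= 3 / (2 * x ^+ 2).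
Proof.
move=> x0; have P4 := P_ge4 hp hpq; have s0 := rt_gt0 hp hpq x0; have a0 := r0_gt0 hp hpq.
have s2 := rt_sqr hp hpq x0.
rewrite /tau; move: (rt p q x) (Num.sqrt P) s0 a0 s2 => s a s0 a0 s2.
have xs : 0 < x * s by exact: mulr_gt0.
rewrite ler_pdivrMr; last by rewrite !mulr_gt0 // addr_gt0.
have -> : 3 / (2 * x ^+ 2) * (2 * x * s * (a + x * s)) = 3 * s * a / x + 3 * s ^+ 2.
  by field; rewrite gt_eqF.
have : 0 < 3 * s * a / x by rewrite divr_gt0 // !mulr_gt0.
by rewrite s2; lra.
Qed.

(** By [tau_le] the function logt y + 3 / (2 y) is nonincreasing, and it tends to 0 at infinity. *)
Lemma logt_ge (x : R) : 0 < x -> - (3 / (2 * x)) <= logt p q x.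
Proof.
move=> x0; rewrite leNgt; apply/negP => lx.
pose g (y : R) := logt p q y + 3 / 2 * y^-1.
have gx : 0 < - g x.
  have -> : - g x = - (3 / (2 * x)) - logt p q x by rewrite /g; field; rewrite gt_eqF.
  by rewrite subr_gt0.
have [z z0 Hz] := logt_large hp hpq gx.
pose y := Num.max z (x + 1).
have xy : x < y by rewrite /y lt_max ltrDl ltr01 orbT.
have zy : z <= y by rewrite /y le_max lexx.
have Dg t : x <= t -> is_derive (t : R) 1 g (tau p q t - 3 / (2 * t ^+ 2)).
  move=> xt; have t0 : 0 < t by exact: lt_le_trans xt.
  have Dl := is_derive_logt hp hpq t0.
  apply: (is_derive_subst (is_derive_add Dl (is_derive_scale (3 / 2)
    (is_derive_inv (lt0r_neq0 t0) (is_derive_id t (1 : R)))))).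
  by field; rewrite gt_eqF.
have [||c] := @MVT R g (fun t => tau p q t - 3 / (2 * t ^+ 2)) x y xy.
- by move=> t; rewrite in_itv /= => /andP[/ltW xt _]; exact: Dg.
- apply: derivable_within_continuous => t; rewrite in_itv /= => /andP[xt _].
  by have [] := Dg _ xt.
rewrite in_itv /= => /andP[xc _] E.
have c0 : 0 < c by exact: lt_trans xc.
have le : g y - g x <= 0.
  by rewrite E mulr_le0_ge0 // ?subr_le0 ?tau_le // subr_ge0 ltW.
have := Hz _ zy; rewrite ltr_norml => /andP[h _].
have yi : 0 < y^-1 by rewrite invr_gt0 (lt_trans x0).
by move: le h; rewrite {1}/g; lra.
Qed.

Lemma rho_le (x : R) : P <= x -> rho p q x <= 3 * x ^+ 2.
Proof.
move=> Px; have P4 := P_ge4 hp hpq; have x0 : 0 < x by lra.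
have s0 := rt_gt0 hp hpq x0; have s2 := rt_sqr hp hpq x0; have a1 := r0_gt1 hp hpq.
rewrite /rho; move: (rt p q x) (Num.sqrt P) s0 s2 a1 => s a s0 s2 a1.
have h1 : x * s / a <= x * s by rewrite ler_pdivrMr ?ler_peMr ?mulr_ge0 ?ltW // (lt_trans ltr01).
have h2 : s <= 2 * x by nra.
by nra.
Qed.

Lemma rho_mono (x y : R) : 0 < x -> x <= y -> rho p q x <= rho p q y.
Proof.
move=> x0 xy; rewrite /rho lerD2l ler_wpM2r ?invr_ge0 ?sqrtr_ge0 //.
rewrite ler_pM ?(ltW x0) ?sqrtr_ge0 // /rt ler_wsqrtr //; lra.
Qed.

Lemma boundary_coord (b : 'rV[R]_3) : K b -> ~ cone_int p q b -> boundary K b.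
Proof.
by move=> Kb nb; split; [exact: subset_closure|move/interior_power_cone].
Qed.

(* Shrinking x (or y) by the factor t^p (or t^q) moves the point horizontally
   onto the upper face z = x^(1/p) y^(1/q). *)
Lemma boundary_near_face (v : 'rV[R]_3) (j : 'I_3) (k e : R) : cone_int p q v ->
  (j = 0 /\ k = p) \/ (j = 1 /\ k = q) -> v 0 j * (1 - expR (k * logW p q v)) < e ->
  exists2 b, boundary K b & `|v - b| < e.
Proof.
move=> [v0 v1 v2 W0] jk ve.
have k0 : 0 < k by case: jk => -[_ ->]; [exact: p_gt0 hp|exact: q_gt0 hp hpq].
have vj : 0 < v 0 j by case: jk => -[-> _].
have E1 : expR (k * logW p q v) < 1 by rewrite expR_lt1 pmulr_rlt0.
have d0 : 0 < v 0 j * (1 - expR (k * logW p q v)) by rewrite mulr_gt0 // subr_gt0.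
have e0 : 0 < e by exact: lt_trans ve.
pose b : 'rV[R]_3 := \row_(i < 3) (v 0 i * (if i == j then expR (k * logW p q v) else 1)).
have bE i : b 0 i = v 0 i * (if i == j then expR (k * logW p q v) else 1) by rewrite mxE.
have bp i : 0 < v 0 i -> 0 < b 0 i.
  by move=> vi; rewrite bE mulr_gt0 //; case: ifP => // _; exact: expR_gt0.
have Wb : logW p q b = 0.
  have lb i : 0 < v 0 i -> ln (b 0 i) = ln (v 0 i) + (if i == j then k * logW p q v else 0).
    move=> vi; rewrite bE; case: ifP => _; last by rewrite mulr1 addr0.
    by rewrite lnM ?posrE ?expR_gt0 // expRK.
  rewrite {1}/logW !lb //.
  have pn := lt0r_neq0 (p_gt0 hp); have qn := lt0r_neq0 (q_gt0 hp hpq).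
  by case: jk => -[-> ->] /=; rewrite /logW; field; rewrite ?pn ?qn.
exists b.
  apply: boundary_coord => [|[_ _ _]]; last by rewrite Wb ltxx.
  have b0 := bp _ v0; have b1 := bp _ v1; have b2 := bp _ v2.
  rewrite /power_cone /=; split; [rewrite (ltW b2) /=|exact: ltW|exact: ltW].
  rewrite -/(gm p q _ _) gmE // -[leLHS]lnK ?posrE // ler_expR.
  by move: Wb; rewrite /logW; lra.
apply: norm_row_lt => // i; rewrite [(v - b) _ _]mxE [(- b) _ _]mxE bE.
case: ifP => [/eqP->|_]; last by rewrite mulr1 subrr normr0.
by rewrite -[X in X - _]mulr1 -mulrBr gtr0_norm.
Qed.

Lemma boundary_near_floor (v : 'rV[R]_3) (e : R) : cone_int p q v -> v 0 2 < e ->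
  exists2 b, boundary K b & `|v - b| < e.
Proof.
move=> [v0 v1 v2 W0] ve.
pose b : 'rV[R]_3 := \row_(i < 3) (if i == 2 then 0 else v 0 i).
exists b.
  apply: boundary_coord => [|[_ _ + _]]; last by rewrite mxE /= ltxx.
  rewrite /power_cone /= !mxE /=; split; [rewrite lexx /=|exact: ltW|exact: ltW].
  by rewrite -/(gm p q _ _) ltW // gm_gt0.
apply: norm_row_lt => [|i]; first exact: lt_trans ve.
rewrite [(v - b) _ _]mxE [(- b) _ _]mxE mxE.
case: ifP => [/eqP->|_]; last by rewrite subrr normr0; exact: lt_trans ve.
by rewrite subr0 gtr0_norm.
Qed.

Lemma prod_sphere_param u : U u -> f u 0 0 * f u 0 1 * f u 0 2 = rho p q (u 0 0).
Proof.
move=> Uu; have r0 := rho_gt0 hp hpq Uu.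
have f0 := sph_gt0 hp hpq 0 Uu; have f1 := sph_gt0 hp hpq 1 Uu; have f2 := sph_gt0 hp hpq 2 Uu.
apply: ln_inj; rewrite ?posrE ?mulr_gt0 //.
by rewrite !lnM ?posrE ?mulr_gt0 // sum_ln_sphere_param.
Qed.

(* For large xi the smaller one of x, y is O(xi^(2/3)), while the face is within
   relative distance O(1/xi) *)
Lemma asymptotic_large (v : 'rV[R]_3) (x m k e : R) : cone_int p q v ->
  P <= x -> 27 * 3 * p ^+ 3 < e ^+ 3 * (4 * x) -> 0 < e -> 0 < k -> k <= p ->
  logW p q v = logt p q x -> v 0 0 * v 0 1 * v 0 2 = rho p q x ->
  0 < m -> m <= v 0 0 -> m <= v 0 1 -> m * (1 - expR (k * logW p q v)) < e.
Proof.
move=> [v0 v1 v2 W0] Px xe e0 k0 kp Wx vr m0 mv0 mv1.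
have P4 := P_ge4 hp hpq; have x0 : 0 < x by lra.
have lx := logt_ge x0; set w := logW p q v in W0 Wx *; rewrite -Wx in lx.
have x2 : 0 < 2 * x by lra.
have w12 : 2^-1 <= expR w.
  have : 3 / (2 * x) <= 2^-1 by rewrite ler_pdivrMr //; lra.
  have := expR_ge1Dx w; lra.
have m2 : m <= gm p q (v 0 0) (v 0 1).
  by rewrite -{1}(gm_diag hpq m0); apply: gm_le => //; exact: ltW.
have v2E : v 0 2 = expR w * gm p q (v 0 0) (v 0 1).
  rewrite gmE // -expRD -[LHS]lnK ?posrE //; congr expR; rewrite /w /logW; ring.
(* x and y are at least m and z is at least m / 2, while x y z = rho. *)
have m3 : m ^+ 3 <= 2 * rho p q x.
  have h2 : 2^-1 * m <= v 0 2 by rewrite v2E ler_pM // ltW.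
  have h3 : m * m <= v 0 0 * v 0 1 by rewrite ler_pM // ltW.
  have : m * m * (2^-1 * m) <= v 0 0 * v 0 1 * v 0 2 by rewrite ler_pM // ltW // mulr_gt0.
  by rewrite vr exprS expr2; lra.
have rx := rho_le Px.
have d1 : 1 - expR (k * w) <= p * (3 / (2 * x)).
  have := expR_ge1Dx (k * w).
  have : k * - w <= p * (3 / (2 * x)) by rewrite ler_pM //; lra.
  rewrite mulrN; lra.
apply: (@le_lt_trans _ _ (m * (p * (3 / (2 * x))))); first by rewrite ler_wpM2l // ltW.
have p0 := p_gt0 hp.
have d0 : 0 < p * (3 / (2 * x)) by rewrite mulr_gt0 // divr_gt0.
have H := @ltr_pXn2r R 3 isT (m * (p * (3 / (2 * x)))) e.
rewrite -H ?nnegrE ?(ltW e0) ?(ltW (mulr_gt0 m0 d0)) // exprMn.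
(* m^3 <= 2 rho <= 6 x^2. The cube of 3 p / (2 x) times 6 x^2 is 81 p^3 / (4 x), whence the
   constants in the hypothesis. *)
apply: (@le_lt_trans _ _ (6 * x ^+ 2 * (p * (3 / (2 * x))) ^+ 3)).
  rewrite ler_wpM2r ?exprn_ge0 ?(ltW d0) //; lra.
have -> : 6 * x ^+ 2 * (p * (3 / (2 * x))) ^+ 3 = 27 * 3 * p ^+ 3 / (4 * x).
  by field; rewrite gt_eqF.
by rewrite ltr_pdivrMr //; lra.
Qed.

(** For xi > X, [asymptotic_large] puts the point near the upper face whatever its norm. For xi <= X
    the product x y z is at most rho X, so a point far out has a coordinate below e and is close to
    one of the faces. *)
Lemma sphere_asymptotic : asymptotic_to_boundary K (f @` U).
Proof.
split=> [_ [u Uu <-]|e e0]; first exact: sphere_param_cone.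
have p0 := p_gt0 hp; have q0 := q_gt0 hp hpq.
have qp : q <= p by have := q_le2 hp hpq; move: hp; lra.
have e3 : 0 < e ^+ 3 * 4 by rewrite mulr_gt0 // exprn_gt0.
pose X := Num.max P ((27 * 3 * p ^+ 3 + 1) / (e ^+ 3 * 4)).
have PX : P <= X by rewrite /X le_max lexx.
have eX x : X <= x -> 27 * 3 * p ^+ 3 < e ^+ 3 * (4 * x).
  rewrite /X ge_max => /andP[_]; rewrite ler_pdivrMr // => h.
  by rewrite mulrA [_ * x]mulrC; lra.
have e2 : 0 < e ^+ 2 by rewrite exprn_gt0.
pose A := (`|rho p q X| + 1) / e ^+ 2.
have A0 : 0 < A by rewrite divr_gt0 // ltr_wpDl.
exists A => _ [u Uu <-]; set v := f u => Av.
have Cv : cone_int p q v by apply/interior_power_cone; exact: sphere_param_cone.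
have [v0 v1 v2 W0] := Cv.
have Wx : logW p q v = logt p q (u 0 0) := logW_sphere_param hp hpq Uu.
have vr : v 0 0 * v 0 1 * v 0 2 = rho p q (u 0 0) := prod_sphere_param Uu.
have [xX|Xx] := leP (u 0 0) X; last first.
  have Px : P <= u 0 0 by apply: le_trans PX (ltW Xx).
  have H := fun m k => @asymptotic_large v (u 0 0) m k e Cv Px (eX _ (ltW Xx)) e0.
  have [v01|v10] := leP (v 0 0) (v 0 1).
    by apply: (@boundary_near_face v 0 p e Cv); [left|exact: H].
  by apply: (@boundary_near_face v 1 q e Cv); [right|apply: H => //; exact: ltW].
(* z is below a weighted mean of x and y, so a large norm must come from x or y. *)
have AV : A <= v 0 0 \/ A <= v 0 1.
  have [?|vA0] := leP A (v 0 0); first by left.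
  have [?|vA1] := leP A (v 0 1); first by right.
  suff : `|v| < A by move=> /(lt_trans Av); rewrite ltxx.
  apply: norm_row_lt => //; apply: ord3_ind; rewrite gtr0_norm //.
  move: W0; rewrite logW_lt0 // => /lt_trans; apply.
  apply: (@le_lt_trans _ _ _ _ _ (gm_young hp hpq (ltW v0) (ltW v1))).
  have -> : A = p^-1 * A + q^-1 * A by rewrite -mulrDl hpq mul1r.
  by apply: ltrD; rewrite ltr_pM2l // invr_gt0.
have rA : rho p q X < A * e ^+ 2.
  by rewrite /A divfK ?gt_eqF //; have := ler_norm (rho p q X); lra.
have vX : v 0 0 * v 0 1 * v 0 2 <= rho p q X by rewrite vr; exact: rho_mono.
have small k m : 0 < k -> 0 < m -> m < e -> m * (1 - expR (k * logW p q v)) < e.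
  move=> k0 m0 me; apply: le_lt_trans me; rewrite ler_piMr ?(ltW m0) //.
case: (large_product e0 v0 v1 v2 vX rA AV) => ve.
- by apply: (@boundary_near_face v 0 p e Cv); [left|exact: small].
- by apply: (@boundary_near_face v 1 q e Cv); [right|exact: small].
- exact: boundary_near_floor.
Qed.

End Asymptotic.

Theorem mainTheorem5 (R : realType) (p q : R) (F : 'rV[R]_3 -> R)
    (hp : 2 <= p) (hpq : p^-1 + q^-1 = 1)
    (hF : canonical_potential (power_cone p q) F) :
  let K := power_cone p q in
  let U := [set u : 'rV[R]_2 | 0 < u 0 0] in
  [/\ [set v | K° v /\ F v = 0] = sphere_param p q @` U,
      immersion U (sphere_param p q) &
      complete_hyperbolic_affine_sphere K U (sphere_param p q)].
Proof.
move=> K U; have immf : immersion U (sphere_param p q) := sphere_param_immersion hp hpq.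
have FE := canonical_potentialE hp hpq hF.
split=> //.
  apply/seteqP; split=> [v [Kv Fv]|_ [u Uu <-]].
    by apply: sphere_param_surj => //; rewrite -FE.
  by have Ku := sphere_param_cone hp hpq Uu; split=> //; rewrite FE // sphere_param_potential.
split=> //.
- exact: sphere_convex_hypersurface.
- exact: sphere_separates.
- exact: sphere_asymptotic.
- exists (sph_normal p q), (sph_metric p q); split.
  + exact: sph_affine_normal.
  + by move=> u _; exact: sph_center.
  + exact: sph_metric_complete.
Qed.
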